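(* The strictly contact homeomorphism groups $\mathrm{Homeo}_{(1,\infty)}(M,\alpha)$ and $\mathrm{Homeo}_\infty(M,\alpha)$ coincide.
   Context: Setting. $M$ is a closed (compact, without boundary), connected smooth manifold of dimension $2n+1$ with a cooriented contact structure $\xi=\ker\alpha$, where $\alpha$ is a fixed contact form with Reeb vector field $R$, and $\nu_\alpha=\alpha\wedge(d\alpha)^n$. A smooth strictly contact isotopy is a smooth isotopy $\Phi=\{\phi_t\}_{0\le t\le1}$ with $\phi_0=\mathrm{id}$ and $\phi_t^*\alpha=\alpha$ for all $t$; if $\frac{d}{dt}\phi_t=X_t\circ\phi_t$, its Hamiltonian is $H_t=\alpha(X_t)$, and one writes $\Phi=\Phi_H=\{\phi_H^t\}$. The Hamiltonians so obtained are exactly the smooth basic functions $H\colon[0,1]\times M\to\mathbb R$, i.e. those with $dH_t(R)=0$ for all $t$. Then $(\Phi_H,H)$ is called a smooth strictly contact dynamical system. Norms. For a function $H$ on $M$, $\|H\|=\max_M H-\min_M H+\left|\frac{1}{\int_M\nu_\alpha}\int_M H\,\nu_\alpha\right|$. For $H\colon[0,1]\times M\to\mathbb R$, $\|H\|_{(1,\infty)}=\int_0^1\|H_t\|\,dt$ and $\|H\|_\infty=\max_{0\le t\le1}\|H_t\|$. Topological and continuous systems. A pair $(\Phi,H)$ of a continuous isotopy of homeomorphisms $\Phi$ and a function $H\colon[0,1]\times M\to\mathbb R$ is a topological strictly contact dynamical system if there are smooth strictly contact dynamical systems $(\Phi_{H_i},H_i)$ with $\Phi_{H_i}\to\Phi$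 uniformly and $\|H-H_i\|_{(1,\infty)}\to0$ ($H$ being an element of $L^1([0,1],C^0(M))$). It is a continuous strictly contact dynamical system if there is such a sequence with $\|H-H_i\|_\infty\to0$ instead. The isotopy $\Phi$ is then written $\Phi_H=\{\phi_H^t\}$ and its time-one map is $\phi_H^1$. $\mathrm{Homeo}_{(1,\infty)}(M,\alpha)$ is the group of time-one maps of topological strictly contact dynamical systems, and $\mathrm{Homeo}_\infty(M,\alpha)$ is the group of time-one maps of continuous strictly contact dynamical systems. *)

(* Defs.v *)
From HB Require Import structures.
From mathcomp Require Import all_boot all_order all_algebra all_fingroup.
From mathcomp Require Import all_classical all_reals all_analysis.

Set Implicit Arguments.
Unset Strict Implicit.
Unset Printing Implicit Defensive.

Import Order.TTheory GRing.Theory Num.Theory.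
Import numFieldNormedType.Exports.

Local Open Scope classical_set_scope.
Local Open Scope ring_scope.

(** * Smooth functions on subsets of R^m *)

Definition partial (R : realType) (m : nat) (i : 'I_m) (f : 'rV[R]_m -> R) :
    'rV[R]_m -> R :=
  fun x => 'D_(delta_mx 0 i) f x.

Definition iter_partial (R : realType) (m : nat) (s : seq 'I_m)
    (f : 'rV[R]_m -> R) : 'rV[R]_m -> R :=
  foldr (@partial R m) f s.

(* All partial derivatives of all orders exist and are continuous on [V],
   which is meant to be open. *)
Definition Cinfty_on (R : realType) (m : nat) (V : set 'rV[R]_m)
    (f : 'rV[R]_m -> R) : Prop :=
  forall (s : seq 'I_m) (x : 'rV[R]_m), V x ->
    {for x, continuous (iter_partial s f)} /\
    (forall i : 'I_m, derivable (iter_partial s f) x (delta_mx 0 i)).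

(* On an arbitrary subset [A], smooth means locally extendable to a smooth
   function on an open set; for open [A] this is [Cinfty_on].  The general
   case is needed for [0,1] x M, a manifold with boundary. *)
Definition smooth_on (R : realType) (m : nat) (A : set 'rV[R]_m)
    (f : 'rV[R]_m -> R) : Prop :=
  forall x, A x -> exists (V : set 'rV[R]_m) (g : 'rV[R]_m -> R),
    [/\ open V, V x, Cinfty_on V g & forall y, A y -> V y -> f y = g y].

Definition smooth_vec_on (R : realType) (m k : nat) (A : set 'rV[R]_m)
    (f : 'rV[R]_m -> 'rV[R]_k) : Prop :=
  forall j : 'I_k, smooth_on A (fun x => f x 0 j).

(** * Smooth manifolds *)

(* [chart_map] and [chart_inv] are total functions, meaningful only on
   [chart_dom] and on its image respectively. *)
Record chart (R : realType) (M : topologicalType) (m : nat) := Chart {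
  chart_dom : set M;
  chart_map : M -> 'rV[R]_m;
  chart_inv : 'rV[R]_m -> M;
  chart_dom_open : open chart_dom;
  chart_img_open : open (chart_map @` chart_dom);
  chart_mapK : forall p, chart_dom p -> chart_inv (chart_map p) = p;
  chart_map_continuous : forall p, chart_dom p ->
    {for p, continuous chart_map};
  chart_inv_continuous : forall x, (chart_map @` chart_dom) x ->
    {for x, continuous chart_inv}
}.

Definition chart_img (R : realType) (M : topologicalType) (m : nat)
    (c : chart R M m) : set 'rV[R]_m :=
  chart_map c @` chart_dom c.

Record smooth_atlas (R : realType) (M : topologicalType) (m : nat) :=
  SmoothAtlas {
  atlas_index : Type;
  atlas_chart :> atlas_index -> chart R M m;
  atlas_cover : forall p : M, exists i, chart_dom (atlas_chart i) p;
  atlas_smooth : forall i j,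
    smooth_vec_on
      (chart_map (atlas_chart i) @`
         (chart_dom (atlas_chart i) `&` chart_dom (atlas_chart j)))
      (fun x => chart_map (atlas_chart j) (chart_inv (atlas_chart i) x))
}.

Definition smooth_map (R : realType) (M : topologicalType) (m : nat)
    (A : smooth_atlas R M m) (f : M -> M) : Prop :=
  continuous f /\
  forall i j : atlas_index A,
    smooth_vec_on
      [set x | chart_img (A i) x /\ chart_dom (A j) (f (chart_inv (A i) x))]
      (fun x => chart_map (A j) (f (chart_inv (A i) x))).

Definition diffeomorphism (R : realType) (M : topologicalType) (m : nat)
    (A : smooth_atlas R M m) (f : M -> M) : Prop :=
  exists g : M -> M,
    [/\ smooth_map A f, smooth_map A g, cancel f g & cancel g f].

(** * Differential 1-forms and contact forms *)

(* In the chart [A i] the form is sum_k a_k dx_k, where the column vector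
   [form_coef i x] collects the a_k at the coordinate point x.  Its value on
   the tangent vector with coordinates v : 'rV_m is [v *m form_coef i x].
   With the row-vector convention ('d f x v = v *m 'J f x) of the library,
   the pull-back of a column b by f is ['J f x *m b]. *)
Record one_form (R : realType) (M : topologicalType) (m : nat)
    (A : smooth_atlas R M m) := OneForm {
  form_coef : atlas_index A -> 'rV[R]_m -> 'cV[R]_m;
  form_smooth : forall i (k : 'I_m),
    smooth_on (chart_img (A i)) (fun x => form_coef i x k 0);
  form_compat : forall i j p, chart_dom (A i) p -> chart_dom (A j) p ->
    form_coef i (chart_map (A i) p) =
      'J (fun x => chart_map (A j) (chart_inv (A i) x)) (chart_map (A i) p)
        *m form_coef j (chart_map (A j) p)
}.

(* f^* alpha = alpha *)
Definition preserves_form (R : realType) (M : topologicalType) (m : nat)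
    (A : smooth_atlas R M m) (alpha : one_form A) (f : M -> M) : Prop :=
  forall i j p, chart_dom (A i) p -> chart_dom (A j) (f p) ->
    'J (fun x => chart_map (A j) (f (chart_inv (A i) x))) (chart_map (A i) p)
      *m form_coef alpha j (chart_map (A j) (f p))
    = form_coef alpha i (chart_map (A i) p).

(* Entry (k, l) is d alpha (e_k, e_l) in the chart [A i]. *)
Definition d_form (R : realType) (M : topologicalType) (m : nat)
    (A : smooth_atlas R M m) (alpha : one_form A) (i : atlas_index A)
    (x : 'rV[R]_m) : 'M[R]_m :=
  \matrix_(k, l) (partial k (fun y => form_coef alpha i y l 0) x
                  - partial l (fun y => form_coef alpha i y k 0) x).

(* (alpha /\ (d alpha)^n)(e_0, ..., e_2n) in the chart [A i], i.e. the
   coefficient of nu_alpha with respect to dx_0 /\ ... /\ dx_2n.  The wedge of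
   forms of degrees p_1, ..., p_r is 1/(p_1! ... p_r!) times the alternating
   sum over all permutations; here this factor is 1/2^n. *)
Definition vol_coef (R : realType) (M : topologicalType) (n : nat)
    (A : smooth_atlas R M n.*2.+1) (alpha : one_form A) (i : atlas_index A)
    (x : 'rV[R]_n.*2.+1) : R :=
  2 ^- n * \sum_(s : 'S_n.*2.+1) (-1) ^+ s * form_coef alpha i x (s ord0) 0 *
    \prod_(k < n) d_form alpha i x (s (inord k.*2.+1)) (s (inord k.*2.+2)).

Definition contact_form (R : realType) (M : topologicalType) (n : nat)
    (A : smooth_atlas R M n.*2.+1) (alpha : one_form A) : Prop :=
  forall i x, chart_img (A i) x -> vol_coef alpha i x != 0.

(** * Integration against nu_alpha *)

(* Integral over R^m as an iterated integral; it is applied below to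
   continuous functions with compact support only. *)
Fixpoint integral_Rm (R : realType) (m : nat) : ('rV[R]_m -> R) -> R :=
  match m return ('rV[R]_m -> R) -> R with
  | 0 => fun f => f 0
  | k.+1 => fun f =>
      \int[@lebesgue_measure R]_t
        integral_Rm (fun y : 'rV[R]_k => f (row_mx (t%:M : 'rV[R]_1) y))
  end.

Definition partition_of_unity (R : realType) (M : topologicalType) (m : nat)
    (A : smooth_atlas R M m) (N : nat) (ix : 'I_N -> atlas_index A)
    (rho : 'I_N -> M -> R) : Prop :=
  [/\ forall k, continuous (rho k),
      forall k p, 0 <= rho k p,
      forall p, \sum_(k < N) rho k p = 1
    & forall k, closure [set p | rho k p != 0] `<=` chart_dom (A (ix k))].

(* M carries the orientation for which nu_alpha is positive, so that in every
   chart nu_alpha integrates like the density |vol_coef|. *)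
Definition integral_with (R : realType) (M : topologicalType) (n : nat)
    (A : smooth_atlas R M n.*2.+1) (alpha : one_form A) (N : nat)
    (ix : 'I_N -> atlas_index A) (rho : 'I_N -> M -> R) (f : M -> R) : R :=
  \sum_(k < N) integral_Rm
    ((fun x => let p := chart_inv (A (ix k)) x in
               rho k p * f p * `|vol_coef alpha (ix k) x|)
       \_ (chart_img (A (ix k)))).

(* The functional f |-> \int_M f nu_alpha on continuous functions, computed
   with some partition of unity: on a closed manifold one exists, and the
   value on a continuous function does not depend on it. *)
Definition form_integral (R : realType) (M : topologicalType) (n : nat)
    (A : smooth_atlas R M n.*2.+1) (alpha : one_form A) : (M -> R) -> R :=
  xget (fun=> 0) [set I : (M -> R) -> R |
    exists (N : nat) (ix : 'I_N -> atlas_index A) (rho : 'I_N -> M -> R),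
      partition_of_unity ix rho /\ I = integral_with alpha ix rho].

(** * Norms *)

Definition ham_norm (R : realType) (M : topologicalType) (n : nat)
    (A : smooth_atlas R M n.*2.+1) (alpha : one_form A) (f : M -> R) : R :=
  sup (range f) - inf (range f)
  + `|(form_integral alpha (fun=> 1))^-1 * form_integral alpha f|.

Definition norm_1oo (R : realType) (M : topologicalType) (n : nat)
    (A : smooth_atlas R M n.*2.+1) (alpha : one_form A) (H : R -> M -> R) :
    \bar R :=
  (\int[@lebesgue_measure R]_(t in `[0%R, 1%R]) (ham_norm alpha (H t))%:E)%E.

Definition norm_oo (R : realType) (M : topologicalType) (n : nat)
    (A : smooth_atlas R M n.*2.+1) (alpha : one_form A) (H : R -> M -> R) : R :=
  sup [set ham_norm alpha (H t) | t in `[0, 1]].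

(** * Strictly contact isotopies *)

(* Time-dependent objects are total in t : R; only t in [0, 1] matters. *)
Definition continuous_isotopy (R : realType) (M : topologicalType)
    (Phi : R -> M -> M) : Prop :=
  [/\ {within `[0, 1] `*` [set: M], continuous (fun z : R * M => Phi z.1 z.2)},
      forall t : R, t \in `[0, 1] -> exists g : M -> M,
        [/\ continuous (Phi t), continuous g, cancel (Phi t) g
          & cancel g (Phi t)]
    & Phi 0 = id].

(* The smoothness in (t, x) is stated in coordinates z = (t, x) : R^(1 + m). *)
Definition smooth_isotopy (R : realType) (M : topologicalType) (m : nat)
    (A : smooth_atlas R M m) (Phi : R -> M -> M) : Prop :=
  [/\ {within `[0, 1] `*` [set: M], continuous (fun z : R * M => Phi z.1 z.2)},
      forall i j : atlas_index A,
        let F := fun z : 'rV[R]_(1 + m) =>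
          Phi (lsubmx z 0 0) (chart_inv (A i) (rsubmx z)) in
        smooth_vec_on
          [set z | [/\ lsubmx z 0 0 \in `[0, 1], chart_img (A i) (rsubmx z)
                     & chart_dom (A j) (F z)]]
          (fun z => chart_map (A j) (F z)),
      forall t : R, t \in `[0, 1] -> diffeomorphism A (Phi t)
    & Phi 0 = id].

Definition strictly_contact_isotopy (R : realType) (M : topologicalType)
    (m : nat) (A : smooth_atlas R M m) (alpha : one_form A)
    (Phi : R -> M -> M) : Prop :=
  smooth_isotopy A Phi /\
  forall t : R, t \in `[0, 1] -> preserves_form alpha (Phi t).

(* [X t j q] is the coordinate vector, in the chart [A j], of X_t at q; the
   derivative in time is one-sided at t = 0 and t = 1. *)
Definition generated_by (R : realType) (M : topologicalType) (m : nat)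
    (A : smooth_atlas R M m) (Phi : R -> M -> M)
    (X : R -> atlas_index A -> M -> 'rV[R]_m) : Prop :=
  forall (t : R) j p, t \in `[0, 1] -> chart_dom (A j) (Phi t p) ->
    (s - t)^-1 *: (chart_map (A j) (Phi s p) - chart_map (A j) (Phi t p))
      @[s --> within `[0, 1] t^'] --> X t j (Phi t p).

(* H_t = alpha(X_t) *)
Definition hamiltonian_of (R : realType) (M : topologicalType) (m : nat)
    (A : smooth_atlas R M m) (alpha : one_form A) (Phi : R -> M -> M)
    (H : R -> M -> R) : Prop :=
  exists2 X : R -> atlas_index A -> M -> 'rV[R]_m, generated_by Phi X &
    forall (t : R) j q, t \in `[0, 1] -> chart_dom (A j) q ->
      H t q = (X t j q *m form_coef alpha j (chart_map (A j) q)) 0 0.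

Definition smooth_system (R : realType) (M : topologicalType) (m : nat)
    (A : smooth_atlas R M m) (alpha : one_form A) (Phi : R -> M -> M)
    (H : R -> M -> R) : Prop :=
  strictly_contact_isotopy alpha Phi /\ hamiltonian_of alpha Phi H.

(** * Topological and continuous strictly contact systems *)

Definition simple_C0 (R : realType) (M : topologicalType) (S : R -> M -> R) :
    Prop :=
  exists (N : nat) (B : 'I_N -> set R) (g : 'I_N -> M -> R),
    [/\ forall k, measurable (B k), forall k, continuous (g k)
      & forall t x, S t x = \sum_(k < N) \1_(B k) t * g k x].

(* Bochner integrability: H represents an element of L^1([0,1], C^0(M)). *)
Definition in_L1C0 (R : realType) (M : topologicalType) (n : nat)
    (A : smooth_atlas R M n.*2.+1) (alpha : one_form A) (H : R -> M -> R) :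
    Prop :=
  [/\ {ae @lebesgue_measure R, forall t : R, t \in `[0, 1] ->
        continuous (H t)},
      exists S : nat -> R -> M -> R, (forall k, simple_C0 (S k)) /\
        {ae @lebesgue_measure R, forall t : R, t \in `[0, 1] ->
          {uniform, (fun k => S k t) @ \oo --> H t}}
    & (norm_1oo alpha H < +oo)%E].

Definition isotopy_cvg (R : realType) (M : metricType R)
    (Phi_ : nat -> R -> M -> M) (Phi : R -> M -> M) : Prop :=
  {uniform `[0, 1] `*` [set: M],
    (fun i (z : R * M) => Phi_ i z.1 z.2) @ \oo --> (fun z => Phi z.1 z.2)}.

Definition topological_system (R : realType) (M : metricType R) (n : nat)
    (A : smooth_atlas R M n.*2.+1) (alpha : one_form A) (Phi : R -> M -> M)
    (H : R -> M -> R) : Prop :=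
  [/\ continuous_isotopy Phi, in_L1C0 alpha H &
    exists (Phi_ : nat -> R -> M -> M) (H_ : nat -> R -> M -> R),
      [/\ forall i, smooth_system alpha (Phi_ i) (H_ i),
          isotopy_cvg Phi_ Phi
        & norm_1oo alpha (fun t x => H t x - H_ i t x) @[i --> \oo] --> 0%E]].

(* The continuity of H, automatic for a uniform limit of the H_i, makes the
   suprema in [norm_oo] genuine maxima. *)
Definition continuous_system (R : realType) (M : metricType R) (n : nat)
    (A : smooth_atlas R M n.*2.+1) (alpha : one_form A) (Phi : R -> M -> M)
    (H : R -> M -> R) : Prop :=
  [/\ continuous_isotopy Phi,
      {within `[0, 1] `*` [set: M], continuous (fun z : R * M => H z.1 z.2)} &
    exists (Phi_ : nat -> R -> M -> M) (H_ : nat -> R -> M -> R),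
      [/\ forall i, smooth_system alpha (Phi_ i) (H_ i),
          isotopy_cvg Phi_ Phi
        & norm_oo alpha (fun t x => H t x - H_ i t x) @[i --> \oo] --> 0]].

Definition Homeo_1oo (R : realType) (M : metricType R) (n : nat)
    (A : smooth_atlas R M n.*2.+1) (alpha : one_form A) : set (M -> M) :=
  [set phi | exists Phi H, topological_system alpha Phi H /\ phi = Phi 1].

Definition Homeo_oo (R : realType) (M : metricType R) (n : nat)
    (A : smooth_atlas R M n.*2.+1) (alpha : one_form A) : set (M -> M) :=
  [set phi | exists Phi H, continuous_system alpha Phi H /\ phi = Phi 1].

(* Main.v *)
(* A continuous system is a topological one because a continuous Hamiltonian
   is Bochner integrable and the L^(1,oo) norm is bounded by the L^oo norm.

   Conversely, let (Phi, H) be the limit of smooth systems (phi^i, H^i) in the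
   L^(1,oo) sense.  Passing to a subsequence, the integrals over [0,1] of
   sup |H^(i+1)_t - H^i_t| decrease as fast as we please.  The isotopy
   t |-> (phi^i_t)^-1 o phi^(i+1)_t is generated by
   (H^(i+1)_t - H^i_t) o phi^i_t; a time change that slows down where this is
   large makes it pointwise small, although it is performed during the short
   time interval [1 - 1/(i+1), 1 - 1/(i+2)].  Concatenating these isotopies
   for i = 0, 1, ... gives an isotopy that runs through phi^0_1, phi^1_1, ...
   and ends at Phi_1, whose Hamiltonian is a uniform limit of smooth ones. *)
From HB Require Import structures.
Require Import Defs.
From mathcomp Require Import all_boot all_order all_algebra all_fingroup.
From mathcomp Require Import all_classical all_reals all_analysis.
From mathcomp Require Import measurable_realfun ring lra.
Import numFieldNormedType.Exports.

Set Implicit Arguments.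
Unset Strict Implicit.
Unset Printing Implicit Defensive.

Import Order.TTheory GRing.Theory Num.Theory.

Local Open Scope classical_set_scope.
Local Open Scope ring_scope.

(** * Differentiability in R^m *)

(** The given isotopies live on [0,1], with one-sided derivatives at the ends. The time change
    removes this boundary: a smooth [tau] from R into [0,1] yields a family that is smooth for all
    times, and the approximating systems of the concatenated isotopy are finite compositions of such
    families and their inverses ([flow]). These inverses are continuous by compactness, and their
    smoothness is bootstrapped from continuity.

    The second obstacle is measurability: H is only almost everywhere a limit of simple functions,
    and the integrand in its distance to H^i is not known to be measurable. The Cauchy property is
    therefore derived from suprema over a countable dense set.

    Stage k lasts a time d_k, and the time change bounds its Hamiltonian by C eps_k / d_k. The
    choice eps_k = d_k^2 / C turns this into d_k, and these lengths telescope. Each finite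
    concatenation is smooth up to time 1, and together they form the approximating sequence. They
    converge uniformly near time 1 because at every instant only one stage is in progress, and it
    moves points little. *)

Lemma near_forall (T : topologicalType) (I : finType) (x : T) (P : I -> T -> Prop) :
  (forall i, \forall y \near x, P i y) -> \forall y \near x, forall i, P i y.
Proof. exact: filter_forall. Qed.

Section Differentiability.
Context {R : realType}.

Lemma diff_epsP (V W : normedModType R) (f : V -> W) (x : V)
    (L : {linear V -> W}) : continuous L ->
  (forall e : R, 0 < e -> \forall h \near 0, `|f (h + x) - f x - L h| <= e * `|h|) ->
  differentiable f x /\ 'd f x = L :> (V -> W).
Proof.
move=> cL fL.
have H : f \o shift x = cst (f x) + L +o_ 0 id.
  apply/eqaddoP => e e0; near=> h.
  rewrite /= (_ : (f \o shift x - (cst (f x) + L)) h = f (h + x) - f x - L h).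
    by near: h; apply: fL.
  by rewrite /GRing.add /GRing.opp /= /cst opprD addrA.
have dE := diff_unique cL H; split=> //.
by apply/diff_locallyP; rewrite dE.
Unshelve. all: by end_near. Qed.

Lemma diff_eps (V W : normedModType R) (f : V -> W) (x : V) :
  differentiable f x -> forall e : R, 0 < e ->
  \forall h \near 0, `|f (h + x) - f x - 'd f x h| <= e * `|h|.
Proof.
move=> /diff_locally /eqaddoP fx e e0.
near=> h.
rewrite (_ : f (h + x) - f x - 'd f x h = (f \o shift x - (cst (f x) + 'd f x)) h).
  by near: h; apply: fx.
by rewrite /GRing.add /GRing.opp /= /cst opprD addrA.
Unshelve. all: by end_near. Qed.

Lemma coord_le_norm m (v : 'rV[R]_m) j : `|v 0 j| <= `|v|.
Proof.
rewrite [leRHS]/Num.Def.normr/= mx_normrE.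
exact: (le_bigmax _ (fun ij : 'I_1 * 'I_m => `|v ij.1 ij.2|) (0, j)).
Qed.

Lemma norm_le_coord m (v : 'rV[R]_m) (c : R) : 0 <= c ->
  (forall j, `|v 0 j| <= c) -> `|v| <= c.
Proof.
move=> c0 vc; rewrite [leLHS]/Num.Def.normr/= mx_normrE.
by apply: bigmax_le => // -[i j] _; rewrite /= ord1.
Qed.

(** The estimate for one edge of an axis-parallel path, obtained from the mean value theorem. The
    condition [|s| <= |b|] covers both signs of [b]. *)
Lemma mean_value_le (f df : R -> R) (b g e : R) :
  (forall s : R, `|s| <= `|b| -> is_derive s 1 f (df s) /\ `|df s - g| <= e) ->
  `|f b - f 0 - b * g| <= e * `|b|.
Proof.
move=> H.
have der (s : R) : `|s| <= `|b| -> is_derive s 1 f (df s) by move=> /H[].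
have cont (s : R) : `|s| <= `|b| -> {for s, continuous f}.
  move=> /der[+ _]; move=> /derivable1_diffP; exact: differentiable_continuous.
have cw (u v : R) : `|u| <= `|b| -> `|v| <= `|b| -> {within `[u, v], continuous f}.
  move=> ub vb; apply: continuous_in_subspaceT => s; rewrite inE/= in_itv/= => /andP[us sv].
  apply: cont; rewrite ler_norml; move: ub vb; rewrite !ler_norml.
  by move=> /andP[? ?] /andP[? ?]; apply/andP; split; lra.
have b0 : `|0 : R| <= `|b| by rewrite normr0.
have oo (u v s : R) : `|u| <= `|b| -> `|v| <= `|b| -> s \in `]u, v[ -> `|s| <= `|b|.
  rewrite in_itv/= => ub vb /andP[us sv].
  rewrite ler_norml; move: ub vb; rewrite !ler_norml.
  by move=> /andP[? ?] /andP[? ?]; apply/andP; split; lra.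
have [b1|b1|<-] := ltgtP 0 b; last by rewrite mul0r subrr subr0 normr0 mulr0.
- have [c cab ->] := MVT b1 (fun s h => der s (oo _ _ s b0 (lexx _) h)) (cw _ _ b0 (lexx _)).
  have [_ dc] := H c (oo _ _ _ b0 (lexx _) cab).
  by rewrite subr0 [df c * b]mulrC -mulrBr normrM mulrC ler_wpM2r.
- have [c cab Hc] := MVT b1 (fun s h => der s (oo _ _ s (lexx _) b0 h)) (cw _ _ (lexx _) b0).
  have [_ dc] := H c (oo _ _ _ (lexx _) b0 cab).
  have -> : f b - f 0 - b * g = b * (df c - g) by rewrite -[f b - f 0]opprB Hc; ring.
  by rewrite normrM mulrC ler_wpM2r.
Qed.

Lemma derivable_line (V W : normedModType R) (f : V -> W) (y d : V) (s : R) :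
  derivable f (s *: d + y) d ->
  is_derive s 1 (fun s : R => f (s *: d + y)) ('D_d f (s *: d + y)).
Proof.
have E : (fun h : R => h^-1 *: (f ((h *: 1 + s) *: d + y) - f (s *: d + y)))
     = (fun h : R => h^-1 *: (f (h *: d + (s *: d + y)) - f (s *: d + y))).
  by apply/funext => h; rewrite [h *: 1]mulr1 scalerDl addrA.
move=> df; apply: DeriveDef; first by rewrite /derivable/= E.
by rewrite /derive/= E.
Qed.

(** For k from 0 to m these vectors are the vertices of an axis-parallel path from 0 to [h]. *)
Definition trunc m (k : nat) (h : 'rV[R]_m) : 'rV[R]_m :=
  \row_j (if (j < k)%N then h 0 j else 0).

Lemma truncS m (k : 'I_m) (h : 'rV[R]_m) :
  trunc k.+1 h = h 0 k *: delta_mx 0 k + trunc k h.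
Proof.
apply/rowP => j; rewrite !mxE eqxx/= ltnS.
have [->|jk] := eqVneq j k; first by rewrite leqnn ltnn mulr1 addr0.
by rewrite mulr0 add0r leq_eqVlt val_eqE (negbTE jk).
Qed.

(** The increment of [f] telescopes along the vertices [trunc k h]. On each edge a single coordinate
    moves, and the mean value estimate compares the increment with the partial derivative at [x]. *)
Lemma differentiable_C1 m (f : 'rV[R]_m -> R) (x : 'rV[R]_m) :
  (\forall y \near x, forall i, derivable f y (delta_mx 0 i)) ->
  (forall i, {for x, continuous (partial i f)}) -> differentiable f x.
Proof.
move=> df cf.
pose g := fun h : 'rV[R]_m => \sum_i h 0 i * partial i f x.
have glin : linear g.
  move=> a u v; rewrite /g scaler_sumr -big_split/=; apply: eq_bigr => i _.
  by rewrite !mxE mulrDl /GRing.scale/= mulrA.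
pose gM := GRing.isLinear.Build _ _ _ _ _ glin.
pose L : {linear 'rV[R]_m -> R} := HB.pack g gM.
have cL : continuous L.
  rewrite -[continuous _]/(continuous g); apply: continuous_big.
    exact: add_continuous.
  by move=> i _ v; apply: (@cvgM _ _ (nbhs v) _ (fun w : 'rV[R]_m => w 0 i) (fun=> partial i f x) _ _ _ (cvg_cst _)); apply: coord_continuous.
apply: (proj1 (diff_epsP cL _)).
move=> e e0.
(* Each of the m edges may contribute [e'] times the norm of [h]; dividing by m + 1 also covers m =
   0. *)
pose e' := e / m.+1%:R.
have e'0 : 0 < e' by rewrite divr_gt0.
pose P i y := derivable f y (delta_mx 0 i) /\ `|partial i f y - partial i f x| <= e'.
have : \forall y \near x, forall i, P i y.
  apply: near_forall => i.
  have cfi : \forall y \near x, `|partial i f x - partial i f y| <= e'.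
    by have /cvgrPdist_le/(_ _ e'0) := cf i.
  near=> y; split; first by move: (i); near: y.
  by rewrite distrC; near: y.
move=> /nbhs_normP[d/= d0 dH]; apply/nbhs_normP; exists d => //= h.
rewrite /ball_/= sub0r normrN => hd.
have tr k : `|trunc k h| <= `|h|.
  apply: norm_le_coord => // j; rewrite mxE; case: ifP => _; first exact: coord_le_norm.
  by rewrite normr0.
have -> : f (h + x) - f x - g h =
    \sum_(k < m) (f (trunc k.+1 h + x) - f (trunc k h + x) - h 0 k * partial k f x).
  rewrite big_split/= sumrN; congr (_ - _).
  rewrite -(big_mkord xpredT (fun k => f (trunc k.+1 h + x) - f (trunc k h + x))).
  rewrite telescope_sumr//; congr (f (_ + _) - f _).
    by apply/rowP => j; rewrite mxE ltn_ord.
  by rewrite -[LHS]add0r; congr (_ + _); apply/rowP => j; rewrite !mxE.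
apply: le_trans (ler_norm_sum _ _ _) _.
apply: (@le_trans _ _ (\sum_(k < m) e' * `|h|)); last first.
  rewrite sumr_const card_ord -mulrnAl ler_wpM2r// /e' -mulr_natr mulrAC -mulrA.
  by rewrite ger_pMr// ler_pdivrMr// mul1r ler_nat.
apply: ler_sum => k _; rewrite truncS.
apply: (@le_trans _ _ (e' * `|h 0 k|)); last by rewrite ler_wpM2l ?coord_le_norm// ltW.
pose y := trunc k h + x.
have := @mean_value_le (fun s : R => f (s *: delta_mx 0 k + y))
   (fun s => partial k f (s *: delta_mx 0 k + y)) (h 0 k) (partial k f x) e'.
rewrite scale0r add0r addrA; apply=> s sh.
(* In the maximum norm a vector whose coordinates are bounded by those of [h] is no longer than [h],
   so the whole edge stays in the ball where the partial derivatives are controlled. *)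
have /dH/(_ k)[ds de] : `|x - (s *: delta_mx 0 k + y)| < d; last first.
  by have := @derivable_line _ _ f y (delta_mx 0 k) s ds; split.
rewrite /y addrA opprD addrCA subrr addr0 normrN.
apply: le_lt_trans hd; apply: norm_le_coord => // j.
rewrite !mxE eqxx/=; have [->|jk] := eqVneq j k.
  by rewrite ltnn mulr1 addr0 (le_trans sh)// coord_le_norm.
rewrite mulr0 add0r; case: ifP => _; first exact: coord_le_norm.
by rewrite normr0.
Unshelve. all: by end_near. Qed.

Lemma differentiable_rV (V : normedModType R) m (f : V -> 'rV[R]_m) (x : V) :
  (forall j, differentiable (fun y => f y 0 j) x) -> differentiable f x.
Proof.
move=> df.
rewrite (_ : f = \sum_j (fun y => f y 0 j *: (delta_mx 0 j : 'rV[R]_m))).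
  by apply: differentiable_sum => j; exact: differentiableZl.
apply/funext => y; rewrite fct_sumE; exact: row_sum_delta.
Qed.

Lemma diff_coord (V : normedModType R) m (f : V -> 'rV[R]_m) (x : V) j :
  differentiable f x -> differentiable (fun y => f y 0 j) x.
Proof.
move=> df; apply: (@differentiable_comp _ _ _ _ f (fun v : 'rV[R]_m => v 0 j)) => //.
exact: differentiable_coord.
Qed.

Lemma derive_coord (V : normedModType R) m (f : V -> 'rV[R]_m) (x v : V) j :
  differentiable f x -> 'D_v (fun y => f y 0 j) x = ('D_v f x) 0 j.
Proof. by move=> df; rewrite derive_mx ?mxE//; exact: diff_derivable. Qed.

Lemma derive_partial m (f : 'rV[R]_m -> R) (x v : 'rV[R]_m) :
  differentiable f x -> 'D_v f x = \sum_i v 0 i * partial i f x.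
Proof.
move=> df; rewrite deriveE// {1}(row_sum_delta v) linear_sum; apply: eq_bigr => i _.
by rewrite linearZ /partial deriveE.
Qed.

Lemma chain_derive (V : normedModType R) m (f : 'rV[R]_m -> R) (g : V -> 'rV[R]_m)
    (x v : V) : differentiable g x -> differentiable f (g x) ->
  'D_v (f \o g) x = \sum_j 'D_v (fun y => g y 0 j) x * partial j f (g x).
Proof.
move=> dg df; have dfg := differentiable_comp dg df.
rewrite (deriveE v dfg) (diff_comp dg df).
have -> : ('d f (g x) \o 'd g x) v = 'd f (g x) ('D_v g x) by rewrite (deriveE v dg).
rewrite -(deriveE _ df) (derive_partial _ df); apply: eq_bigr => j _.
by rewrite (derive_coord v j dg).
Qed.

End Differentiability.

(** * Functions of class C^k near a point *)

Lemma near_all (T : topologicalType) (x : T) (P : T -> Prop) :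
  (forall y, P y) -> \forall y \near x, P y.
Proof. by move=> HP; apply: filterE. Qed.

Lemma for_continuousD (R : realType) (T : topologicalType) (f g : T -> R) (x : T) :
  {for x, continuous f} -> {for x, continuous g} ->
  {for x, continuous (fun y => f y + g y)}.
Proof. by move=> cf cg; apply: cvgD. Qed.

Lemma for_continuousB (R : realType) (T : topologicalType) (f g : T -> R) (x : T) :
  {for x, continuous f} -> {for x, continuous g} ->
  {for x, continuous (fun y => f y - g y)}.
Proof. by move=> cf cg; apply: cvgB. Qed.

Lemma for_continuousM (R : realType) (T : topologicalType) (f g : T -> R) (x : T) :
  {for x, continuous f} -> {for x, continuous g} ->
  {for x, continuous (fun y => f y * g y)}.
Proof. by move=> cf cg; apply: cvgM. Qed.

Lemma for_continuous_sum (R : realType) (T : topologicalType) (I : Type) (r : seq I)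
    (f : I -> T -> R) (x : T) : (forall i, {for x, continuous (f i)}) ->
  {for x, continuous (fun y => \sum_(i <- r) f i y)}.
Proof.
move=> cf; elim: r => [|i r IH].
  rewrite (_ : (fun _ => _) = fun=> 0); first exact: cst_continuous.
  by apply/funext => y; rewrite big_nil.
rewrite (_ : (fun _ => _) = fun y => f i y + \sum_(i <- r) f i y).
  exact: for_continuousD.
by apply/funext => y; rewrite big_cons.
Qed.

Lemma for_continuousV (R : realType) (T : topologicalType) (f : T -> R) (x : T) :
  f x != 0 -> {for x, continuous f} -> {for x, continuous (fun y => (f y)^-1)}.
Proof. by move=> fx cf; apply: cvgV. Qed.

Lemma for_continuous_rV (R : realType) (T : topologicalType) p (g : T -> 'rV[R]_p) (x : T) :
  (forall j, {for x, continuous (fun y => g y 0 j)}) -> {for x, continuous g}.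
Proof.
move=> cg; apply/cvgrPdist_le => e e0.
have /near_forall : forall j, \forall y \near x, `|g x 0 j - g y 0 j| <= e.
  by move=> j; have /cvgrPdist_le/(_ _ e0) := cg j.
by apply: filterS => y H; apply: norm_le_coord => [|j]; [exact: ltW|rewrite !mxE].
Qed.

Section Smooth.
Context {R : realType}.

Lemma near_eq_continuous (T U : topologicalType) (f g : T -> U) (x : T) :
  (\forall y \near x, f y = g y) -> {for x, continuous f} -> {for x, continuous g}.
Proof.
move=> fg cf; rewrite /prop_for /continuous_at -(nbhs_singleton fg).
apply: cvg_trans cf; apply: near_eq_cvg; exact: fg.
Qed.

Lemma near_eq_diff (V W : normedModType R) (f g : V -> W) (x : V) :
  (\forall y \near x, f y = g y) -> differentiable f x ->
  differentiable g x /\ 'd g x = 'd f x :> (V -> W).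
Proof.
move=> fg df; apply: (@diff_epsP _ _ _ g x ('d f x)); first exact: diff_continuous.
move=> e e0; near=> h.
have <- : f (h + x) = g (h + x).
  near: h; move/nbhs_normP: fg => [d/= d0 dH]; apply/nbhs_normP; exists d => //= h.
  rewrite /ball_/= sub0r normrN => hd; apply: dH.
  by rewrite /ball_/= opprD addrCA subrr addr0 normrN.
rewrite -(nbhs_singleton fg).
near: h; exact: diff_eps.
Unshelve. all: by end_near. Qed.

(** The recursion is on the order instead of on multi-indices, so closure properties are proved by
    induction on [k] for all functions at once. Total differentiability near the point is demanded,
    and not just existence of partial derivatives, so that the chain rule applies. *)
Fixpoint Ck_at m (k : nat) (f : 'rV[R]_m -> R) (x : 'rV[R]_m) : Prop :=
  match k with
  | 0 => \forall y \near x, {for y, continuous f}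
  | k.+1 => (\forall y \near x, differentiable f y) /\
            (forall i, Ck_at k (partial i f) x)
  end.

Definition smooth_at m (f : 'rV[R]_m -> R) x := forall k, Ck_at k f x.

Section Closure.
Variable m : nat.
Implicit Types (f g : 'rV[R]_m -> R) (x : 'rV[R]_m).

Lemma Ck_at_ext k f g x : (\forall y \near x, f y = g y) -> Ck_at k f x -> Ck_at k g x.
Proof.
elim: k f g => [|k IH] f g fg /=.
  move=> cf; have fg' := near_join fg.
  by near=> y; apply: (@near_eq_continuous _ _ f); near: y.
move=> [df pf]; have fg' := near_join fg; split.
  by near=> y; apply: (proj1 (@near_eq_diff _ _ f g y _ _)); near: y.
move=> i; apply: IH (pf i).
by near=> y; rewrite /partial; apply: near_eq_derive; near: y.
Unshelve. all: by end_near. Qed.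

Lemma Ck_atS k f x : Ck_at k.+1 f x -> Ck_at k f x.
Proof.
elim: k f => [|k IH] f /=.
  move=> [df _]; near=> y; apply: differentiable_continuous; by near: y.
by move=> [df pf]; split=> // i; apply: IH; exact: pf.
Unshelve. all: by end_near. Qed.

Lemma Ck_at_cst k (c : R) x : Ck_at k (fun=> c) x.
Proof.
elim: k c => [|k IH] c /=; first by apply: near_all => y; apply: cst_continuous.
split; first by apply: near_all => y; exact: differentiable_cst.
move=> i; apply: (@Ck_at_ext _ (fun=> 0)); last exact: IH.
by near=> y; rewrite /partial derive_cst.
Unshelve. all: by end_near. Qed.

Lemma Ck_at_coord k j x : Ck_at k (fun y => y 0 j) x.
Proof.
case: k => [|k] /=; first by apply: near_all => y; apply: coord_continuous.
split; first by apply: near_all => y; exact: differentiable_coord.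
move=> i; apply: (@Ck_at_ext _ (fun=> (i == j)%:R)); last exact: Ck_at_cst.
near=> y; rewrite /partial.
have E := @derive_coord _ 'rV[R]_m m id y (delta_mx 0 i) j.
by rewrite /= in E; rewrite E// derive_id mxE eqxx eq_sym.
Unshelve. all: by end_near. Qed.

Lemma Ck_at_add k f g x : Ck_at k f x -> Ck_at k g x -> Ck_at k (fun y => f y + g y) x.
Proof.
elim: k f g => [|k IH] f g /=.
  by move=> cf cg; near=> y; apply: for_continuousD; near: y.
move=> [df pf] [dg pg]; split.
  by near=> y; apply: differentiableD; near: y.
move=> i; apply: Ck_at_ext (IH _ _ (pf i) (pg i)).
near=> y; rewrite /partial deriveD//; apply: diff_derivable; by near: y.
Unshelve. all: by end_near. Qed.

Lemma Ck_at_mul k f g x : Ck_at k f x -> Ck_at k g x -> Ck_at k (fun y => f y * g y) x.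
Proof.
elim: k f g => [|k IH] f g.
  by move=> cf cg /=; near=> y; apply: for_continuousM; near: y.
move=> cf cg; have cf' := Ck_atS cf; have cg' := Ck_atS cg.
move: cf cg => [df pf] [dg pg]; split.
  by near=> y; apply: differentiableM; near: y.
move=> i; apply: Ck_at_ext (Ck_at_add (IH _ _ cf' (pg i)) (IH _ _ cg' (pf i))).
near=> y; rewrite /partial deriveM//; apply: diff_derivable; by near: y.
Unshelve. all: by end_near. Qed.

Lemma Ck_at_scale k c f x : Ck_at k f x -> Ck_at k (fun y => c * f y) x.
Proof. by move=> cf; apply: Ck_at_mul => //; exact: Ck_at_cst. Qed.

Lemma Ck_at_opp k f x : Ck_at k f x -> Ck_at k (fun y => - f y) x.
Proof.
by move=> cf; rewrite (_ : (fun _ => _) = (fun y => -1 * f y)); [exact: Ck_at_scale|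
  apply/funext => y; rewrite mulN1r].
Qed.

Lemma Ck_at_sum k (I : Type) (r : seq I) (P : pred I) (F : I -> 'rV[R]_m -> R) x :
  (forall i, Ck_at k (F i) x) -> Ck_at k (fun y => \sum_(i <- r | P i) F i y) x.
Proof.
move=> cF; elim: r => [|i r IH].
  by apply: Ck_at_ext (Ck_at_cst k 0 x); near=> y; rewrite big_nil.
case Pi : (P i); last by apply: Ck_at_ext IH; near=> y; rewrite big_cons Pi.
by apply: Ck_at_ext (Ck_at_add (cF i) IH); near=> y; rewrite big_cons Pi.
Unshelve. all: by end_near. Qed.

Lemma Ck_at_prod k (I : Type) (r : seq I) (P : pred I) (F : I -> 'rV[R]_m -> R) x :
  (forall i, Ck_at k (F i) x) -> Ck_at k (fun y => \prod_(i <- r | P i) F i y) x.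
Proof.
move=> cF; elim: r => [|i r IH].
  by apply: Ck_at_ext (Ck_at_cst k 1 x); near=> y; rewrite big_nil.
case Pi : (P i); last by apply: Ck_at_ext IH; near=> y; rewrite big_cons Pi.
by apply: Ck_at_ext (Ck_at_mul (cF i) IH); near=> y; rewrite big_cons Pi.
Unshelve. all: by end_near. Qed.

Lemma Ck_at_det k n (F : 'rV[R]_m -> 'M[R]_n) x :
  (forall i j, Ck_at k (fun y => F y i j) x) -> Ck_at k (fun y => \det (F y)) x.
Proof.
move=> cF; apply: Ck_at_sum => s; apply: Ck_at_scale.
by apply: Ck_at_prod => i; exact: cF.
Qed.

Lemma Ck_at_continuous k f x : Ck_at k f x -> \forall y \near x, {for y, continuous f}.
Proof. by elim: k => // k IH /Ck_atS. Qed.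

(** The derivative of 1/f is -(1/f)^2 f', where 1/f is of class [k] by induction; non-vanishing
    persists near [x] by continuity. *)
Lemma Ck_at_inv k f x : f x != 0 -> Ck_at k f x -> Ck_at k (fun y => (f y)^-1) x.
Proof.
move=> fx0 cf.
have fn0 : \forall y \near x, f y != 0.
  have /nbhs_singleton cfx := Ck_at_continuous cf.
  by apply: (cfx (fun z => z != 0)); apply: open_nbhs_nbhs; split => //; exact: open_neq.
have fn0' := near_join fn0.
elim: k cf => [|k IH] cf /=.
  by near=> y; apply: for_continuousV; near: y.
have cV := IH (Ck_atS cf); move: cf => [df pf]; split.
  by near=> y; apply: differentiableV; near: y.
move=> i; apply: Ck_at_ext (Ck_at_opp (Ck_at_mul (Ck_at_mul cV cV) (pf i))).
near=> y; have fy0 : f y != 0 by near: y.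
have dfy : derivable f y (delta_mx 0 i) by apply: diff_derivable; near: y.
have := @deriveV _ _ f y (delta_mx 0 i) fy0 dfy.
rewrite /partial => ->.
by rewrite /GRing.scale/= mulNr -exprVn expr2.
Unshelve. all: by end_near. Qed.
End Closure.

(** By the chain rule a partial derivative of the composite is a sum of products of derivatives of
    [g] with [partial j f \o g], and the latter is of class [k] by induction applied to
    [partial j f]. *)
Lemma Ck_at_comp m p k (f : 'rV[R]_p -> R) (g : 'rV[R]_m -> 'rV[R]_p) x :
  {for x, continuous g} ->
  (forall j, Ck_at k (fun y => g y 0 j) x) -> Ck_at k f (g x) -> Ck_at k (f \o g) x.
Proof.
move=> cgx; elim: k f => [|k IH] f.
  move=> cg cf /=.
  have cg' := near_forall cg; have cf' := cgx _ cf.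
  near=> y; apply: (@continuous_comp _ _ _ g f); last by near: y.
  by apply: for_continuous_rV; near: y.
move=> cg cf; have IH' h := IH h (fun j => Ck_atS (cg j)).
have dg : \forall y \near x, forall j, differentiable (fun y => g y 0 j) y.
  by apply: near_forall => j; have [] := cg j.
move: cf => [df pf]; have df' : \forall y \near x, differentiable f (g y) := cgx _ df; split.
  near=> y; apply: differentiable_comp; last by near: y.
  by apply: differentiable_rV; near: y.
move=> i.
have cs : Ck_at k (fun y => \sum_j partial i (fun y => g y 0 j) y * (partial j f \o g) y) x.
  by apply: Ck_at_sum => j; apply: Ck_at_mul; [have [_ pg] := cg j; apply: (pg i) | apply: IH'; exact: pf].
apply: (Ck_at_ext _ cs); near=> y; rewrite /partial [RHS]chain_derive//; last by near: y.
by apply: differentiable_rV; near: y.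
Unshelve. all: by end_near. Qed.

Section SmoothAt.
Variable m : nat.
Implicit Types (f g : 'rV[R]_m -> R) (x : 'rV[R]_m).

Lemma smooth_at_ext f g x :
  (\forall y \near x, f y = g y) -> smooth_at f x -> smooth_at g x.
Proof. by move=> fg sf k; apply: Ck_at_ext fg (sf k). Qed.

Lemma smooth_at_continuous f x : smooth_at f x -> {for x, continuous f}.
Proof. by move=> /(_ 0) /nbhs_singleton. Qed.

Lemma smooth_at_diff f x : smooth_at f x -> differentiable f x.
Proof. by move=> /(_ 1)[/nbhs_singleton]. Qed.

Lemma smooth_at_partial f x i : smooth_at f x -> smooth_at (partial i f) x.
Proof. by move=> sf k; have [_] := sf k.+1; exact. Qed.

Lemma Cinfty_on_partial V f i : Cinfty_on V f -> Cinfty_on V (partial i f).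
Proof.
move=> sf s x Vx; have := sf (rcons s i) x Vx.
by rewrite /iter_partial foldr_rcons.
Qed.

(** [Cinfty_on] speaks of iterated partial derivatives only; the criterion [differentiable_C1],
    applied to each of them, supplies the total differentiability required in [Ck_at]. *)
Lemma Cinfty_on_smooth_at V f x : open V -> Cinfty_on V f -> V x -> smooth_at f x.
Proof.
move=> oV sf Vx k; have nV : \forall y \near x, V y by exact: open_nbhs_nbhs.
elim: k f sf => [|k IH] f sf.
  by apply: filterS nV => y Vy; have [] := sf [::] y Vy.
split=> [|i]; last exact/IH/Cinfty_on_partial.
apply: filterS nV => y Vy; apply: differentiable_C1.
  have : \forall z \near y, V z by exact: open_nbhs_nbhs.
  by apply: filterS => z Vz; have [] := sf [::] z Vz.
by move=> i; have [] := sf [:: i] y Vy.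
Qed.

Lemma smooth_at_Cinfty_on V f : (forall x, V x -> smooth_at f x) -> Cinfty_on V f.
Proof.
move=> sf s x Vx.
have {sf Vx} : smooth_at (iter_partial s f) x.
  elim: s => [|i s IH]; first exact: sf.
  exact: smooth_at_partial.
move=> sf; split; first exact: smooth_at_continuous.
by move=> i; apply: diff_derivable; exact: smooth_at_diff.
Qed.

Lemma smooth_on_smooth_at A f x : open A -> smooth_on A f -> A x -> smooth_at f x.
Proof.
move=> oA sf Ax; have [V [g [oV Vx sg fg]]] := sf x Ax.
apply: smooth_at_ext (Cinfty_on_smooth_at oV sg Vx).
have nA : \forall y \near x, A y by exact: open_nbhs_nbhs.
have nV : \forall y \near x, V y by exact: open_nbhs_nbhs.
by near=> y; apply/esym/fg; near: y.
Unshelve. all: by end_near. Qed.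

Lemma smooth_at_smooth_on A B f : open B -> A `<=` B ->
  (forall x, B x -> smooth_at f x) -> smooth_on A f.
Proof.
move=> oB AB sf x Ax; exists B, f; split=> //; first exact: AB.
exact: smooth_at_Cinfty_on.
Qed.

Lemma jacobianE p (f : 'rV[R]_m -> 'rV[R]_p) x : differentiable f x ->
  jacobian f x = \matrix_(i, j) partial i (fun y => f y 0 j) x.
Proof.
move=> df; apply/matrixP => i j; rewrite !mxE /partial (derive_coord _ _ df).
by rewrite deriveE.
Qed.

(** Cramer's rule: the entries of the inverse are cofactors divided by the determinant, which stays
    nonzero near [x]. *)
Lemma Ck_at_invmx k n (F : 'rV[R]_m -> 'M[R]_n) x :
  \det (F x) != 0 -> (forall i j, Ck_at k (fun y => F y i j) x) ->
  forall i j, Ck_at k (fun y => invmx (F y) i j) x.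
Proof.
move=> Fx cF i j; have cdet := Ck_at_det cF.
have : Ck_at k (fun y => (\det (F y))^-1 * cofactor (F y) j i) x.
  apply: Ck_at_mul; first exact: Ck_at_inv.
  apply: Ck_at_scale; apply: Ck_at_det => a b.
  apply: Ck_at_ext (cF (lift j a) (lift i b)).
  by apply: near_all => y; rewrite !mxE.
apply: Ck_at_ext.
have : \forall y \near x, \det (F y) != 0.
  have /nbhs_singleton cfx := Ck_at_continuous cdet.
  by apply: (cfx (fun z => z != 0)); apply: open_nbhs_nbhs; split => //; exact: open_neq.
by apply: filterS => y Fy; rewrite /invmx unitmxE unitfE Fy !mxE.
Qed.

End SmoothAt.

Lemma smooth_at_comp m p (f : 'rV[R]_p -> R) (g : 'rV[R]_m -> 'rV[R]_p) x :
  (forall j, smooth_at (fun y => g y 0 j) x) -> smooth_at f (g x) -> smooth_at (f \o g) x.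
Proof.
move=> sg sf k; apply: Ck_at_comp => //; last by move=> j; exact: sg.
by apply: for_continuous_rV => j; exact: smooth_at_continuous.
Qed.

(** With k = G(h + w) - G(w), the expansion of [F] at [G w] reads h = k J + o(k), so that k = h J^-1
    + o(k). Continuity of [G] makes k small; the error is first absorbed to give a bound of k by a
    multiple of h, and is then o(h). *)
Lemma differentiable_right_inverse m (F G : 'rV[R]_m -> 'rV[R]_m) (w : 'rV[R]_m) :
  {for w, continuous G} -> (\forall v \near w, F (G v) = v) ->
  differentiable F (G w) -> jacobian F (G w) \in unitmx ->
  differentiable G w /\ forall v, 'd G w v = v *m invmx (jacobian F (G w)).
Proof.
move=> cG FG dF uJ; set J := jacobian F (G w); set y0 := G w.
pose L : {linear 'rV[R]_m -> 'rV[R]_m} := mulmxr (invmx J).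
have cL : continuous L.
  move=> v; apply: for_continuous_rV => j.
  pose g := fun v : 'rV[R]_m => \sum_i v 0 i * invmx J i j.
  rewrite (_ : (fun _ => _) = g); last by apply/funext => u; rewrite /= mxE.
  suff cg : continuous g by exact: cg.
  apply: continuous_big; first exact: add_continuous.
  by move=> i _ u; apply: for_continuousM; [exact: coord_continuous|exact: cst_continuous].
have [c c0 Lc] := linear_lipschitz cL.
suff [dG GE] : differentiable G w /\ 'd G w = L :> (_ -> _) by split=> // v; rewrite GE.
apply: diff_epsP => // e e0.
(* Here [c] is a Lipschitz constant of the inverse Jacobian. The first bound gives c e1 <= 1/2,
   which absorbs half of the norm of k and leaves it at most 2 c times that of h; the second makes c
   e1 times 2 c at most e. *)
pose e1 := Num.min (1 / 2 / c) (e / 2 / c / c).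
have e10 : 0 < e1 by rewrite lt_min !divr_gt0.
have cG0 : \forall h \near (0 : 'rV[R]_m), forall k : 'rV[R]_m, k = G (h + w) - y0 ->
    `|F (k + y0) - F y0 - 'd F y0 k| <= e1 * `|k|.
  have /nbhs_normP[d/= d0 dH] := diff_eps dF e10.
  have /cvgrPdist_lt/(_ _ d0)/nbhs_normP[d'/= d'0 d'H] := cG.
  apply/nbhs_normP; exists d' => //= h; rewrite /ball_/= sub0r normrN => hd _ ->.
  apply: dH; rewrite /ball_/= sub0r opprB; apply: d'H.
  by rewrite /ball_/= opprD addrCA subrr addr0 normrN.
have FG0 : \forall h \near (0 : 'rV[R]_m), F (G (h + w)) = h + w.
  move/nbhs_normP : FG => [d/= d0 dH]; apply/nbhs_normP; exists d => //= h.
  rewrite /ball_/= sub0r normrN => hd; apply: dH.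
  by rewrite /ball_/= opprD addrCA subrr addr0 normrN.
near=> h.
have H1 : F (G (h + w)) = h + w by near: h.
have : forall k : 'rV[R]_m, k = G (h + w) - y0 ->
    `|F (k + y0) - F y0 - 'd F y0 k| <= e1 * `|k| by near: h.
move=> /(_ _ erefl); rewrite subrK H1 (nbhs_singleton FG) addrK.
set k := G (h + w) - y0; set r := h - _ => rk.
have kE : k = L h - L r.
  rewrite -linearB /r opprB addrC subrK /= -deriveE// deriveEjacobian//.
  by rewrite -mulmxA mulmxV ?mulmx1.
have Lr : `|L r| <= c * e1 * `|k|.
  by apply: le_trans (Lc r) _; rewrite -mulrA ler_wpM2l// ltW.
have ce1 : c * e1 <= 1 / 2.
  by rewrite mulrC -ler_pdivlMr// ge_min lexx.
have ce2 : c * e1 <= e / 2 / c.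
  by rewrite mulrC -ler_pdivlMr// ge_min lexx orbT.
have k2 : `|k| <= 2 * (c * `|h|).
  have : `|k| <= c * `|h| + 1 / 2 * `|k|.
    rewrite {1}kE; apply: le_trans (ler_normB _ _) _; apply: lerD => //.
    by apply: le_trans Lr _; rewrite ler_wpM2r.
  lra.
rewrite kE addrAC subrr add0r normrN.
apply: le_trans Lr _.
apply: (@le_trans _ _ (e / 2 / c * (2 * (c * `|h|)))).
  by apply: ler_pM => //; rewrite mulr_ge0// ltW.
suff -> : e / 2 / c * (2 * (c * `|h|)) = e * `|h| by [].
by field; rewrite gt_eqF.
Unshelve. all: by end_near. Qed.

(** Bootstrapping: the derivative of [G] is the inverse Jacobian of [F] evaluated along [G]. If [G]
    is of class C^k, so is its derivative, and [G] is of class C^(k+1). *)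
Lemma smooth_right_inverse m (F G : 'rV[R]_m -> 'rV[R]_m) (w : 'rV[R]_m) :
  (\forall v \near w, {for v, continuous G}) -> (\forall v \near w, F (G v) = v) ->
  (forall j, smooth_at (fun y => F y 0 j) (G w)) -> jacobian F (G w) \in unitmx ->
  forall j, smooth_at (fun v => G v 0 j) w.
Proof.
move=> cG FG sF uJ.
have cGw := nbhs_singleton cG.
pose J y : 'M[R]_m := \matrix_(i, j) partial i (fun y => F y 0 j) y.
have dFw : differentiable F (G w).
  by apply: differentiable_rV => j; exact: smooth_at_diff.
have JJ := jacobianE dFw; rewrite -/(J (G w)) in JJ.
have Jw : \det (J (G w)) != 0 by rewrite -unitfE -unitmxE -JJ.
have sJ k i j : Ck_at k (fun y => J y i j) (G w).
  apply: Ck_at_ext (smooth_at_partial i (sF j) k).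
  by apply: near_all => y; rewrite mxE.
have dF' : \forall y \near G w, differentiable F y.
  have : forall j, \forall y \near G w, differentiable (fun y => F y 0 j) y.
    by move=> j; have [] := sF j 1.
  by move=> /near_forall; apply: filterS => y; exact: differentiable_rV.
have dF : \forall v \near w, differentiable F (G v) := cGw _ dF'.
have uJ' : \forall y \near G w, J y \in unitmx.
  have /nbhs_singleton cdet := Ck_at_continuous (Ck_at_det (sJ 0)).
  have : \forall y \near G w, \det (J y) != 0.
    by apply: (cdet (fun z => z != 0)); apply: open_nbhs_nbhs; split => //; exact: open_neq.
  by apply: filterS => y; rewrite unitmxE unitfE.
have uJv : \forall v \near w, J (G v) \in unitmx := cGw _ uJ'.
have FG' := near_join FG.
have dG : \forall v \near w, differentiable G v /\
    forall u, 'd G v u = u *m invmx (J (G v)).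
  near=> v.
  have dFv : differentiable F (G v) by near: v.
  have E := jacobianE dFv; rewrite -/(J (G v)) in E.
  have cGv : {for v, continuous G} by near: v.
  have FGv : \forall u \near v, F (G u) = u by near: v.
  have uv : jacobian F (G v) \in unitmx by rewrite E; near: v.
  have [dGv GE] := differentiable_right_inverse cGv FGv dFv uv.
  by split=> // u; rewrite GE E.
have dG' := near_join dG.
move=> j k; elim: k j => [|k IH] j /=.
  near=> v; apply: (@continuous_comp _ _ _ G (fun y : 'rV[R]_m => y 0 j)).
    by near: v.
  exact: coord_continuous.
split.
  near=> v; apply: diff_coord.
  by have [] : differentiable G v /\ forall u, 'd G v u = u *m invmx (J (G v)) by near: v.
move=> i.
have : Ck_at k (fun v => invmx (J (G v)) i j) w.
  apply: Ck_at_invmx => // a b.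
  exact: (@Ck_at_comp _ _ _ (fun y => J y a b) G).
apply: Ck_at_ext; near=> v.
have [dGv GE] : differentiable G v /\ forall u, 'd G v u = u *m invmx (J (G v)) by near: v.
by rewrite /partial (derive_coord _ _ dGv) deriveE// GE -rowE mxE.
Unshelve. all: by end_near. Qed.

End Smooth.

(** * Smooth functions of one variable and time changes *)

Section OneVariable.
Context {R : realType}.
Implicit Types f g : R -> R.

(** Functions of one variable are read on row vectors of length 1, so that the calculus of
    [smooth_at] serves for them too. *)
Definition smooth1 f := forall z : 'rV[R]_1, smooth_at (fun z => f (z 0 0)) z.

Lemma smooth_at_smooth1 m f (u : 'rV[R]_m -> R) z :
  smooth1 f -> smooth_at u z -> smooth_at (fun z => f (u z)) z.
Proof.
move=> sf su; pose g := fun z => (u z)%:M : 'rV[R]_1.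
apply: (@smooth_at_ext _ _ ((fun y : 'rV[R]_1 => f (y 0 0)) \o g)).
  by apply: near_all => y; rewrite /g /= mxE eqxx mulr1n.
apply: smooth_at_comp => // j.
apply: (smooth_at_ext _ su); apply: near_all => y.
by rewrite /g ord1 mxE eqxx mulr1n.
Qed.

Lemma smooth1_comp f g : smooth1 f -> smooth1 g -> smooth1 (fun x => f (g x)).
Proof. by move=> sf sg z; apply: smooth_at_smooth1. Qed.

Lemma smooth1_cst c : smooth1 (fun=> c).
Proof. by move=> z k; exact: Ck_at_cst. Qed.

Lemma smooth1_id : smooth1 id.
Proof. by move=> z k; exact: Ck_at_coord. Qed.

Lemma smooth1_add f g : smooth1 f -> smooth1 g -> smooth1 (fun x => f x + g x).
Proof. by move=> sf sg z k; apply: Ck_at_add; [exact: sf|exact: sg]. Qed.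

Lemma smooth1_scale c f : smooth1 f -> smooth1 (fun x => c * f x).
Proof. by move=> sf z k; apply: Ck_at_scale; exact: sf. Qed.

(** Induction on [k] for all members together: the derivative of a member is again a member. This
    handles the functions [flat p] without formulas for higher derivatives. *)
Lemma smooth1_class (P : set (R -> R)) :
  (forall f, P f -> (forall x : R, derivable f x 1) /\ P (f^`())%classic) ->
  forall f, P f -> smooth1 f.
Proof.
move=> HP f Pf z k; elim: k f Pf z => [|k IH] f Pf z /=.
  apply: near_all => y; apply: (@continuous_comp _ _ _ (fun y : 'rV[R]_1 => y 0 0) f).
    exact: coord_continuous.
  by apply/differentiable_continuous/derivable1_diffP; have [] := HP f Pf.
have [df Pf'] := HP f Pf.
have dc (y : 'rV[R]_1) : differentiable (fun y : 'rV[R]_1 => y 0 0) y.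
  exact: differentiable_coord.
have dfy (x : R) : differentiable f x by apply/derivable1_diffP.
have dcomp (y : 'rV[R]_1) : differentiable (f \o (fun y : 'rV[R]_1 => y 0 0)) y.
  exact: differentiable_comp.
split; first by apply: near_all => y; exact: dcomp.
move=> i; apply: Ck_at_ext (IH _ Pf' z); apply: near_all => y.
rewrite /partial (deriveE (delta_mx 0 i) (dcomp y)) diff_comp//=.
rewrite -(deriveE (delta_mx 0 i) (dc y)).
rewrite (@derive_coord _ 'rV[R]_1 1 id y (delta_mx 0 i) 0)// derive_id mxE eqxx ord1/=.
by rewrite derive1E'.
Qed.

Lemma smooth1_row f : smooth1 f ->
  f = (fun z : 'rV[R]_1 => f (z 0 0)) \o (fun t : R => t%:M : 'rV[R]_1).
Proof. by move=> sf; apply/funext => t /=; rewrite mxE eqxx mulr1n. Qed.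

Let drow (x : R) : differentiable (fun t : R => t%:M : 'rV[R]_1) x.
Proof.
apply: differentiable_rV => j.
rewrite (_ : (fun _ => _) = id)//; apply/funext => t.
by rewrite ord1 mxE eqxx mulr1n.
Qed.

Lemma smooth1_derivable f (x : R) : smooth1 f -> derivable f x 1.
Proof.
move=> sf; apply/derivable1_diffP; rewrite (smooth1_row sf).
by apply: differentiable_comp => //; exact/smooth_at_diff/sf.
Qed.

Lemma smooth1_continuous f : smooth1 f -> continuous f.
Proof.
move=> sf x; apply/differentiable_continuous/derivable1_diffP.
exact: smooth1_derivable.
Qed.

Lemma smooth1_derive f : smooth1 f -> smooth1 (f^`())%classic.
Proof.
move=> sf z; apply: smooth_at_ext (smooth_at_partial 0 (sf z)).
apply: near_all => y.
have yE : y = (y 0 0)%:M by apply/rowP => j; rewrite !ord1 mxE eqxx mulr1n.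
rewrite [in RHS]derive1E {2}(smooth1_row sf) chain_derive//; last first.
  by apply: smooth_at_diff; exact: sf.
rewrite big_ord1 -yE.
rewrite (_ : (fun t : R => (t%:M : 'rV[R]_1) 0 ord0) = id) ?derive_id ?mul1r//.
by apply/funext => t; rewrite mxE eqxx mulr1n.
Qed.

Let oo1 (x : R) : x \in `]x - 1, x + 1[.
Proof. by rewrite in_itv/=; apply/andP; split; lra. Qed.

Lemma derive1_global_max f (x : R) : (forall y : R, derivable f y 1) ->
  (forall y, f y <= f x) -> (f^`())%classic x = 0.
Proof.
move=> df H; rewrite derive1E; have h : x - 1 <= x + 1 by lra.
by have [] := derive1_at_max h (fun t _ => df t) (oo1 x) (fun t _ => H t).
Qed.

Lemma derive1_global_min f (x : R) : (forall y : R, derivable f y 1) ->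
  (forall y, f x <= f y) -> (f^`())%classic x = 0.
Proof.
move=> df H; rewrite derive1E; have h : x - 1 <= x + 1 by lra.
by have [] := derive1_at_min h (fun t _ => df t) (oo1 x) (fun t _ => H t).
Qed.

(** Each monomial satisfies u^i <= i! exp u for u >= 0. With u = 1/x this plays polynomials in 1/x
    off against exp(-1/x) near 0. *)
Lemma horner_le_expR (p : {poly R}) :
  exists2 C, 0 <= C & forall u : R, 0 <= u -> `|p.[u]| <= C * expR u.
Proof.
exists (\sum_(i < size p) `|p`_i| * i`!%:R).
  by apply: sumr_ge0 => i _; rewrite mulr_ge0.
move=> u u0; rewrite horner_coef mulr_suml.
apply: le_trans (ler_norm_sum _ _ _) _; apply: ler_sum => i _.
rewrite normrM -mulrA ler_wpM2l// ger0_norm ?exprn_ge0//.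
have f0 : 0 < (i`!)%:R :> R by rewrite ltr0n fact_gt0.
rewrite mulrC -ler_pdivrMr//.
case: (nat_of_ord i) => [|n]; first by rewrite expr0 divr1 -expR0 ler_expR.
by apply: le_trans (expR_ge1Dxn n u0); rewrite lerDr.
Qed.

(* The derivatives of x |-> p(1/x) exp(-1/x) on x > 0 are again of this form,
   which is what makes [flat 1] smooth across 0. *)
Definition flat (p : {poly R}) (x : R) : R :=
  if 0 < x then p.[x^-1] * expR (- x^-1) else 0.

Lemma flat_derive (p : {poly R}) (x : R) :
  is_derive x 1 (flat p) (flat ('X^2 * (p - p^`())) x).
Proof.
have [x0|x0|<-] := ltgtP 0 x.
- apply: (@near_eq_is_derive R R R (fun y => p.[y^-1] * expR (- y^-1)) (flat p) x 1).
    have n0 : \forall y \near x, 0 < y by apply: open_nbhs_nbhs; split => //; exact: open_gt.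
    by near=> y; have y0 : 0 < y by [near: y]; rewrite /flat y0.
  have xn0 : x != 0 by rewrite gt_eqF.
  rewrite /flat x0.
  have dinv : is_derive x 1 (fun y : R => y^-1) (- x^-2).
    have := @is_deriveV R id x 1 1 xn0 (is_derive_id x (1 : R)).
    by move=> dI; apply: (is_derive_eq dI); rewrite /GRing.scale/= mulr1.
  have d1 : is_derive x 1 (fun y => p.[y^-1]) (p^`().[x^-1] * (- x^-2)).
    exact: (@is_derive1_comp _ (horner p) (fun y : R => y^-1) x _ _ (is_derive_poly p _) dinv).
  have d2 : is_derive x 1 (fun y => expR (- y^-1)) (expR (- x^-1) * x^-2).
    have dn : is_derive x 1 (fun y : R => - y^-1) (x^-2).
      by apply: (is_derive_eq (is_deriveN dinv)); rewrite opprK.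
    exact: (@is_derive1_comp _ (@expR R) (fun y : R => - y^-1) x _ _ (is_derive_expR _) dn).
  apply: (is_derive_eq (is_deriveM d1 d2)); rewrite !hornerE /GRing.scale/= exprVn; ring.
- apply: (@near_eq_is_derive R R R (cst 0) (flat p) x 1).
    have n0 : \forall y \near x, y < 0 by apply: open_nbhs_nbhs; split => //; exact: open_lt.
    by near=> y; have y0 : y < 0 by [near: y]; rewrite /flat /cst ltNge (ltW y0).
  by rewrite /flat ltNge (ltW x0); exact: is_derive_cst.
- rewrite {2}/flat ltxx.
  (* The factor X^2 is there for the difference quotient: h^-1 p(1/h) exp(-1/h) equals h times h^-2
     p(1/h) exp(-1/h), hence is at most C h in absolute value. *)
  have [C C0 HC] := horner_le_expR ('X^2 * p).
  suff H : (fun h : R => h^-1 *: (flat p (h *: 1 + 0) - flat p 0)) @ 0^' --> (0 : R).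
    by apply: DeriveDef; [apply/cvg_ex; exists 0 | apply/cvg_lim].
  apply/cvgrPdist_le => e e0; near=> h.
  rewrite sub0r normrN [h *: 1]mulr1 addr0 {2}/flat ltxx subr0 /flat.
  case: ifPn => h0; last by rewrite scaler0 normr0 ltW.
  have hV0 : 0 <= h^-1 by rewrite invr_ge0 ltW.
  apply: (@le_trans _ _ (C * h)); last first.
    apply: (@le_trans _ _ (C * (e / (C + 1)))).
      rewrite ler_wpM2l//; apply: le_trans (ler_norm _) _.
      by near: h; apply: dnbhs0_le; rewrite divr_gt0// ltr_wpDl.
    by rewrite mulrA ler_pdivrMr ?ltr_wpDl// mulrC ler_wpM2l ?lerDl// ltW.
  have := HC _ hV0; rewrite !hornerE normrM normrX (ger0_norm hV0) => H.
  rewrite normrZ normrM (ger0_norm hV0) (ger0_norm (expR_ge0 _)) expRN.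
  rewrite mulrA ler_pdivrMr ?expR_gt0// mulrAC -ler_pdivrMr//.
  by apply: le_trans H; rewrite le_eqVlt; apply/orP; left; apply/eqP; ring.
Unshelve. all: by end_near. Qed.

Lemma smooth1_flat p : smooth1 (flat p).
Proof.
apply: (@smooth1_class (range flat)); last by exists p.
move=> _ [q _ <-]; split=> [x|]; first by have [] := flat_derive q x.
exists ('X^2 * (q - q^`())) => //; apply/funext => x.
by rewrite derive1E; have [_ ->] := flat_derive q x.
Qed.

Let flat1_bound (x : R) : x <= 1 -> 0 <= flat 1 x <= expR (- 1).
Proof.
rewrite /flat => x1; case: ifP => x0; last by rewrite lexx expR_ge0.
by rewrite hornerC mul1r expR_ge0 ler_expR lerN2 invf_ge1.
Qed.

(** Since [flat 1 x] is exp(-1/x) for x > 0, the inner difference is 1 for x <= 0 and nonpositive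
    for x >= 1. The outer [flat 1] is then exp(-1), respectively 0, which gives the values 0 and 1.
    Only compositions occur, no quotient. *)
Definition step (x : R) : R := 1 - expR 1 * flat 1 (1 - expR 1 * flat 1 x).

Lemma flat1_ge0 x : 0 <= flat 1 x.
Proof. by rewrite /flat; case: ifP => // _; rewrite hornerC mul1r expR_ge0. Qed.

Lemma smooth1_step : smooth1 step.
Proof.
have H f : smooth1 f -> smooth1 (fun x => 1 - expR 1 * f x).
  move=> sf; rewrite (_ : (fun _ => _) = (fun x => 1 + (- expR 1) * f x)).
    by apply: smooth1_add; [exact: smooth1_cst|exact: smooth1_scale].
  by apply/funext => x; rewrite mulNr.
apply: (H (fun x => flat 1 (1 - expR 1 * flat 1 x))).
by apply: smooth1_comp; [|apply: H]; exact: smooth1_flat.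
Qed.

Lemma step_itv x : 0 <= step x <= 1.
Proof.
have le1 : 1 - expR 1 * flat 1 x <= 1.
  by rewrite gerBl mulr_ge0 ?expR_ge0 ?flat1_ge0.
have /andP[f0 f1] := flat1_bound le1.
rewrite /step subr_ge0 gerBl mulr_ge0 ?expR_ge0// andbT.
have e1 : expR 1 * expR (- 1) = 1 :> R by rewrite -expRD subrr expR0.
by rewrite -[leRHS]e1 ler_wpM2l ?expR_ge0.
Qed.

Lemma step_le0 x : x <= 0 -> step x = 0.
Proof.
move=> x0; rewrite /step {2}/flat ltNge x0 mulr0 subr0 /flat ltr01 hornerC mul1r invr1.
by rewrite expRN mulfV ?subrr// gt_eqF ?expR_gt0.
Qed.

Lemma step_ge1 x : 1 <= x -> step x = 1.
Proof.
move=> x1; have x0 : 0 < x by apply: lt_le_trans x1.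
rewrite /step {1}/flat ltNge.
suff -> : 1 - expR 1 * flat 1 x <= 0 by rewrite mulr0 subr0.
rewrite subr_le0 /flat x0 hornerC mul1r -expRD -[leLHS]expR0 ler_expR subr_ge0.
by rewrite invf_le1.
Qed.

Definition smooth_step (st : R -> R) := [/\ smooth1 st, forall x, 0 <= st x <= 1,
  forall x, x <= 0 -> st x = 0 & forall x, 1 <= x -> st x = 1].

Lemma exists_smooth_step : exists st, smooth_step st.
Proof. by exists step; split; [exact: smooth1_step|exact: step_itv|exact: step_le0|exact: step_ge1]. Qed.

(** For x <= 0 and x >= 1 the function sits at its global minimum or maximum, so its derivative
    vanishes; in between the derivative is continuous on a segment. *)
Lemma step_derive_bound st : smooth_step st ->
  exists2 C, 0 < C & forall x, `|(st^`())%classic x| <= C.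
Proof.
move=> [sst st_itv st0 st1].
pose ds x := (st^`())%classic x.
have cs : continuous (fun x => `|ds x|).
  move=> x; apply: continuous_comp; last exact: norm_continuous.
  exact/smooth1_continuous/smooth1_derive.
have [c _ Hc] := @EVT_max R (fun x => `|ds x|) 0 1 ler01 (continuous_subspaceT cs).
have dst (x : R) : derivable st x 1 by exact: smooth1_derivable.
exists (`|ds c| + 1); first by rewrite ltr_wpDl.
move=> x; rewrite -/(ds x); have [x0|x0] := leP x 0.
  have -> : ds x = 0.
    apply: derive1_global_min => // y.
    by rewrite (st0 x x0); have /andP[] := st_itv y.
  by rewrite normr0 addr_ge0.
have [x1|x1] := leP 1 x.
  have -> : ds x = 0.
    apply: derive1_global_max => // y.
    by rewrite (st1 x x1); have /andP[] := st_itv y.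
  by rewrite normr0 addr_ge0.
apply: (@le_trans _ _ `|ds c|); last by rewrite lerDl.
by apply: Hc; rewrite in_itv/= !ltW.
Qed.

(** [tau] climbs by [m] smooth steps of height [w], the k-th of which takes the time [theta k]. The
    slope is recorded by the slab of values containing [tau t], and not by the time, because it is
    going to be multiplied by a function of [tau t]. *)
Lemma staircase st (C : R) : smooth_step st ->
  (forall x, `|(st^`())%classic x| <= C) ->
  forall m (theta : nat -> R) (a w s : R), 0 <= w -> (forall k, 0 < theta k) ->
  exists tau : R -> R, [/\ smooth1 tau,
    forall t, a <= tau t <= a + m%:R * w,
    forall t, t <= s -> tau t = a,
    forall t, s + \sum_(k < m) theta k <= t -> tau t = a + m%:R * w &
    forall t, (tau^`())%classic t = 0 \/ exists k, [/\ (k < m)%N,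
      a + k%:R * w <= tau t <= a + k.+1%:R * w &
      `|(tau^`())%classic t| <= C * w / theta k]].
Proof.
move=> [sst st_itv st0 st1] HC m theta a w s w0 th0; elim: m => [|m [tau [stau itau tau0 tau1 dtau]]].
  exists (fun=> a); split => //.
  - exact: smooth1_cst.
  - by move=> t; rewrite mul0r addr0 lexx.
  - by move=> t _; rewrite mul0r addr0.
  - by move=> t; left; rewrite derive1_cst.
set s' := s + \sum_(k < m) theta k in tau1.
(* The new step starts when the first [m] are completed, at time s', and is stretched to last
   [theta m]. *)
pose u t := (t - s') / theta m.
pose sig t := tau t + w * st (u t).
have su : smooth1 u.
  rewrite (_ : u = (fun t => (theta m)^-1 * (t + - s'))); last first.
    by apply/funext => t; rewrite mulrC.
  by apply/smooth1_scale/smooth1_add; [exact: smooth1_id|exact: smooth1_cst].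
have sstu : smooth1 (fun t => w * st (u t)).
  by apply/smooth1_scale/(smooth1_comp _ su); exact: sst.
have ssig : smooth1 sig by exact: smooth1_add.
have wst t : 0 <= w * st (u t) <= w.
  by have /andP[s0 s1] := st_itv (u t); rewrite mulr_ge0//= ler_piMr.
have dsig t : (sig^`())%classic t = (tau^`())%classic t +
    w * ((st^`())%classic (u t) / theta m).
  have dt : derivable tau t 1 by exact: smooth1_derivable.
  have dst : derivable st (u t) 1 by exact: smooth1_derivable sst.
  have du : derivable u t 1 by exact: smooth1_derivable.
  have D1 : is_derive t 1 u (theta m)^-1.
    rewrite (_ : u = (theta m)^-1 \*: (id - cst s')); last first.
      by apply/funext => x; rewrite /u mulrC.
    have D := is_deriveZ (theta m)^-1 (is_deriveB (is_derive_id t (1 : R)) (is_derive_cst s' t 1)).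
    by apply: (is_derive_eq D); rewrite subr0 /GRing.scale/= mulr1.
  have Ds : is_derive (u t) 1 st ((st^`())%classic (u t)).
    by have := derivableP dst; rewrite -(derive1E st).
  have D2 := is_derive1_comp Ds D1.
  have D3 := is_deriveD (derivableP dt) (is_deriveZ w D2).
  rewrite derive1E [in RHS]derive1E.
  by have [_ DE] := D3; exact: DE.
have ss' : s <= s' by rewrite lerDl sumr_ge0// => k _; exact: ltW.
have mS : m.+1%:R * w = m%:R * w + w by rewrite -natr1 mulrDl mul1r.
(* Before s' the new step, and after s' the old staircase, is at a global extremum and has
   derivative zero, so that at any time at most one of the two contributes. *)
have below t : t <= s' -> sig t = tau t /\ (sig^`())%classic t = (tau^`())%classic t.
  move=> ts; have u0 : u t <= 0 by rewrite /u mulr_le0_ge0 ?subr_le0 ?invr_ge0// ltW.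
  have E : (st^`())%classic (u t) = 0.
    apply: derive1_global_min => y; first exact: smooth1_derivable sst.
    by rewrite (st0 (u t) u0); have /andP[] := st_itv y.
  by rewrite dsig /sig st0// E mul0r mulr0 !addr0.
have above t : s' <= t -> sig t = a + m%:R * w + w * st (u t) /\
     (sig^`())%classic t = w * ((st^`())%classic (u t) / theta m).
  move=> hst; have E : (tau^`())%classic t = 0.
    apply: derive1_global_max => y; first exact: smooth1_derivable.
    by rewrite (tau1 t hst); have /andP[] := itau y.
  by rewrite dsig /sig (tau1 t hst) E add0r.
exists sig; split => //.
- move=> t; rewrite mS addrA; have /andP[? ?] := itau t; have /andP[? ?] := wst t.
  by apply/andP; split; [rewrite -[a]addr0|]; apply: lerD.
- move=> t ts; have [-> _] := below t (le_trans ts ss'); exact: tau0.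
- move=> t; rewrite big_ord_recr/= addrA -/s' => hst.
  have s't : s' <= t by apply: le_trans hst; rewrite lerDl ltW.
  have [-> _] := above t s't.
  have u1 : 1 <= u t by rewrite /u ler_pdivlMr// mul1r; lra.
  by rewrite (st1 _ u1) mulr1 mS addrA.
- move=> t; have [/below[-> ->]|/ltW/above[-> ->]] := leP t s'.
    have [->|[k [km kt dk]]] := dtau t; [by left|right].
    by exists k; split => //; rewrite ltnS ltnW.
  right; exists m; split=> //.
    by have /andP[w1 w2] := wst t; rewrite mS; apply/andP; split; lra.
  rewrite normrM normrM (ger0_norm w0) normfV (gtr0_norm (th0 m)).
  rewrite mulrA ler_pM2r ?invr_gt0// mulrC ler_wpM2r//.
Qed.

(** The slab of values from k/m to (k+1)/m is crossed in a time essentially proportional to the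
    bound [c k] of [h] on it. Speed times [h] is then bounded independently of the slab, by the
    average of the [c k] over the available time, up to the constant of the step profile. *)
Lemma time_change : exists2 C : R, 0 < C &
  forall (h : R -> R) m (c : nat -> R) (eps s s' : R),
    (0 < m)%N -> s < s' ->
    (forall k x, (k < m)%N -> k%:R / m%:R <= x <= k.+1%:R / m%:R -> 0 <= h x <= c k) ->
    (\sum_(k < m) c k) / m%:R < eps ->
  exists tau : R -> R, [/\ smooth1 tau, forall t, 0 <= tau t <= 1,
    forall t, t <= s -> tau t = 0, forall t, s' <= t -> tau t = 1 &
    forall t, `|(tau^`())%classic t| * h (tau t) <= C * eps / (s' - s)].
Proof.
have [st sst] := exists_smooth_step.
have [C C0 HC] := step_derive_bound sst.
exists C => // h m c eps s s' m0 ss' hc ceps.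
have mR : 0 < m%:R :> R by rewrite ltr0n.
have c0 k : (k < m)%N -> 0 <= c k.
  move=> km; have /andP[h0 h1] : 0 <= h (k%:R / m%:R) <= c k.
    by apply: hc => //; rewrite lexx ler_pM2r ?invr_gt0// ler_nat leqnSn.
  exact: le_trans h0 h1.
have eps0 : 0 < eps.
  by apply: le_lt_trans ceps; apply: divr_ge0 (ltW mR); apply: sumr_ge0 => k _; exact: c0.
(* The gap in the strict inequality is spread over the slabs. It keeps the durations positive where
   [c k] is 0, and it makes the numbers c k + eta add up to m eps, so that the durations [theta k]
   add up to s' - s. *)
pose eta := eps - (\sum_(k < m) c k) / m%:R.
have eta0 : 0 < eta by rewrite subr_gt0.
(* [staircase] asks for positive durations at all indices, whereas [c k] is known to be nonnegative
   only for k < m. *)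
pose d k := if (k < m)%N then c k else 0.
have d0 k : 0 < d k + eta.
  by rewrite /d; case: ifP => [/c0 ck|_]; [exact: ltr_wpDl|rewrite add0r].
pose theta k := (s' - s) * (d k + eta) / (m%:R * eps).
have th0 k : 0 < theta k by rewrite divr_gt0// mulr_gt0// subr_gt0.
have w0 : 0 <= (m%:R : R)^-1 by rewrite invr_ge0 ltW.
have [tau [stau itau tau0 tau1 dtau]] := staircase sst HC m 0 s w0 th0.
rewrite mulfV ?gt_eqF// add0r in itau tau1.
exists tau; split=> //.
  move=> t hst; apply: tau1; rewrite -mulr_suml -mulr_sumr big_split/=.
  have -> : \sum_(i < m) d i = \sum_(i < m) c i.
    by apply: eq_bigr => i _; rewrite /d ltn_ord.
  rewrite sumr_const card_ord -[eta *+ m]mulr_natr.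
  have -> : \sum_(i < m) c i + eta * m%:R = m%:R * eps.
    by rewrite /eta mulrBl divfK ?gt_eqF// addrCA subrr addr0 mulrC.
  by rewrite mulfK ?mulf_neq0 ?gt_eqF// addrC subrK.
have CE0 : 0 <= C * eps / (s' - s).
  by apply: divr_ge0; [apply: mulr_ge0; exact: ltW|rewrite subr_ge0 ltW].
move=> t; have [->|[k [km kt dk]]] := dtau t; first by rewrite normr0 mul0r.
rewrite !add0r in kt; have /andP[h0 hk] := hc k _ km kt.
apply: (@le_trans _ _ (C * m%:R^-1 / theta k * c k)); first exact: ler_pM.
have := d0 k; rewrite /d km => dk0.
have -> : C * m%:R^-1 / theta k * c k = C * eps / (s' - s) * (c k / (c k + eta)).
  rewrite /theta /d km; field.
  by rewrite (gt_eqF mR) (gt_eqF eps0) (gt_eqF dk0) subr_eq0 (gt_eqF ss').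
by rewrite ler_piMr// ler_pdivrMr// mul1r lerDl ltW.
Qed.
End OneVariable.

(** * Smooth families of maps of a manifold *)

Lemma for_continuous_pair (T U V : topologicalType) (f : T -> U) (g : T -> V) (x : T) :
  {for x, continuous f} -> {for x, continuous g} ->
  {for x, continuous (fun y => (f y, g y))}.
Proof. by move=> cf cg; apply: cvg_pair; [exact: cf|exact: cg]. Qed.

Section Pt.
Context {R : realType} {m : nat}.

Definition pt (t : R) (x : 'rV[R]_m) : 'rV[R]_(1 + m) := row_mx t%:M x.

Lemma pt_time t x : lsubmx (pt t x) 0 0 = t.
Proof. by rewrite row_mxKl mxE eqxx mulr1n. Qed.

Lemma pt_space t x : rsubmx (pt t x) = x.
Proof. by rewrite row_mxKr. Qed.

Lemma ptK (z : 'rV[R]_(1 + m)) : pt (lsubmx z 0 0) (rsubmx z) = z.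
Proof.
rewrite /pt -[RHS]hsubmxK; congr row_mx.
by apply/rowP => j; rewrite !ord1 mxE eqxx mulr1n.
Qed.

Lemma pt_lshift t x j : pt t x 0 (lshift m j) = t.
Proof. by rewrite row_mxEl !ord1 mxE eqxx mulr1n. Qed.

Lemma pt_rshift t x j : pt t x 0 (rshift 1 j) = x 0 j.
Proof. by rewrite row_mxEr. Qed.

Lemma for_continuous_pt (T : topologicalType) (t : T -> R) (x : T -> 'rV[R]_m) a :
  {for a, continuous t} -> {for a, continuous x} ->
  {for a, continuous (fun a => pt (t a) (x a))}.
Proof.
move=> ct cx; apply: for_continuous_rV => j.
case: (split_ordP j) => k ->.
  by rewrite (_ : (fun _ => _) = t)//; apply/funext => y; rewrite pt_lshift.
rewrite (_ : (fun _ => _) = (fun y => x y 0 k)).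
  apply: (@continuous_comp _ _ _ x (fun v : 'rV[R]_m => v 0 k)) => //.
  exact: coord_continuous.
by apply/funext => y; rewrite pt_rshift.
Qed.

Lemma smooth_at_time (z : 'rV[R]_(1 + m)) : smooth_at (fun z => lsubmx z 0 0) z.
Proof.
move=> k; apply: Ck_at_ext (Ck_at_coord k (lshift m 0) z).
by apply: near_all => y; rewrite mxE.
Qed.

Lemma smooth_at_space j (z : 'rV[R]_(1 + m)) : smooth_at (fun z => rsubmx z 0 j) z.
Proof.
move=> k; apply: Ck_at_ext (Ck_at_coord k (rshift 1 j) z).
by apply: near_all => y; rewrite mxE.
Qed.

Lemma smooth_at_pt p (t : 'rV[R]_p -> R) (x : 'rV[R]_p -> 'rV[R]_m) z :
  smooth_at t z -> (forall j, smooth_at (fun z => x z 0 j) z) ->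
  forall j, smooth_at (fun z => pt (t z) (x z) 0 j) z.
Proof.
move=> st sx j; case: (split_ordP j) => k ->.
  by apply: smooth_at_ext st; apply: near_all => y; rewrite pt_lshift.
by apply: smooth_at_ext (sx k); apply: near_all => y; rewrite pt_rshift.
Qed.

Lemma time_continuous : continuous (fun z : 'rV[R]_(1 + m) => lsubmx z 0 0).
Proof. by move=> z; exact/smooth_at_continuous/smooth_at_time. Qed.

Lemma space_continuous : continuous (fun z : 'rV[R]_(1 + m) => rsubmx z).
Proof.
by move=> z; apply: for_continuous_rV => j; exact/smooth_at_continuous/smooth_at_space.
Qed.

Lemma derive_pt (V : normedModType R) (t : V -> R) (x : V -> 'rV[R]_m) a v :
  differentiable t a -> differentiable x a ->
  differentiable (fun s => pt (t s) (x s)) a /\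
  'D_v (fun s => pt (t s) (x s)) a = pt ('D_v t a) ('D_v x a).
Proof.
move=> dt dx.
have dpt : differentiable (fun s => pt (t s) (x s)) a.
  apply: differentiable_rV => j; case: (split_ordP j) => k ->.
    by rewrite (_ : (fun _ => _) = t)//; apply/funext => y; rewrite pt_lshift.
  rewrite (_ : (fun _ => _) = (fun y => x y 0 k)); first exact: diff_coord.
  by apply/funext => y; rewrite pt_rshift.
split=> //; apply/rowP => j; rewrite -(derive_coord v j dpt).
case: (split_ordP j) => k ->.
  rewrite pt_lshift (_ : (fun _ => _) = t)//.
  by apply/funext => y; rewrite pt_lshift.
rewrite pt_rshift -(derive_coord v k dx) (_ : (fun _ => _) = (fun y => x y 0 k))//.
by apply/funext => y; rewrite pt_rshift.
Qed.

End Pt.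

Section Rep.
Context {R : realType} {M : topologicalType} {m : nat} (A : smooth_atlas R M m).
Implicit Types (F G : R -> M -> M) (i j k : atlas_index A).

Definition joint (U : Type) (F : R -> M -> U) := fun z : R * M => F z.1 z.2.

Lemma chart_img_map i p : chart_dom (A i) p -> chart_img (A i) (chart_map (A i) p).
Proof. by move=> ip; exists p. Qed.

Lemma chart_invK i x : chart_img (A i) x -> chart_map (A i) (chart_inv (A i) x) = x.
Proof. by move=> [p ip <-]; rewrite chart_mapK. Qed.

Lemma chart_inv_dom i x : chart_img (A i) x -> chart_dom (A i) (chart_inv (A i) x).
Proof. by move=> [p ip <-]; rewrite chart_mapK. Qed.

Lemma near_dom i p : chart_dom (A i) p -> \forall q \near p, chart_dom (A i) q.
Proof. by move=> ip; apply: open_nbhs_nbhs; split => //; exact: chart_dom_open. Qed.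

Lemma near_img i x : chart_img (A i) x -> \forall y \near x, chart_img (A i) y.
Proof. by move=> ix; apply: open_nbhs_nbhs; split => //; exact: chart_img_open. Qed.

Definition family_rep F i j (z : 'rV[R]_(1 + m)) : 'rV[R]_m :=
  chart_map (A j) (F (lsubmx z 0 0) (chart_inv (A i) (rsubmx z))).

Definition family_at F i (z : 'rV[R]_(1 + m)) : M :=
  F (lsubmx z 0 0) (chart_inv (A i) (rsubmx z)).

Lemma family_at_continuous F i z : continuous (joint F) -> chart_img (A i) (rsubmx z) ->
  {for z, continuous (family_at F i)}.
Proof.
move=> cF iz.
apply: (@continuous_comp _ _ _
  (fun z : 'rV[R]_(1 + m) => (lsubmx z 0 0, chart_inv (A i) (rsubmx z))) (joint F)).
  apply: for_continuous_pair; first exact: time_continuous.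
  apply: (@continuous_comp _ _ _ (fun z : 'rV[R]_(1 + m) => rsubmx z) (chart_inv (A i))).
    exact: space_continuous.
  exact: chart_inv_continuous.
exact: cF.
Qed.

Lemma near_family_rep F i j z : continuous (joint F) -> chart_img (A i) (rsubmx z) ->
  chart_dom (A j) (family_at F i z) ->
  \forall w \near z, chart_img (A i) (rsubmx w) /\ chart_dom (A j) (family_at F i w).
Proof.
move=> cF iz jz.
have H1 : \forall w \near z, chart_img (A i) (rsubmx w).
  by have := @space_continuous R m z _ (near_img iz).
have H2 : \forall w \near z, chart_dom (A j) (family_at F i w).
  by have := family_at_continuous cF iz (near_dom jz).
by near=> w; split; near: w.
Unshelve. all: by end_near. Qed.

Lemma family_rep_continuous F i j z : continuous (joint F) -> chart_img (A i) (rsubmx z) ->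
  chart_dom (A j) (family_at F i z) -> {for z, continuous (family_rep F i j)}.
Proof.
move=> cF iz jz.
apply: (@continuous_comp _ _ _ (family_at F i) (chart_map (A j))).
  exact: family_at_continuous.
exact: chart_map_continuous.
Qed.

(* Joint smoothness on all of R x M, i.e. without boundary in time. *)
Definition smooth_family F := continuous (joint F) /\
  forall t p i j, chart_dom (A i) p -> chart_dom (A j) (F t p) ->
    forall l, smooth_at (fun z => family_rep F i j z 0 l) (pt t (chart_map (A i) p)).

Lemma smooth_at_family_rep F i j z : smooth_family F -> chart_img (A i) (rsubmx z) ->
  chart_dom (A j) (family_at F i z) -> forall l, smooth_at (fun z => family_rep F i j z 0 l) z.
Proof.
move=> [_ sF] iz jz l; rewrite -[z]ptK -[rsubmx z](chart_invK iz).
by apply: sF => //; exact: chart_inv_dom.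
Qed.

Lemma smooth_family_diff F i j t p : smooth_family F -> chart_dom (A i) p ->
  chart_dom (A j) (F t p) -> differentiable (family_rep F i j) (pt t (chart_map (A i) p)).
Proof.
by move=> [_ sF] ip jp; apply: differentiable_rV => l; apply/smooth_at_diff/sF.
Qed.

Lemma smooth_family_comp F G : smooth_family F -> smooth_family G ->
  smooth_family (fun t p => F t (G t p)).
Proof.
move=> sF sG; have [cF _] := sF; have [cG _] := sG; split.
  move=> z; apply: (@continuous_comp _ _ _ (fun z : R * M => (z.1, joint G z)) (joint F)).
    by apply: for_continuous_pair; [exact: cvg_fst|exact: cG].
  exact: cF.
move=> t p i j ip jp l; have [k kp] := atlas_cover A (G t p).
set z0 := pt _ _.
have iz0 : chart_img (A i) (rsubmx z0) by rewrite pt_space; exact: chart_img_map.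
have kz0 : chart_dom (A k) (family_at G i z0).
  by rewrite /family_at pt_time pt_space chart_mapK.
pose g z := pt (lsubmx z 0 0) (family_rep G i k z).
have sg : forall l', smooth_at (fun z => g z 0 l') z0.
  apply: smooth_at_pt; first exact: smooth_at_time.
  by move=> j'; exact: smooth_at_family_rep.
have gz0 : g z0 = pt t (chart_map (A k) (G t p)).
  by rewrite /g /family_rep pt_time pt_space chart_mapK.
apply: (@smooth_at_ext _ _ ((fun z => family_rep F k j z 0 l) \o g)); last first.
  by apply: smooth_at_comp => //; rewrite gz0; case: sF => _; exact.
have := near_family_rep cG iz0 kz0; apply: filterS => z [iz kz].
by rewrite /= /family_rep /g pt_time pt_space chart_mapK.
Qed.

End Rep.

(** * Inverses of continuous families of bijections of a compact space *)

Section InverseContinuity.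
Context {T M : topologicalType}.
Hypotheses (M_compact : compact [set: M]) (M_hausdorff : hausdorff_space M).

Lemma near_all_compact (X : topologicalType) (x : X) (P : X -> M -> Prop) (K : set M) :
  compact K ->
  (forall p, K p -> \forall q \near p & y \near x, P y q) ->
  \forall y \near x, forall p, K p -> P y p.
Proof. by move=> /compact_near_coveringP cK /(cK X (nbhs x) P); exact. Qed.

(** Let V be an open neighbourhood of G(t, q). For p outside V the points F(t, p) and q differ and
    are separated by open sets. Compactness of the complement of V makes the separation uniform for
    parameters near (t, q), and there [G] can only take values in V. *)
Lemma continuous_inverse_family (F G : T -> M -> M) :
  continuous (fun z : T * M => F z.1 z.2) ->
  (forall t, cancel (F t) (G t)) -> (forall t, cancel (G t) (F t)) ->
  continuous (fun z : T * M => G z.1 z.2).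
Proof.
move=> cF FK GK [t q] U /=; rewrite nbhsE/= => -[V [oV Vp] VU].
have cV : compact (~` V).
  by apply: subclosed_compact M_compact _ => //; exact: open_closedC.
have H p : (~` V) p -> \forall p' \near p & z \near (t, q), F z.1 p' <> z.2.
  move=> nVp; have Fpq : F t p != q.
    by apply/eqP => E; apply: nVp; rewrite -(FK t p) E.
  move: M_hausdorff; rewrite open_hausdorff => /(_ _ _ Fpq)[[B C]/= [/set_mem Bp /set_mem Cq] [oB oC BC]].
  have B' : \forall z \near (t, p), B (F z.1 z.2).
    by apply: (cF (t, p)); exact: open_nbhs_nbhs.
  have C' : \forall z \near q, C z by exact: open_nbhs_nbhs.
  move: B' => [[/= N1 N2] [N1t N2p] NB].
  exists (N2, [set z : T * M | N1 z.1 /\ C z.2]) => /=.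
    split=> //; exists (N1, C) => //=; split=> //.
  move=> [p' [t' q']]/= [N2p' [N1t' Cq']] E.
  have : (B `&` C) q' by split=> //; rewrite -E; exact: (NB (t', p')).
  by rewrite (eqP BC).
have := near_all_compact cV H.
apply: filterS => z Hz; apply: VU; apply: contrapT => nV.
by apply: (Hz _ nV); rewrite GK.
Qed.
End InverseContinuity.

Lemma derive_comp {R : realType} (U V W : normedModType R) (f : U -> V) (g : V -> W)
    (x v : U) : differentiable f x -> differentiable g (f x) ->
  'D_v (g \o f) x = 'D_('D_v f x) g (f x).
Proof.
move=> df dg; have dgf := differentiable_comp df dg.
by rewrite (deriveE v dgf) (diff_comp df dg) (deriveE _ dg) (deriveE v df).
Qed.

Lemma open_near (T : topologicalType) (B : set T) :
  (forall x, B x -> \forall y \near x, B y) -> open B.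
Proof. by move=> HB; rewrite openE => x Bx; exact: HB. Qed.

(** * Smooth families and their inverses *)

Section Families.
Context {R : realType} {M : topologicalType} {m : nat} (A : smooth_atlas R M m).
Implicit Types (F G : R -> M -> M) (f g : M -> M) (i j k : atlas_index A).

Definition chart_rep f i j (x : 'rV[R]_m) : 'rV[R]_m := chart_map (A j) (f (chart_inv (A i) x)).

Lemma chart_rep_continuous f i x : continuous f -> chart_img (A i) x ->
  {for x, continuous (fun x => f (chart_inv (A i) x))}.
Proof.
move=> cf ix; apply: (@continuous_comp _ _ _ (chart_inv (A i)) f); last exact: cf.
exact: chart_inv_continuous.
Qed.

Lemma near_chart_rep f i j x : continuous f -> chart_img (A i) x ->
  chart_dom (A j) (f (chart_inv (A i) x)) ->
  \forall y \near x, chart_img (A i) y /\ chart_dom (A j) (f (chart_inv (A i) y)).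
Proof.
move=> cf ix jx.
have H1 : \forall y \near x, chart_img (A i) y by exact: near_img.
have H2 : \forall y \near x, chart_dom (A j) (f (chart_inv (A i) y)).
  by have := chart_rep_continuous cf ix (near_dom jx).
by near=> y; split; near: y.
Unshelve. all: by end_near. Qed.

Lemma smooth_map_at f i j p l : smooth_map A f -> chart_dom (A i) p ->
  chart_dom (A j) (f p) -> smooth_at (fun x => chart_rep f i j x 0 l) (chart_map (A i) p).
Proof.
move=> [cf sf] ip jp; apply: (smooth_on_smooth_at _ (sf i j l)).
  by apply: open_near => x [ix jx]; exact: near_chart_rep.
by split; [exact: chart_img_map|rewrite chart_mapK].
Qed.

Lemma family_slice_continuous F t : continuous (joint F) -> continuous (F t).
Proof.
move=> cF p; apply: (@continuous_comp _ _ _ (fun p : M => (t, p)) (joint F)).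
  by apply: for_continuous_pair; [exact: cst_continuous|exact: cvg_id].
exact: cF.
Qed.

Lemma smooth_family_slice F t i j p l : smooth_family A F -> chart_dom (A i) p ->
  chart_dom (A j) (F t p) -> smooth_at (fun x => chart_rep (F t) i j x 0 l) (chart_map (A i) p).
Proof.
move=> sF ip jp.
apply: (@smooth_at_ext _ _ ((fun z => family_rep F i j z 0 l) \o pt t)).
  by apply: near_all => x; rewrite /= /family_rep pt_time pt_space.
apply: smooth_at_comp; last by case: sF => _; exact.
apply: smooth_at_pt => [k|j' k]; [exact: Ck_at_cst|exact: Ck_at_coord].
Qed.

Lemma smooth_family_map F t : smooth_family A F -> smooth_map A (F t).
Proof.
move=> sF; have [cF _] := sF; have cFt := family_slice_continuous (t:=t) cF.
split=> // i j l.
apply: (@smooth_at_smooth_on _ _ _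
  [set x | chart_img (A i) x /\ chart_dom (A j) (F t (chart_inv (A i) x))]) => //.
  by apply: open_near => x [ix jx]; exact: near_chart_rep.
move=> x [ix jx]; rewrite -[x](chart_invK ix).
by apply: smooth_family_slice => //; exact: chart_inv_dom.
Qed.

Lemma chart_rep_diff f i j p : smooth_map A f -> chart_dom (A i) p -> chart_dom (A j) (f p) ->
  differentiable (chart_rep f i j) (chart_map (A i) p).
Proof.
by move=> sf ip jp; apply: differentiable_rV => l; apply/smooth_at_diff/smooth_map_at.
Qed.

Lemma chart_rep_comp f g i j k p : continuous g -> chart_dom (A i) p -> chart_dom (A k) (g p) ->
  \forall x \near chart_map (A i) p, chart_rep (f \o g) i j x = (chart_rep f k j \o chart_rep g i k) x.
Proof.
move=> cg ip kp.
have := @near_chart_rep g i k (chart_map (A i) p) cg (chart_img_map ip).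
rewrite chart_mapK// => /(_ kp); apply: filterS => x [ix kx].
by rewrite /chart_rep /= chart_mapK.
Qed.

Lemma chart_rep_left_inverse f g i j p (u : 'rV[R]_m) : smooth_map A f -> smooth_map A g ->
  cancel f g -> chart_dom (A i) p -> chart_dom (A j) (f p) ->
  'D_('D_u (chart_rep f i j) (chart_map (A i) p)) (chart_rep g j i) (chart_map (A j) (f p)) = u.
Proof.
move=> sf sg fK ip jp.
have df := chart_rep_diff sf ip jp.
have dg : differentiable (chart_rep g j i) (chart_map (A j) (f p)).
  by apply: chart_rep_diff => //; rewrite fK.
have E : chart_rep f i j (chart_map (A i) p) = chart_map (A j) (f p) by rewrite /chart_rep chart_mapK.
rewrite -E -derive_comp//; last by rewrite E.
rewrite -[RHS](derive_id (chart_map (A i) p) u); apply: near_eq_derive.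
have := @chart_rep_comp g f i i j p (proj1 sf) ip jp.
have ni := near_img (chart_img_map ip).
move=> nc; near=> x; have <- : chart_rep (g \o f) i i x = (chart_rep g j i \o chart_rep f i j) x by near: x.
by rewrite /chart_rep /= fK chart_invK//; near: x.
Unshelve. all: by end_near. Qed.

(** Adjoining time as a coordinate turns the family into the single map (t, x) -> (t, F_t x) of
    R^(1+m), to which [smooth_right_inverse] applies. The smoothness of each [G t] separately yields
    the invertible Jacobian. *)
Lemma smooth_family_inverse F G : smooth_family A F -> continuous (joint G) ->
  (forall t, cancel (F t) (G t)) -> (forall t, cancel (G t) (F t)) ->
  (forall t, smooth_map A (G t)) -> smooth_family A G.
Proof.
move=> sF cG FK GK sG; split=> // t q j i jq ip.
set p := G t q in ip.
have Fp : F t p = q by rewrite /p GK.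
have [cF sF'] := sF.
pose F' z := pt (lsubmx z 0 0) (family_rep F i j z).
pose G' w := pt (lsubmx w 0 0) (family_rep G j i w).
set w0 := pt t (chart_map (A j) q).
set z0 := pt t (chart_map (A i) p).
have jw0 : chart_img (A j) (rsubmx w0) by rewrite pt_space; exact: chart_img_map.
have iw0 : chart_dom (A i) (family_at G j w0).
  by rewrite /family_at pt_time pt_space chart_mapK.
have Gw0 : G' w0 = z0 by rewrite /G' /family_rep pt_time pt_space chart_mapK.
have nw := near_family_rep cG jw0 iw0.
have jFp : chart_dom (A j) (F t p) by rewrite Fp.
have dF := smooth_family_diff sF ip jFp.
have sF'0 : forall l', smooth_at (fun z => F' z 0 l') z0.
  by apply: smooth_at_pt; [exact: smooth_at_time|move=> l'; exact: sF'].
have sG' : forall l', smooth_at (fun w => G' w 0 l') w0.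
  apply: (@smooth_right_inverse _ _ F').
  - near=> w.
    have [jw iw] : chart_img (A j) (rsubmx w) /\ chart_dom (A i) (family_at G j w) by near: w.
    apply: for_continuous_pt; first exact: time_continuous.
    exact: family_rep_continuous.
  - near=> w.
    have [jw iw] : chart_img (A j) (rsubmx w) /\ chart_dom (A i) (family_at G j w) by near: w.
    by rewrite /F' /family_rep !pt_time !pt_space chart_mapK// GK chart_invK// ptK.
  - by rewrite Gw0.
  (* A vector in the kernel of the Jacobian has zero time component, and its space component is
     killed by the differential of [F t], of which the differential of [G t] is a left inverse. *)
  - rewrite Gw0 -row_free_unit; apply: inj_row_free => v.
    have dF' : differentiable F' z0 by apply: differentiable_rV => l'; exact/smooth_at_diff.
    rewrite -(deriveEjacobian v dF').
    have dt : differentiable (fun z : 'rV[R]_(1 + m) => lsubmx z 0 0) z0.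
      exact/smooth_at_diff/smooth_at_time.
    have [_ ->] := derive_pt v dt dF.
    move=> E; have : pt ('D_v (fun z : 'rV[R]_(1 + m) => lsubmx z 0 0) z0)
        ('D_v (family_rep F i j) z0) = pt 0 0 by rewrite E; apply/rowP => j';
        case: (split_ordP j') => ? ->; rewrite ?pt_lshift ?pt_rshift !mxE.
    move=> {}E; have := congr1 (fun z : 'rV[R]_(1 + m) => lsubmx z 0 0) E.
    have := congr1 rsubmx E; rewrite !pt_space !pt_time => Dv v0.
    have vE : v = pt 0 (rsubmx v).
      rewrite -[LHS]ptK; congr pt; rewrite -[RHS]v0.
      have dx : differentiable (fun z : 'rV[R]_(1 + m) => z) z0 by [].
      rewrite (_ : (fun z : 'rV[R]_(1 + m) => lsubmx z 0 0) = (fun z => z 0 (lshift m 0))).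
        by rewrite (derive_coord v _ dx) derive_id mxE.
      by apply/funext => z; rewrite mxE.
    have : 'D_(rsubmx v) (chart_rep (F t) i j) (chart_map (A i) p) = 0.
      have -> : chart_rep (F t) i j = family_rep F i j \o pt t.
        by apply/funext => x; rewrite /= /family_rep pt_time pt_space.
      have dc : differentiable (fun _ : 'rV[R]_m => t) (chart_map (A i) p) by [].
      have di : differentiable (fun x : 'rV[R]_m => x) (chart_map (A i) p) by [].
      have [dpt Dpt] := derive_pt (rsubmx v) dc di.
      by rewrite derive_comp// Dpt derive_cst derive_id -vE.
    have := @chart_rep_left_inverse (F t) (G t) i j p (rsubmx v) (smooth_family_map t sF)
      (sG t) (FK t) ip jFp.
    move=> + D0; rewrite D0 => Dg; rewrite vE -Dg.
    rewrite deriveE; last by apply: chart_rep_diff => //; rewrite FK.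
    by rewrite linear0; apply/rowP => j';
        case: (split_ordP j') => ? ->; rewrite ?pt_lshift ?pt_rshift !mxE.
move=> l; apply: smooth_at_ext (sG' (rshift 1 l)).
by apply: near_all => w; rewrite pt_rshift.
Unshelve. all: by end_near. Qed.

End Families.

(** * Strictly contact flows *)

Section Flows.
Context {R : realType} {M : topologicalType} {m : nat} {A : smooth_atlas R M m}.
Variable alpha : one_form A.
Implicit Types (F G : R -> M -> M) (f g : M -> M) (i j k : atlas_index A).

(** Directional derivatives replace Jacobian matrices, so that the chain rule in the form of
    [derive_comp] can be used for compositions and inverses. *)
Lemma preserves_formP f : smooth_map A f -> preserves_form alpha f <->
  (forall i j p (v : 'rV[R]_m), chart_dom (A i) p -> chart_dom (A j) (f p) ->
    'D_v (chart_rep f i j) (chart_map (A i) p) *m form_coef alpha j (chart_map (A j) (f p))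
    = v *m form_coef alpha i (chart_map (A i) p)).
Proof.
move=> sf; split=> [pf i j p v ip jp|H i j p ip jp].
  rewrite deriveEjacobian; last exact: chart_rep_diff.
  by rewrite -mulmxA; congr (_ *m _); exact: pf.
apply/row_matrixP => a; rewrite [LHS]row_mul !rowE -(H i j p (delta_mx 0 a) ip jp).
by rewrite deriveEjacobian//; exact: chart_rep_diff.
Qed.

Lemma preserves_form_comp f g : smooth_map A f -> smooth_map A g ->
  smooth_map A (f \o g) ->
  preserves_form alpha f -> preserves_form alpha g -> preserves_form alpha (f \o g).
Proof.
move=> sf sg sfg /(preserves_formP sf) pf /(preserves_formP sg) pg.
apply/(preserves_formP sfg) => i j p v ip jp.
have [k kp] := atlas_cover A (g p).
have := chart_rep_comp f j (proj1 sg) ip kp => E.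
have {}E : 'D_v (chart_rep (f \o g) i j) (chart_map (A i) p) =
   'D_('D_v (chart_rep g i k) (chart_map (A i) p)) (chart_rep f k j) (chart_map (A k) (g p)).
  have gE : chart_rep g i k (chart_map (A i) p) = chart_map (A k) (g p) by rewrite /chart_rep chart_mapK.
  have dg := chart_rep_diff sg ip kp; have df := chart_rep_diff sf kp jp.
  by rewrite -gE -derive_comp ?gE//; exact: near_eq_derive.
by rewrite E pf// pg.
Qed.

Lemma preserves_form_inverse f g : smooth_map A f -> smooth_map A g ->
  cancel f g -> cancel g f -> preserves_form alpha f -> preserves_form alpha g.
Proof.
move=> sf sg fK gK /(preserves_formP sf) pf; apply/(preserves_formP sg) => j i q v jq ip.
have jq' : chart_dom (A j) (f (g q)) by rewrite gK.
by rewrite -(pf i j _ _ ip jq') (chart_rep_left_inverse v sg sf gK jq ip) gK.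
Qed.

Definition velocity F p j (t : R) : 'rV[R]_m := 'D_1 (fun s => chart_map (A j) (F s p)) t.

(** This is alpha(X_t) at the point [F t p], read in the chart [A j]; the trajectory is labelled by
    [p], not by its position at time t. *)
Definition pairing F p j t : R :=
  (velocity F p j t *m form_coef alpha j (chart_map (A j) (F t p))) 0 0.

Lemma curve_family_rep F p i j : chart_dom (A i) p ->
  (fun s => chart_map (A j) (F s p)) = family_rep F i j \o (fun s => pt s (chart_map (A i) p)).
Proof. by move=> ip; apply/funext => s; rewrite /= /family_rep pt_time pt_space chart_mapK. Qed.

Let derive_pt_time (x : 'rV[R]_m) (t : R) :
  differentiable (fun s => pt s x) t /\ 'D_1 (fun s => pt s x) t = pt 1 0.
Proof.
have di : differentiable (fun s : R => s) t by [].
have dc : differentiable (fun _ : R => x) t by [].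
by have [d D] := @derive_pt R m R _ _ t 1 di dc; split=> //; rewrite D derive_id derive_cst.
Qed.

Lemma curve_diff F p j t : smooth_family A F -> chart_dom (A j) (F t p) ->
  differentiable (fun s => chart_map (A j) (F s p)) t.
Proof.
move=> sF jp; have [i ip] := atlas_cover A p; rewrite (curve_family_rep F j ip).
apply: differentiable_comp; last exact: smooth_family_diff.
by have [] := derive_pt_time (chart_map (A i) p) t.
Qed.

Lemma velocity_rep F p i j t : smooth_family A F -> chart_dom (A i) p ->
  chart_dom (A j) (F t p) ->
  velocity F p j t = 'D_(pt 1 0) (family_rep F i j) (pt t (chart_map (A i) p)).
Proof.
move=> sF ip jp; rewrite /velocity (curve_family_rep F j ip).
have [dpt Dpt] := derive_pt_time (chart_map (A i) p) t.
by rewrite derive_comp ?Dpt//; exact: smooth_family_diff.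
Qed.

(* The Hamiltonians of a composition F o G of isotopies add, with that of G
   transported by F, because F_t preserves the form. *)
Lemma pairing_comp F G t p j k : smooth_family A F -> smooth_family A G ->
  preserves_form alpha (F t) -> chart_dom (A k) (G t p) ->
  chart_dom (A j) (F t (G t p)) ->
  pairing (fun s p => F s (G s p)) p j t = pairing F (G t p) j t + pairing G p k t.
Proof.
move=> sF sG pF kp jp; rewrite /pairing.
have [i ip] := atlas_cover A p.
set q := G t p in kp jp *.
suff -> : velocity (fun s p => F s (G s p)) p j t =
    velocity F q j t + 'D_(velocity G p k t) (chart_rep (F t) k j) (chart_map (A k) q).
  rewrite mulmxDl mxE; congr (_ + _).
  by have /(preserves_formP (smooth_family_map t sF)) -> := pF.
have dG : differentiable (fun s => chart_map (A k) (G s p)) t by exact: curve_diff.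
have di : differentiable (fun s : R => s) t by [].
have [dpt Dpt] := @derive_pt R m R _ _ t 1 di dG.
have dF := smooth_family_diff sF kp jp.
have E : \forall s \near t, (family_rep F k j \o (fun s => pt s (chart_map (A k) (G s p)))) s =
    chart_map (A j) (F s (G s p)).
  have : \forall s \near t, chart_dom (A k) (G s p).
    have cG := (@continuous_comp _ _ _ (fun s : R => (s, p)) (joint G) t).
    apply: cG (near_dom kp); last by case: sG => cG _; exact: cG.
    by apply: for_continuous_pair; [exact: cvg_id|exact: cst_continuous].
  by apply: filterS => s ks; rewrite /= /family_rep pt_time pt_space chart_mapK.
rewrite {1}/velocity -(near_eq_derive _ E) derive_comp//.
rewrite Dpt derive_id -/(velocity G p k t) (velocity_rep sF kp jp).
(* The time direction accounts for the velocity of [F], the space direction for the image of the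
   velocity of [G] under the differential of [F t]. *)
have -> : pt 1 (velocity G p k t) = pt 1 0 + pt 0 (velocity G p k t).
  by apply/rowP => l; case: (split_ordP l) => l' ->;
    rewrite [RHS]mxE ?pt_lshift ?pt_rshift ?addr0// [X in X + _]mxE add0r.
rewrite !(deriveE _ dF) linearD; congr (_ + _).
have -> : chart_rep (F t) k j = family_rep F k j \o pt t.
  by apply/funext => x; rewrite /= /family_rep pt_time pt_space.
have dc : differentiable (fun _ : 'rV[R]_m => t) (chart_map (A k) q) by [].
have di' : differentiable (fun x : 'rV[R]_m => x) (chart_map (A k) q) by [].
have [dpt' Dpt'] := derive_pt (velocity G p k t) dc di'.
by rewrite derive_comp// Dpt' derive_cst derive_id (deriveE _ dF).
Qed.

Lemma pairing_id p j t : pairing (fun=> id) p j t = 0.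
Proof. by rewrite /pairing /velocity derive_cst mul0mx mxE. Qed.

Definition generates F (H : R -> M -> R) :=
  forall t p j, chart_dom (A j) (F t p) -> H t (F t p) = pairing F p j t.

(* A strictly contact isotopy defined for all times, with its inverse and its
   Hamiltonian. *)
Record flow F G (H : R -> M -> R) : Prop := Flow {
  flow_smooth : smooth_family A F;
  flow_smooth_inv : smooth_family A G;
  flowK : forall t, cancel (F t) (G t);
  flow_invK : forall t, cancel (G t) (F t);
  flow_preserves : forall t, preserves_form alpha (F t);
  flow_generates : generates F H
}.

Lemma flow_comp F G H F' G' H' : flow F G H -> flow F' G' H' ->
  flow (fun t p => F t (F' t p)) (fun t p => G' t (G t p))
       (fun t p => H t p + H' t (G t p)).
Proof.
move=> [sF sG FK GK pF hF] [sF' sG' FK' GK' pF' hF']; split.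
- exact: smooth_family_comp.
- exact: smooth_family_comp.
- by move=> t p; rewrite FK FK'.
- by move=> t p; rewrite GK' GK.
- move=> t; apply: (@preserves_form_comp (F t) (F' t)) => //.
  + exact: smooth_family_map.
  + exact: smooth_family_map.
  + exact: (smooth_family_map t (smooth_family_comp sF sF')).
- move=> t p j jp; have [k kp] := atlas_cover A (F' t p).
  by rewrite (@pairing_comp F F' t p j k)// -hF// -hF'// FK.
Qed.

(** The additive law [pairing_comp], applied to the constant family F_t o G_t = id with zero
    pairing, determines the Hamiltonian of the inverse. *)
Lemma flow_inv F G H : flow F G H -> flow G F (fun t p => - H t (F t p)).
Proof.
move=> [sF sG FK GK pF hF]; split=> //.
  by move=> t; apply: (@preserves_form_inverse (F t) (G t)) => //; exact: smooth_family_map.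
move=> t q i iq; have [j jq] := atlas_cover A q.
have jq' : chart_dom (A j) (F t (G t q)) by rewrite GK.
have := @pairing_comp F G t q j i sF sG (pF t) iq jq'.
have -> : (fun s p => F s (G s p)) = (fun=> id).
  by apply/funext => s; apply/funext => p; exact: GK.
by rewrite pairing_id -hF// GK => /esym/eqP; rewrite addr_eq0 => /eqP ->; rewrite opprK.
Qed.

Lemma flow_joint F G H : flow F G H -> continuous (joint F).
Proof. by case=> -[]. Qed.

Lemma velocity_limit F p j t : smooth_family A F -> chart_dom (A j) (F t p) ->
  (s - t)^-1 *: (chart_map (A j) (F s p) - chart_map (A j) (F t p))
    @[s --> t^'] --> velocity F p j t.
Proof.
move=> sF jp; have dc := curve_diff sF jp.
have /cvg_ex[l Hl] : derivable (fun s => chart_map (A j) (F s p)) t 1.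
  exact: diff_derivable.
have lE : velocity F p j t = l by apply/cvg_lim.
rewrite lE; move/cvgrPdist_le : Hl => Hl; apply/cvgrPdist_le => e e0.
have /nbhs_normP[d/= d0 dH] := Hl e e0; apply/nbhs_normP; exists d => //= s.
rewrite /ball_/= => sd st; have := dH (s - t).
rewrite /ball_/= sub0r normrN distrC => /(_ sd).
by rewrite subr_eq0 => /(_ st); rewrite [(s - t)%:A]mulr1 subrK.
Qed.

Lemma flow_smooth_system F G H : flow F G H -> F 0 = id -> smooth_system alpha F H.
Proof.
move=> [sF sG FK GK pF hF] F0; split.
  split=> //; split=> //.
  - by apply: continuous_subspaceT => z; have [cF _] := sF; exact: cF.
  - move=> i j F' l; have [cF _] := sF.
    apply: (@smooth_at_smooth_on _ _ _
      [set z | chart_img (A i) (rsubmx z) /\ chart_dom (A j) (family_at F i z)]).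
    + by apply: open_near => z [iz jz]; exact: near_family_rep.
    + by move=> z [].
    + by move=> z [iz jz]; exact: smooth_at_family_rep.
  - by move=> t _; exists (G t); split => //; exact: smooth_family_map.
(* The vector at [q] is the velocity of the trajectory passing through [q] at time t, which is the
   one that starts at [G t q]. *)
exists (fun t j q => velocity F (G t q) j t).
  move=> t j p _ jp; rewrite FK.
  apply: cvg_trans (velocity_limit sF jp); apply: cvg_app.
  exact: cvg_within.
move=> t j q _ jq; have jq' : chart_dom (A j) (F t (G t q)) by rewrite GK.
by rewrite -{1}(GK t q) (hF t (G t q) j jq') /pairing GK.
Qed.

Lemma coef_continuous j q l : chart_dom (A j) q ->
  {for q, continuous (fun q => form_coef alpha j (chart_map (A j) q) l 0)}.
Proof.
move=> jq.
apply: (@continuous_comp _ _ _ (chart_map (A j)) (fun x => form_coef alpha j x l 0)).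
  exact: chart_map_continuous.
apply: smooth_at_continuous.
have oj : open (chart_img (A j)) by exact: chart_img_open.
exact: (smooth_on_smooth_at oj (@form_smooth _ _ _ _ alpha j l) (chart_img_map jq)).
Qed.

Lemma pt10 : pt (1 : R) 0 = delta_mx 0 (lshift m 0) :> 'rV[R]_(1 + m).
Proof.
apply/rowP => l; case: (split_ordP l) => k ->; rewrite ?pt_lshift ?pt_rshift !mxE.
  by rewrite !ord1 !eqxx.
by rewrite eq_rlshift andbF.
Qed.

(** Near a given point, H(t, q) is a sum of time derivatives of a chart representation of [F] at (t,
    G_t q), multiplied by coefficients of the form; every factor is continuous in (t, q). *)
Lemma flow_continuous F G H : flow F G H -> continuous (joint H).
Proof.
move=> [sF sG FK GK pF hF] [t0 q0].
have [cG _] := sG; have [cF sF'] := sF.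
have [j jq0] := atlas_cover A q0; have [i ip0] := atlas_cover A (G t0 q0).
pose K (z : R * M) := \sum_l
  partial (lshift m 0) (fun z => family_rep F i j z 0 l) (pt z.1 (chart_map (A i) (joint G z))) *
  form_coef alpha j (chart_map (A j) z.2) l 0.
have nj : \forall z \near (t0, q0), chart_dom (A j) z.2.
  exact: (@cvg_snd R M (nbhs t0) (nbhs q0) _ _ (near_dom jq0)).
have ni : \forall z \near (t0, q0), chart_dom (A i) (joint G z).
  exact: (cG (t0, q0) _ (near_dom ip0)).
apply: (@near_eq_continuous _ _ K).
  near=> z; have jz : chart_dom (A j) z.2 by near: z.
  have iz : chart_dom (A i) (joint G z) by near: z.
  have jz' : chart_dom (A j) (F z.1 (G z.1 z.2)) by rewrite GK.
  rewrite [RHS]/joint -[in RHS](GK z.1 z.2) (hF z.1 _ j jz') /pairing (velocity_rep sF iz jz').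
  rewrite GK mxE /K; apply: eq_bigr => l _; congr (_ * _).
  have dr := smooth_family_diff sF iz jz'.
  by rewrite /partial (derive_coord _ l dr) pt10.
apply: for_continuous_sum => l; apply: for_continuousM; last first.
  apply: (@continuous_comp _ _ _ (fun z : R * M => z.2)
    (fun q => form_coef alpha j (chart_map (A j) q) l 0)); first exact: cvg_snd.
  exact: coef_continuous.
have jz0 : chart_dom (A j) (F t0 (G t0 q0)) by rewrite GK.
apply: (@continuous_comp _ _ _ (fun z : R * M => pt z.1 (chart_map (A i) (joint G z)))
   (partial (lshift m 0) (fun z => family_rep F i j z 0 l))).
  apply: for_continuous_pt; first exact: cvg_fst.
  apply: (@continuous_comp _ _ _ (joint G) (chart_map (A i))); first exact: cG.
  exact: chart_map_continuous.
by apply/smooth_at_continuous/smooth_at_partial/sF'.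
Unshelve. all: by end_near. Qed.

End Flows.

(** * Time changes of smooth strictly contact systems *)

Lemma continuous_within_comp (T U V : topologicalType) (B : set U) (f : U -> V)
    (g : T -> U) (x : T) : {within B, continuous f} -> {for x, continuous g} ->
  (forall y, B (g y)) -> {for x, continuous (f \o g)}.
Proof.
move=> /subspace_continuousP cf cg Bg W /= nW.
have := cf (g x) (Bg x) W nW; rewrite /within/= => nf.
have : \forall y \near x, B (g y) -> W (f (g y)) := cg _ nf.
by apply: filterS => y H; exact: H.
Qed.

Section Clamp.
Context {R : realType}.

(** The retraction of R onto [0,1]: composing with it turns objects that are meaningful on [0,1]
    only into continuous ones on R, unchanged on [0,1]. *)
Definition clamp (t : R) : R := Num.max 0 (Num.min 1 t).

Lemma clamp_itv t : clamp t \in `[0, 1].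
Proof. by rewrite in_itv/= /clamp le_max lexx ge_max ler01 ge_min lexx. Qed.

Lemma clamp_id t : t \in `[0, 1] -> clamp t = t.
Proof.
by rewrite in_itv/= /clamp => /andP[t0 t1]; rewrite (min_idPr t1) (max_idPr t0).
Qed.

Lemma clamp_continuous : continuous clamp.
Proof.
move=> t; apply: continuous_max; first exact: cst_continuous.
by apply: continuous_min; [exact: cst_continuous|exact: cvg_id].
Qed.

(** Uniqueness of the time derivatives in [generated_by] rests on this: every point of [0,1], the
    ends included, is a limit of other points of [0,1]. *)
Lemma within_itv_proper (t : R) : t \in `[0, 1] ->
  ProperFilter (within `[0, 1] t^').
Proof.
rewrite in_itv/= => /andP[t0 t1]; apply: Build_ProperFilter_ex => B.
move=> /nbhs_normP[d/= d0 dB].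
pose e := Num.min (d / 2) (1 / 4).
have e0 : 0 < e by rewrite lt_min !divr_gt0.
have ed : e < d by rewrite gt_min; apply/orP; left; lra.
have e4 : e <= 1 / 4 by rewrite ge_min lexx orbT.
(* A move by at most 1/4 towards the farther end of [0,1] stays inside. *)
have [th|th] := leP t (1 / 2).
  exists (t + e); apply: dB => //=.
  - by rewrite /ball_/= opprD addrA subrr add0r normrN gtr0_norm.
  - by rewrite -subr_eq0 addrC addKr gt_eqF.
  - by rewrite in_itv/=; apply/andP; split; lra.
exists (t - e); apply: dB => //=.
- by rewrite /ball_/= opprB addrC subrK gtr0_norm.
- by rewrite -subr_eq0 addrC addKr oppr_eq0 gt_eqF.
- by rewrite in_itv/=; apply/andP; split; lra.
Qed.
Lemma near_within_itv (u : R) (P : R -> Prop) :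
  (\forall s \near u, s \in `[0, 1] -> P s) -> \forall s \near within `[0, 1] u^', P s.
Proof.
move=> H; have : \forall s \near u, s != u -> s \in `[0, 1] -> P s.
  by apply: filterS H => s + _; exact.
exact.
Qed.
End Clamp.

Section Systems.
Context {R : realType} {M : topologicalType} {m : nat} {A : smooth_atlas R M m}.
Hypotheses (M_compact : compact [set: M]) (M_hausdorff : hausdorff_space M).
Variable alpha : one_form A.
Implicit Types (Phi F G : R -> M -> M) (i j k : atlas_index A).

Definition time_dom Phi i j := [set z : 'rV[R]_(1 + m) |
  [/\ lsubmx z 0 0 \in `[0, 1], chart_img (A i) (rsubmx z)
    & chart_dom (A j) (family_at Phi i z)]].

Lemma isotopy_joint Phi (g : R -> R) : smooth_isotopy A Phi -> continuous g ->
  (forall t, g t \in `[0, 1]) -> continuous (joint (fun t => Phi (g t))).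
Proof.
move=> [cP _ _ _] cg g01 z.
apply: (@continuous_within_comp _ _ _ _ (fun z : R * M => Phi z.1 z.2)
  (fun z : R * M => (g z.1, z.2)) z cP); last first.
  by move=> y; split=> //=; exact: g01.
apply: for_continuous_pair; last exact: cvg_snd.
by apply: (@continuous_comp _ _ _ (fun z : R * M => z.1) g); [exact: cvg_fst|exact: cg].
Qed.

Lemma isotopy_inverse Phi : smooth_isotopy A Phi -> exists Psi : R -> M -> M,
  forall u : R, u \in `[0, 1] ->
  [/\ smooth_map A (Phi u), smooth_map A (Psi u), cancel (Phi u) (Psi u) & cancel (Psi u) (Phi u)].
Proof.
move=> [_ _ dP _].
have H (u : R) : exists g : M -> M, u \in `[0, 1] ->
  [/\ smooth_map A (Phi u), smooth_map A g, cancel (Phi u) g & cancel g (Phi u)].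
  by have [/dP[g Hg]|nu] := boolP (u \in `[0, 1]); [exists g|exists id].
by have [Psi HPsi] := choice H; exists Psi.
Qed.

Lemma curve_near Phi p j (u : R) : smooth_isotopy A Phi -> u \in `[0, 1] ->
  chart_dom (A j) (Phi u p) ->
  \forall s \near u, s \in `[0, 1] -> chart_dom (A j) (Phi s p).
Proof.
move=> sP u01 jp.
have cF := isotopy_joint sP (@clamp_continuous R) (@clamp_itv R).
have : {for u, continuous (fun s => Phi (clamp s) p)}.
  apply: (@continuous_comp _ _ _ (fun s : R => (s, p)) (joint (fun t => Phi (clamp t)))).
    by apply: for_continuous_pair; [exact: cvg_id|exact: cst_continuous].
  exact: cF.
move=> csupp; have nj : \forall s \near u, chart_dom (A j) (Phi (clamp s) p).
  by apply: csupp; rewrite clamp_id//; exact: near_dom.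
by near=> s => s01; rewrite -(clamp_id s01); near: s.
Unshelve. all: by end_near. Qed.

(** The velocity in [generated_by] is a limit within [0,1], while the extension [g] is smooth across
    the end times. Within [0,1] the two difference quotients agree, so uniqueness of limits
    identifies the velocity with a genuine partial derivative in time. *)
Lemma velocity_extension Phi X i j l V g (u : R) p :
  smooth_isotopy A Phi -> generated_by Phi X -> open V -> Cinfty_on V g ->
  (forall y, time_dom Phi i j y -> V y -> family_rep Phi i j y 0 l = g y) ->
  u \in `[0, 1] -> chart_dom (A i) p -> chart_dom (A j) (Phi u p) ->
  V (pt u (chart_map (A i) p)) ->
  X u j (Phi u p) 0 l = partial (lshift m 0) g (pt u (chart_map (A i) p)).
Proof.
move=> sP gX oV sg fg u01 ip jp Vu; set x := chart_map (A i) p.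
have PF := within_itv_proper u01.
have nV : \forall s \near u, V (pt s x).
  have cpt : {for u, continuous (fun s : R => pt s x)}.
    by apply: for_continuous_pt; [exact: cvg_id|exact: cst_continuous].
  by apply: cpt; exact: open_nbhs_nbhs.
have nj := curve_near sP u01 jp.
have E s : s \in `[0, 1] -> V (pt s x) -> chart_dom (A j) (Phi s p) ->
    chart_map (A j) (Phi s p) 0 l = g (pt s x).
  move=> s01 Vs js; rewrite -fg//; last first.
    split; rewrite ?pt_time ?pt_space//; first exact: chart_img_map.
    by rewrite /family_at pt_time pt_space chart_mapK.
  by rewrite /family_rep pt_time pt_space chart_mapK.
have nE : \forall s \near within `[0, 1] u^',
    chart_map (A j) (Phi s p) 0 l = g (pt s x).
  apply: near_within_itv; near=> s => s01; apply: E => //; first by near: s.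
  by move: s01; near: s.
have Eu : chart_map (A j) (Phi u p) 0 l = g (pt u x) by apply: E => //; exact: nbhs_singleton.
have L1 : (s - u)^-1 * (g (pt s x) - g (pt u x)) @[s --> within `[0, 1] u^']
    --> X u j (Phi u p) 0 l.
  have /cvgrPdist_le Hl := gX u j p u01 jp.
  apply/cvgrPdist_le => e e0; have He := Hl e e0; near=> s.
  have <- : chart_map (A j) (Phi s p) 0 l = g (pt s x) by near: s.
  rewrite -Eu.
  have : `|X u j (Phi u p) - (s - u)^-1 *: (chart_map (A j) (Phi s p) - chart_map (A j) (Phi u p))| <= e.
    by near: s.
  by apply: le_trans; apply: le_trans (coord_le_norm _ l); rewrite !mxE.
have L2 : (s - u)^-1 * (g (pt s x) - g (pt u x)) @[s --> within `[0, 1] u^']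
    --> partial (lshift m 0) g (pt u x).
  have dg : differentiable g (pt u x).
    by apply: smooth_at_diff; exact: (Cinfty_on_smooth_at oV sg).
  have /cvgrPdist_le Hl : (fun h => h^-1 *: (g (h *: delta_mx 0 (lshift m 0) + pt u x) - g (pt u x)))
      @ 0^' --> partial (lshift m 0) g (pt u x).
    by have := @diff_derivable _ _ _ g _ (delta_mx 0 (lshift m 0)) dg.
  apply/cvgrPdist_le => e e0; have /nbhs_normP[d/= d0 dH] := Hl e e0.
  have : \forall s \near u, s != u -> s \in `[0, 1] ->
    `|partial (lshift m 0) g (pt u x) - (s - u)^-1 * (g (pt s x) - g (pt u x))| <= e.
    apply/nbhs_normP; exists d => //= s; rewrite /ball_/= distrC => sd su _.
    have := dH (s - u); rewrite /ball_/= sub0r normrN => /(_ sd).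
    rewrite subr_eq0 => /(_ su); rewrite -pt10.
    have -> : (s - u) *: pt 1 0 + pt u x = pt s x.
      apply/rowP => a; rewrite [LHS]mxE [X in X + _]mxE; case: (split_ordP a) => b ->.
        by rewrite !pt_lshift mulr1 subrK.
      by rewrite !pt_rshift mxE mulr0 add0r.
    exact.
  exact.
exact: (cvg_unique _ L1 L2).
Unshelve. all: by end_near. Qed.

(** Because [tau] has values in [0,1], the representation of [Phi] agrees with its local smooth
    extension [g] along (t, x) -> (tau t, x), even where [tau t] is 0 or 1. Hence the composite is
    smooth for all real times. *)
Lemma reparam_smooth_family Phi H (tau : R -> R) : smooth_system alpha Phi H -> smooth1 tau ->
  (forall t, tau t \in `[0, 1]) -> smooth_family A (fun t => Phi (tau t)).
Proof.
move=> [[sP pP] hP] stau tau01.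
have cF := isotopy_joint sP (smooth1_continuous stau) tau01.
split=> // t p i j ip jp l; have [_ sPhi _ _] := sP.
set z0 := pt t _.
have Dz0 : time_dom Phi i j (pt (tau t) (chart_map (A i) p)).
  split; rewrite ?pt_time ?pt_space//; first exact: chart_img_map.
  by rewrite /family_at pt_time pt_space chart_mapK.
have [V [g [oV Vz sg fg]]] := sPhi i j l _ Dz0.
pose T (z : 'rV[R]_(1 + m)) := pt (tau (lsubmx z 0 0)) (rsubmx z) : 'rV[R]_(1 + m).
have sT : forall l', smooth_at (fun z => T z 0 l') z0.
  apply: smooth_at_pt; last by move=> l'; exact: smooth_at_space.
  by apply: smooth_at_smooth1 => //; exact: smooth_at_time.
have Tz0 : T z0 = pt (tau t) (chart_map (A i) p) by rewrite /T pt_time pt_space.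
apply: (@smooth_at_ext _ _ (g \o T)); last first.
  by apply: smooth_at_comp => //; rewrite Tz0; exact: (Cinfty_on_smooth_at oV sg).
have cT : {for z0, continuous T}.
  by apply: for_continuous_rV => l'; exact: smooth_at_continuous.
have nV : \forall z \near z0, V (T z).
  by apply: cT; rewrite Tz0; exact: open_nbhs_nbhs.
have nr : \forall z \near z0, chart_img (A i) (rsubmx z) /\
    chart_dom (A j) (family_at (fun t => Phi (tau t)) i z).
  apply: near_family_rep => //; first by rewrite pt_space; exact: chart_img_map.
  by rewrite /family_at pt_time pt_space chart_mapK.
near=> z.
have [iz jz] : chart_img (A i) (rsubmx z) /\
    chart_dom (A j) (family_at (fun t => Phi (tau t)) i z) by near: z.
have Vz' : V (T z) by near: z.
have Dz : time_dom Phi i j (T z).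
  split; rewrite /T ?pt_time ?pt_space//.
  by rewrite /family_at pt_time pt_space.
by rewrite /= -(fg _ Dz Vz') /family_rep /T pt_time pt_space.
Unshelve. all: by end_near. Qed.

(** The chain rule in time, carried out on the local extension [g] because [Phi] may have only
    one-sided derivatives at times 0 and 1. *)
Lemma reparam_generates Phi H (tau : R -> R) : smooth_system alpha Phi H -> smooth1 tau ->
  (forall t, tau t \in `[0, 1]) ->
  generates alpha (fun t => Phi (tau t)) (fun t q => (tau^`())%classic t * H (tau t) q).
Proof.
move=> sys stau tau01 t p j jp; have sF := reparam_smooth_family sys stau tau01.
move: sys => [[sP pP] [X gX HX]].
rewrite (HX _ j)// /pairing.
suff -> : velocity (fun t => Phi (tau t)) p j t =
  (tau^`())%classic t *: X (tau t) j (Phi (tau t) p) by rewrite -scalemxAl [RHS]mxE.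
apply/esym/rowP => l.
have [i ip] := atlas_cover A p.
have [_ sPhi _ _] := sP.
have Dz0 : time_dom Phi i j (pt (tau t) (chart_map (A i) p)).
  split; rewrite ?pt_time ?pt_space//; first exact: chart_img_map.
  by rewrite /family_at pt_time pt_space chart_mapK.
have [V [g [oV Vz sg fg]]] := sPhi i j l _ Dz0.
have dc : differentiable (fun s => chart_map (A j) (Phi (tau s) p)) t.
  exact: (curve_diff sF).
rewrite mxE (velocity_extension sP gX oV sg fg (tau01 t) ip jp Vz).
rewrite /velocity -(@derive_coord R R m _ t 1 l dc).
have dtau : differentiable tau t by apply/derivable1_diffP; exact: smooth1_derivable.
have dx : differentiable (fun _ : R => chart_map (A i) p) t by [].
have [dpt Dpt] := @derive_pt R m R _ _ t 1 dtau dx.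
have dg : differentiable g (pt (tau t) (chart_map (A i) p)).
  by apply: smooth_at_diff; exact: (Cinfty_on_smooth_at oV sg).
have E : \forall s \near t, (g \o (fun s => pt (tau s) (chart_map (A i) p))) s =
    chart_map (A j) (Phi (tau s) p) 0 l.
  have nV : \forall s \near t, V (pt (tau s) (chart_map (A i) p)).
    have cpt : {for t, continuous (fun s : R => pt (tau s) (chart_map (A i) p))}.
      by apply: for_continuous_pt; [exact: smooth1_continuous|exact: cst_continuous].
    by apply: cpt; exact: open_nbhs_nbhs.
  have nj : \forall s \near t, chart_dom (A j) (Phi (tau s) p).
    have cF : continuous (joint (fun t => Phi (tau t))) by case: sF.
    have csupp : {for t, continuous (fun s => Phi (tau s) p)}.
      apply: (@continuous_comp _ _ _ (fun s : R => (s, p)) (joint (fun t => Phi (tau t)))).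
        by apply: for_continuous_pair; [exact: cvg_id|exact: cst_continuous].
      exact: cF.
    by apply: csupp; exact: near_dom.
  near=> s; have Vs : V (pt (tau s) (chart_map (A i) p)) by near: s.
  have js : chart_dom (A j) (Phi (tau s) p) by near: s.
  have Ds : time_dom Phi i j (pt (tau s) (chart_map (A i) p)).
    split; rewrite ?pt_time ?pt_space//; first exact: chart_img_map.
    by rewrite /family_at pt_time pt_space chart_mapK.
  by have := fg _ Ds Vs; rewrite pt_time pt_space chart_mapK.
rewrite -(near_eq_derive _ E) derive_comp// Dpt derive_cst.
have -> : pt ('D_1 tau t) 0 = 'D_1 tau t *: delta_mx 0 (lshift m 0) :> 'rV[R]_(1 + m).
  rewrite -pt10; apply/rowP => a; rewrite [RHS]mxE; case: (split_ordP a) => b ->.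
    by rewrite !pt_lshift mulr1.
  by rewrite !pt_rshift mxE mulr0.
by rewrite (deriveE _ dg) linearZ -(deriveE _ dg) -derive1E.
Unshelve. all: by end_near. Qed.

Lemma flow_reparam Phi H (tau : R -> R) : smooth_system alpha Phi H -> smooth1 tau ->
  (forall t, tau t \in `[0, 1]) ->
  exists G, flow alpha (fun t => Phi (tau t)) G (fun t q => (tau^`())%classic t * H (tau t) q).
Proof.
move=> sys stau tau01; have sF := reparam_smooth_family sys stau tau01.
have gF := reparam_generates sys stau tau01.
move: sys => [[sP pP] hP]; have [Psi HPsi] := isotopy_inverse sP.
have FK t : cancel (Phi (tau t)) (Psi (tau t)) by have [] := HPsi (tau t) (tau01 t).
have GK t : cancel (Psi (tau t)) (Phi (tau t)) by have [] := HPsi (tau t) (tau01 t).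
exists (fun t => Psi (tau t)); split=> //; last by move=> t; exact: pP.
apply: (smooth_family_inverse sF) => //.
  have cF := isotopy_joint sP (smooth1_continuous stau) tau01.
  exact: (@continuous_inverse_family R M M_compact M_hausdorff _ _ cF FK GK).
by move=> t; have [] := HPsi (tau t) (tau01 t).
Qed.

(** As in [flow_continuous], but with the time derivatives taken of local smooth extensions past
    [0,1], one for each coordinate; this gives continuity up to the end times. *)
Lemma system_hamiltonian_continuous Phi H : smooth_system alpha Phi H ->
  continuous (fun z : R * M => H (clamp z.1) z.2).
Proof.
move=> [[sP pP] [X gX HX]] [t0 q0].
have [Psi HPsi] := isotopy_inverse sP.
pose F t := Phi (clamp t); pose G t := Psi (clamp t).
have FK t : cancel (F t) (G t) by have [] := HPsi (clamp t) (clamp_itv t).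
have GK t : cancel (G t) (F t) by have [] := HPsi (clamp t) (clamp_itv t).
have cF : continuous (joint F) := isotopy_joint sP (@clamp_continuous R) (@clamp_itv R).
have cG : continuous (joint G).
  exact: (@continuous_inverse_family R M M_compact M_hausdorff _ _ cF FK GK).
have [j jq0] := atlas_cover A q0; have [i ip0] := atlas_cover A (G t0 q0).
have [_ sPhi _ _] := sP.
pose x (z : R * M) := pt (clamp z.1) (chart_map (A i) (joint G z)).
have cx : {for (t0, q0), continuous x}.
  apply: for_continuous_pt.
    apply: (@continuous_comp _ _ _ (fun z : R * M => z.1) clamp); first exact: cvg_fst.
    exact: clamp_continuous.
  apply: (@continuous_comp _ _ _ (joint G) (chart_map (A i))); first exact: cG.
  exact: chart_map_continuous.
have Dx : time_dom Phi i j (x (t0, q0)).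
  split; rewrite ?pt_time ?pt_space//; [exact: clamp_itv|exact: chart_img_map|].
  by rewrite /family_at pt_time pt_space chart_mapK// -/(F t0) GK.
have Vg l : exists Vg : set 'rV[R]_(1 + m) * ('rV[R]_(1 + m) -> R),
    [/\ open Vg.1, Vg.1 (x (t0, q0)), Cinfty_on Vg.1 Vg.2 &
     forall y, time_dom Phi i j y -> Vg.1 y -> family_rep Phi i j y 0 l = Vg.2 y].
  by have [V [g HVg]] := sPhi i j l _ Dx; exists (V, g).
have {Vg}[W HW] := choice Vg.
pose K (z : R * M) := \sum_l partial (lshift m 0) (W l).2 (x z) *
  form_coef alpha j (chart_map (A j) z.2) l 0.
have nj : \forall z \near (t0, q0), chart_dom (A j) z.2.
  exact: (@cvg_snd R M (nbhs t0) (nbhs q0) _ _ (near_dom jq0)).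
have ni : \forall z \near (t0, q0), chart_dom (A i) (joint G z).
  exact: (cG (t0, q0) _ (near_dom ip0)).
have nW : \forall z \near (t0, q0), forall l, (W l).1 (x z).
  apply: near_forall => l; have [oV Vx _ _] := HW l.
  by apply: cx; exact: open_nbhs_nbhs.
apply: (@near_eq_continuous _ _ K).
  near=> z; have jz : chart_dom (A j) z.2 by near: z.
  have iz : chart_dom (A i) (joint G z) by near: z.
  have Wz l : (W l).1 (x z) by move: (l); near: z.
  have jz' : chart_dom (A j) (Phi (clamp z.1) (joint G z)).
    by rewrite -/(F z.1) /joint GK.
  rewrite (HX _ j) ?clamp_itv// mxE /K; apply: eq_bigr => l _; congr (_ * _).
  have [oV _ sg fg] := HW l.
  rewrite -(velocity_extension sP gX oV sg fg (clamp_itv z.1) iz jz' (Wz l)).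
  by rewrite -/(F z.1) /joint GK.
apply: for_continuous_sum => l; apply: for_continuousM; last first.
  apply: (@continuous_comp _ _ _ (fun z : R * M => z.2)
    (fun q => form_coef alpha j (chart_map (A j) q) l 0)); first exact: cvg_snd.
  exact: coef_continuous.
apply: (@continuous_comp _ _ _ x (partial (lshift m 0) (W l).2)) => //.
have [oV Vx sg _] := HW l.
by apply/smooth_at_continuous/smooth_at_partial; exact: (Cinfty_on_smooth_at oV sg).
Unshelve. all: by end_near. Qed.

End Systems.

(** * Iterated integrals of compactly supported functions *)

Section CompactSupport1.
Context {R : realType}.
Local Notation mu := (@lebesgue_measure R).
Implicit Types g : R -> R.

Definition csupp1 (B : R) g := continuous g /\ forall t, g t != 0 -> `|t| <= B.

Lemma csupp1_restrict B g : csupp1 B g -> g \_ `[- B, B] = g.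
Proof.
move=> [_ gB]; apply/funext => t; rewrite patchE; case: ifPn => // /negP nt.
apply/esym/eqP; apply: contrapT => /negP /gB; rewrite ler_norml => h; apply: nt.
by rewrite inE/= in_itv.
Qed.

Lemma csupp1_integrable_itv B g : csupp1 B g -> mu.-integrable `[- B, B] (EFin \o g).
Proof.
move=> [cg _]; apply: continuous_compact_integrable; first exact: segment_compact.
exact: continuous_subspaceT.
Qed.

Lemma csupp1_integrable B g : csupp1 B g -> mu.-integrable setT (EFin \o g).
Proof.
move=> cg; have := csupp1_integrable_itv cg.
have mI : measurable (`[- B, B] : set (measurableTypeR R)) by exact: measurable_itv.
move=> /(integrable_mkcond _ mI).
by rewrite restrict_EFin (csupp1_restrict cg).
Qed.

Lemma measure_itv_cc (a b : R) : a <= b -> fine (mu `[a, b]) = b - a.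
Proof.
move=> ab; transitivity (fine (if (a%:E < b%:E)%E then b%:E - a%:E else 0)%E).
  by congr fine; exact: lebesgue_measure_itv.
rewrite lte_fin; case: ltP => [|ba] //=.
by rewrite (le_anti (introT andP (conj ab ba))) subrr.
Qed.

Lemma csupp1_le_bound B g e : 0 <= B -> csupp1 B g -> (forall t, `|g t| <= e) ->
  `|\int[mu]_t g t| <= (B + B) * e.
Proof.
move=> B0 cg ge; have ci := csupp1_integrable_itv cg.
have mI : measurable (`[- B, B] : set (measurableTypeR R)) by exact: measurable_itv.
rewrite -[in X in `|X|](csupp1_restrict cg) -Rintegral_mkcond.
apply: le_trans (le_normr_Rintegral mI ci) _.
apply: (@le_trans _ _ (\int[mu]_(t in `[- B, B]) e)).
  apply: le_Rintegral => //.
    by apply: integrable_norm.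
  apply: continuous_compact_integrable; first exact: segment_compact.
  by apply: continuous_subspaceT => t; exact: cst_continuous.
rewrite Rintegral_cst// mulrC.
have BB : - B <= B by lra.
have -> : fine (mu `[- B, B]) = B + B by rewrite measure_itv_cc ?opprK.
by [].
Qed.

Lemma csupp1_gt0 B g t0 : csupp1 B g -> (forall t, 0 <= g t) -> 0 < g t0 -> 0 < \int[mu]_t g t.
Proof.
move=> cg g0 gt0; have ci := csupp1_integrable cg; have [cont _] := cg.
have h0 : 0 < g t0 / 2 by rewrite divr_gt0.
have /cvgrPdist_le/(_ _ h0)/nbhs_normP[d/= d0 dH] := cont t0.
pose I := `[t0 - d / 2, t0 + d / 2]%classic.
have mI : measurable (I : set (measurableTypeR R)) by exact: measurable_itv.
have IH t : I t -> g t0 / 2 <= g t.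
  rewrite /I/= in_itv/= => /andP[ta tb]; have := dH t.
  rewrite /ball_/= => H; have : `|t0 - t| < d by rewrite ltr_norml; apply/andP; split; lra.
  by move=> /H; rewrite ler_norml => /andP[]; lra.
apply: (@lt_le_trans _ _ (\int[mu]_(t in I) (g t0 / 2))).
  rewrite Rintegral_cst// mulr_gt0// /I measure_itv_cc; lra.
rewrite Rintegral_mkcond; apply: le_Rintegral => //.
  rewrite -restrict_EFin; apply/(integrable_mkcond _ mI).
  apply: continuous_compact_integrable; first exact: segment_compact.
  by apply: continuous_subspaceT => t; exact: cst_continuous.
move=> t _; rewrite patchE; case: ifPn => [|_]; last exact: g0.
by rewrite inE; exact: IH.
Qed.
End CompactSupport1.

Section CompactSupport.
Context {R : realType}.
Local Notation mu := (@lebesgue_measure R).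

Definition csupp m (B : R) (f : 'rV[R]_m -> R) :=
  continuous f /\ forall x, f x != 0 -> forall j, `|x 0 j| <= B.

Lemma csupp_slice m B (f : 'rV[R]_(1 + m) -> R) t : csupp B f -> csupp B (fun y : 'rV[R]_m => f (pt t y)).
Proof.
move=> [cf fB]; split=> [y|y /fB fy j].
  apply: (@continuous_comp _ _ _ (fun y : 'rV[R]_m => pt t y) f); last exact: cf.
  by apply: for_continuous_pt; [exact: cst_continuous|exact: cvg_id].
by have := fy (rshift 1 j); rewrite pt_rshift.
Qed.

Lemma csuppB m B (f g : 'rV[R]_m -> R) : csupp B f -> csupp B g -> csupp B (fun x => f x - g x).
Proof.
move=> [cf fB] [cg gB]; split=> [x|x fgx].
  by apply: (@for_continuousB _ _ f g); [exact: cf|exact: cg].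
have [fx|/fB//] := eqVneq (f x) 0; apply: gB.
by apply: contra_neq fgx => gx; rewrite fx gx subrr.
Qed.

Lemma box_compact m (B : R) : compact [set y : 'rV[R]_m | forall j, `|y 0 j| <= B].
Proof.
have : compact [set y : 'rV[R]_m | forall j, `[- B, B]%classic (y ord0 j)].
  by apply: (@rV_compact R m (fun=> `[- B, B]%classic)) => _; exact: segment_compact.
congr compact; apply/seteqP; split=> y /= H j; have := H j.
  by rewrite /= in_itv/= -ler_norml.
by rewrite /= in_itv/= -ler_norml.
Qed.

(** On the box the estimate is uniform by compactness; outside it both values are zero. *)
Lemma slice_uniform m B (f : 'rV[R]_(1 + m) -> R) s e : csupp B f -> 0 < e ->
  \forall t \near s, forall y, `|f (pt s y) - f (pt t y)| <= e.
Proof.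
move=> [cf fB] e0.
have : \forall t \near s, forall y, [set y : 'rV[R]_m | forall j, `|y 0 j| <= B] y ->
    `|f (pt s y) - f (pt t y)| <= e.
  apply: near_all_compact; first exact: box_compact.
  move=> y _.
  have cF : {for (y, s), continuous (fun z : 'rV[R]_m * R => f (pt s z.1) - f (pt z.2 z.1))}.
    apply: for_continuousB.
      apply: (@continuous_comp _ _ _ (fun z : 'rV[R]_m * R => pt s z.1) f); last exact: cf.
      by apply: for_continuous_pt; [exact: cst_continuous|exact: cvg_fst].
    apply: (@continuous_comp _ _ _ (fun z : 'rV[R]_m * R => pt z.2 z.1) f); last exact: cf.
    by apply: for_continuous_pt; [exact: cvg_snd|exact: cvg_fst].
  have /cvgrPdist_le/(_ _ e0) := cF.
  rewrite subrr; apply: filterS => z /=; by rewrite sub0r normrN.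
apply: filterS => t Ht y.
have [By|nBy] := pselect (forall j, `|y 0 j| <= B); first exact: Ht.
have z u : f (pt u y) = 0.
  apply/eqP; apply: contrapT => /negP /fB H; apply: nBy => j.
  by have := H (rshift 1 j); rewrite pt_rshift.
by rewrite !z subrr normr0 ltW.
Qed.

(** The properties are bundled because the induction on the dimension needs them jointly: continuity
    of the inner integral in the outer variable comes from the difference rule and the bound in one
    dimension less. In that bound [K] depends on the size of the support alone. *)
Definition integral_Rm_spec m := [/\
  forall B (f g : 'rV[R]_m -> R), csupp B f -> csupp B g ->
    integral_Rm (fun x => f x - g x) = integral_Rm f - integral_Rm g,
  forall B a (f : 'rV[R]_m -> R), csupp B f -> integral_Rm (fun x => a * f x) = a * integral_Rm f,
  forall B, 0 <= B -> exists2 K, 0 <= K & forall e (f : 'rV[R]_m -> R),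
    csupp B f -> (forall x, `|f x| <= e) -> `|integral_Rm f| <= K * e,
  forall B (f : 'rV[R]_m -> R), csupp B f -> (forall x, 0 <= f x) -> 0 <= integral_Rm f &
  forall B (f : 'rV[R]_m -> R) x, csupp B f -> (forall x, 0 <= f x) -> 0 < f x -> 0 < integral_Rm f].

Lemma integral_RmP m : integral_Rm_spec m.
Proof.
elim: m => [|m [IB IZ Ibd I0 Igt]].
  split=> [B f g _ _|B a f _|B B0|B f _ f0|B f x _ f0] //=.
  - by exists 1 => // e f _ fe; rewrite mul1r.
  - by rewrite [x]thinmx0.
have cslice B (f : 'rV[R]_(1 + m) -> R) : 0 <= B -> csupp B f ->
    csupp1 B (fun t => integral_Rm (fun y => f (pt t y))).
  move=> B0 cf; have [K K0 HK] := Ibd B B0; split=> [s|t].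
    apply/cvgrPdist_le => e e0.
    have e'0 : 0 < e / (K + 1) by rewrite divr_gt0// ltr_wpDl.
    have := slice_uniform s cf e'0; apply: filterS => t Ht.
    rewrite -(IB B) ?csupp_slice//; last first.
    + exact: csupp_slice.
    + exact: csupp_slice.
    apply: le_trans (HK (e / (K + 1)) _ _ _) _ => //.
    + by apply: csuppB; exact: csupp_slice.
    by rewrite mulrA ler_pdivrMr ?ltr_wpDl// mulrC ler_wpM2l ?lerDl// ltW.
  move=> It; rewrite leNgt; apply/negP => Bt; move/negP: It; apply; apply/eqP.
  have f0 y : f (pt t y) = 0.
    apply/eqP; apply: contrapT => /negP /(proj2 cf)/(_ (lshift m 0)).
    by rewrite pt_lshift leNgt Bt.
  have := HK 0 _ (csupp_slice t cf); rewrite mulr0 => H; apply/eqP.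
  by rewrite -normr_le0; apply: H => y; rewrite f0 normr0.
(* The linearity and positivity clauses allow a negative [B], for which the function is zero,
   whereas the estimates on [-B, B] want B >= 0. *)
have csuppN B f : csupp (m := m.+1) B f -> csupp (m := m.+1) (Num.max 0 B) f.
  by move=> [cf fB]; split=> // x /fB H j; rewrite le_max H orbT.
have Bge0 (B : R) : 0 <= Num.max 0 B by rewrite le_max lexx.
split.
- move=> B f g /csuppN cf /csuppN cg; rewrite /= -RintegralB//.
  + congr fine; apply: eq_integral => t _; congr EFin.
    by apply: (IB _ _ _ (csupp_slice t cf) (csupp_slice t cg)).
  + exact: csupp1_integrable (cslice _ _ (Bge0 B) cf).
  + exact: csupp1_integrable (cslice _ _ (Bge0 B) cg).
- move=> B a f /csuppN cf; rewrite /= -RintegralZl//.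
  + congr fine; apply: eq_integral => t _; congr EFin.
    exact: (IZ _ _ _ (csupp_slice t cf)).
  + exact: csupp1_integrable (cslice _ _ (Bge0 B) cf).
- move=> B B0; have [K K0 HK] := Ibd B B0; exists ((B + B) * K).
    by rewrite mulr_ge0// addr_ge0.
  move=> e f cf fe; rewrite -mulrA.
  apply: (csupp1_le_bound B0 (cslice _ _ B0 cf)) => t.
  by apply: HK; [exact: csupp_slice|move=> y; exact: fe].
- move=> B f cf f0; apply: Rintegral_ge0 => t _.
  by apply: (I0 B _ (csupp_slice t cf)) => y; exact: f0.
- move=> B f x /csuppN cf f0 fx; apply: (csupp1_gt0 (t0 := lsubmx (x : 'rV_(1 + m)) 0 0) (cslice _ _ (Bge0 B) cf)).
    by move=> t; apply: (I0 _ _ (csupp_slice t cf)) => y; exact: f0.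
  apply: (Igt _ _ (rsubmx (x : 'rV_(1 + m))) (csupp_slice _ cf)) => [y|]; first exact: f0.
  by rewrite ptK.
Qed.

End CompactSupport.

(** * Positivity of the integral and the norm *)

Section FormIntegral.
Context {R : realType} {M : topologicalType} {n : nat} {A : smooth_atlas R M n.*2.+1}.
Hypothesis M_compact : compact [set: M].
Variable alpha : one_form A.
Hypothesis alpha_contact : contact_form alpha.

Lemma vol_coef_continuous i x : chart_img (A i) x -> {for x, continuous (vol_coef alpha i)}.
Proof.
move=> ix; have oi : open (chart_img (A i)) by exact: chart_img_open.
have sc l : smooth_at (fun y => form_coef alpha i y l 0) x.
  exact: (smooth_on_smooth_at oi (@form_smooth _ _ _ _ alpha i l) ix).
have sd k l : smooth_at (fun y => d_form alpha i y k l) x.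
  move=> a; apply: (@Ck_at_ext _ _ _ (fun y => partial k (fun y => form_coef alpha i y l 0) y
     + - partial l (fun y => form_coef alpha i y k 0) y)).
    by apply: near_all => y; rewrite mxE.
  by apply: Ck_at_add; [|apply: Ck_at_opp]; exact: smooth_at_partial.
have : Ck_at 0 (vol_coef alpha i) x.
  apply: Ck_at_scale; apply: Ck_at_sum => s; apply: Ck_at_mul.
    by apply: Ck_at_scale; exact: sc.
  by apply: Ck_at_prod => k; exact: sd.
exact: nbhs_singleton.
Qed.

Section Partition.
Context {N : nat} {ix : 'I_N -> atlas_index A} {rho : 'I_N -> M -> R}.
Hypothesis Prho : partition_of_unity ix rho.

Definition local_density (f : M -> R) (k : 'I_N) : 'rV[R]_n.*2.+1 -> R :=
  (fun x => let p := chart_inv (A (ix k)) x in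
     rho k p * f p * `|vol_coef alpha (ix k) x|) \_ (chart_img (A (ix k))).

(** The closed support of [rho k] is compact and lies in the chart domain, so its image under the
    chart is compact. The density is continuous on the chart image and zero on the open complement
    of that compact set, and the two regions cover everything. The bound does not depend on [f]. *)
Lemma local_density_csupp (k : 'I_N) : exists B, forall f, continuous f ->
  csupp B (local_density f k).
Proof.
have [crho rho0 rho1 srho] := Prho.
set i := ix k; pose S := closure [set p | rho k p != 0].
have Sd : S `<=` chart_dom (A i) := srho k.
have cS : compact S.
  by apply: subclosed_compact M_compact _ => //; exact: closed_closure.
pose S' := chart_map (A i) @` S.
have cS' : compact S'.
  apply: continuous_compact cS; apply: continuous_in_subspaceT => p /set_mem Sp.
  by apply: chart_map_continuous; exact: Sd.
have oS' : open (~` S').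
  apply: closed_openC; apply: compact_closed cS'; exact: norm_hausdorff.
have zS' f x : ~ S' x -> local_density f k x = 0.
  move=> nS'; rewrite /local_density patchE; case: ifPn => // /set_mem ix'.
  have -> : rho k (chart_inv (A i) x) = 0; last by rewrite !mul0r.
  apply/eqP; apply: contrapT => /negP r0; apply: nS'.
  exists (chart_inv (A i) x); last exact: chart_invK.
  exact: subset_closure.
have [B [_ BS]] := compact_bounded cS'.
(* [compact_bounded] guarantees only the bounds strictly above [B]. *)
exists (B + 1) => f cf; split=> x.
  have [ix'|nix] := pselect (chart_img (A i) x).
    pose F y := rho k (chart_inv (A i) y) * f (chart_inv (A i) y) * `|vol_coef alpha i y|.
    apply: (@near_eq_continuous _ _ F).
      have := near_img ix'; apply: filterS => y iy.
      by rewrite /local_density patchE ifT// inE.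
    apply: for_continuousM.
      apply: for_continuousM.
        apply: (@continuous_comp _ _ _ (chart_inv (A i)) (rho k)); last exact: crho.
        exact: chart_inv_continuous.
      apply: (@continuous_comp _ _ _ (chart_inv (A i)) f); last exact: cf.
      exact: chart_inv_continuous.
    apply: (@continuous_comp _ _ _ (vol_coef alpha i) (fun y : R => `|y|)).
      exact: vol_coef_continuous.
    exact: norm_continuous.
  have nS' : (~` S') x by move=> [p Sp px]; apply: nix; exists p => //; exact: Sd.
  apply: (@near_eq_continuous _ _ (fun=> 0)); last exact: cst_continuous.
  have : \forall y \near x, (~` S') y by exact: open_nbhs_nbhs.
  by apply: filterS => y nSy; rewrite zS'.
move=> fx j; have S'x : S' x.
  by apply: contrapT => /(zS' f) f0; move: fx; rewrite f0 eqxx.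
apply: le_trans (coord_le_norm x j) _; apply: (BS (B + 1)) => //.
by rewrite ltrDl.
Qed.

Lemma integral_withE f :
  integral_with alpha ix rho f = \sum_(k < N) integral_Rm (local_density f k).
Proof. by []. Qed.

Lemma integral_with_le f g : continuous f -> continuous g -> (forall p, f p <= g p) ->
  integral_with alpha ix rho f <= integral_with alpha ix rho g.
Proof.
move=> cf cg fg; rewrite !integral_withE; apply: ler_sum => k _.
have [B HB] := local_density_csupp k; have [IB _ _ I0 _] := @integral_RmP R n.*2.+1.
have [_ rho0 _ _] := Prho.
rewrite -subr_ge0 -(IB B) ?HB//; last first.
- exact: HB.
- exact: HB.
apply: (I0 B); first by apply: csuppB; exact: HB.
move=> x; rewrite subr_ge0 /local_density !patchE; case: ifP => // _.
by rewrite ler_wpM2r// ler_wpM2l.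
Qed.

Lemma integral_with_cst c :
  integral_with alpha ix rho (fun=> c) = c * integral_with alpha ix rho (fun=> 1).
Proof.
rewrite !integral_withE mulr_sumr; apply: eq_bigr => k _.
have [B HB] := local_density_csupp k; have [_ IZ _ _ _] := @integral_RmP R n.*2.+1.
rewrite -(IZ B); last by apply: HB => x; exact: cst_continuous.
congr integral_Rm; apply/funext => x; rewrite /local_density !patchE.
by case: ifP => _; [rewrite mulr1; ring|rewrite mulr0].
Qed.

(** The contact condition enters here: at a point where some [rho k] is positive, the volume
    coefficient is nonzero and the density is positive. *)
Lemma integral_with_gt0 : [set: M] !=set0 -> 0 < integral_with alpha ix rho (fun=> 1).
Proof.
move=> [p _]; have [_ rho0 rho1 srho] := Prho.
have [k rk] : exists k, 0 < rho k p.
  apply: contrapT => nk; have := rho1 p; rewrite big1 => [/esym/eqP|k _].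
    by rewrite oner_eq0.
  by apply/eqP; rewrite eq_le rho0 andbT leNgt; apply/negP => rk; apply: nk; exists k.
rewrite integral_withE (bigD1 k)//= ltr_pwDl//; last first.
  apply: sumr_ge0 => l _; have [B HB] := local_density_csupp l.
  have [_ _ _ I0 _] := @integral_RmP R n.*2.+1.
  apply: (I0 B) => [|x]; first by apply: HB => x; exact: cst_continuous.
  by rewrite /local_density patchE; case: ifP => // _; rewrite !mulr_ge0.
have [B HB] := local_density_csupp k; have [_ _ _ _ Igt] := @integral_RmP R n.*2.+1.
have kp : chart_dom (A (ix k)) p.
  by apply: (srho k); apply: subset_closure; rewrite /= gt_eqF.
apply: (Igt B _ (chart_map (A (ix k)) p)) => [|x|].
- by apply: HB => x; exact: cst_continuous.
- by rewrite /local_density patchE; case: ifP => // _; rewrite !mulr_ge0.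
- rewrite /local_density patchE ifT; last by rewrite inE; exact: chart_img_map.
  rewrite chart_mapK// mulr1 mulr_gt0// normr_gt0; apply: alpha_contact.
  exact: chart_img_map.
Qed.
End Partition.
End FormIntegral.

(** * Partitions of unity from distance functions *)

Section PartitionExists.
Context {R : realType} {M : metricType R} {m : nat} (A : smooth_atlas R M m).
Hypothesis M_compact : compact [set: M].

Lemma mdist_continuous (p : M) : continuous (fun q : M => mdist p q : R).
Proof.
move=> q; apply/cvgrPdist_le => e e0.
have : \forall r \near q, ball q e r by exact: nbhsx_ballx.
apply: filterS => r; rewrite ballEmdist/= => qr.
have h1 := metric_triangle p r q; have h2 := metric_triangle p q r.
by have := metric_sym q r => qrE; rewrite ler_norml; apply/andP; split; lra.
Qed.

(** Only continuity is demanded, so normalized tents max(0, r - dist) over a finite cover by balls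
    suffice. The radii are half of those for which the ball fits in a chart domain, so that the
    closures of the supports fit as well. *)
Lemma exists_partition_of_unity : [set: M] !=set0 ->
  exists (N : nat) (ix : 'I_N -> atlas_index A) (rho : 'I_N -> M -> R),
    partition_of_unity ix rho.
Proof.
move=> [p0 _].
have H p : exists ir : atlas_index A * R, 0 < ir.2 /\ ball p (2 * ir.2) `<=` chart_dom (A ir.1).
  have [i ip] := atlas_cover A p.
  have /nbhs_ballP[e /= e0 He] := near_dom ip.
  by exists (i, e / 2); split=> /=; [rewrite divr_gt0|rewrite mulrC divfK].
have [ir Hir] := choice H.
pose MP : ptopologicalType := HB.pack (M : Type) (Topological.on M) (isPointed.Build M p0).
have : @cover_compact MP [set: M] by rewrite -(compact_cover MP).
move=> /(_ M setT (fun p => (ball p (ir p).2)°)).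
case=> [p _|p _|D _ Dcov]; first exact: open_interior.
  by exists p => //; apply: nbhsx_ballx; have [] := Hir p.
pose s : seq M := finmap.enum_fset D; pose pk k := nth p0 s k.
pose b (k : 'I_(size s)) q : R := Num.max 0 ((ir (pk k)).2 - mdist (pk k) q).
have b0 k q : 0 <= b k q by rewrite /b le_max lexx.
have cb k : continuous (b k).
  move=> q; apply: (@continuous_max R M (fun=> 0) (fun q => (ir (pk k)).2 - mdist (pk k) q) q); first exact: cst_continuous.
  by apply: (@for_continuousB _ _ (fun=> _) (fun q => mdist (pk k) q));
    [exact: cst_continuous|exact: mdist_continuous].
have bgt q : 0 < \sum_k b k q.
  have [p /= Dp pq] := Dcov q I.
  have ks : (index p s < size s)%N by rewrite index_mem.
  have bq : 0 < b (Ordinal ks) q.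
    rewrite /b /pk /= nth_index// lt_max; apply/orP; right.
    by have := interior_subset pq; rewrite ballEmdist/= subr_gt0.
  by rewrite (bigD1 (Ordinal ks))//= ltr_pwDl// sumr_ge0.
exists (size s), (fun k => (ir (pk k)).1), (fun k q => b k q / \sum_k b k q); split.
- move=> k q; apply: (@for_continuousM _ _ (b k) (fun q => (\sum_k b k q)^-1)).
    exact: cb.
  apply: for_continuousV; first by rewrite gt_eqF.
  by apply: for_continuous_sum => l; exact: cb.
- by move=> k q; rewrite divr_ge0// ltW.
- by move=> q; rewrite -mulr_suml mulfV// gt_eqF.
- move=> k q; set r := (ir (pk k)).2; set p := pk k.
  have [r0 rb] := Hir p; move=> cq; apply: rb; rewrite ballEmdist/=.
  have /cq [q' [/= bq' qq']] : nbhs q (ball q r) by exact: nbhsx_ballx.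
  have : mdist p q' < r.
    rewrite ltNge; apply/negP => rq; move/negP: bq'; apply.
    by rewrite /b -/r -/p max_l ?mul0r// subr_le0.
  move: qq'; rewrite ballEmdist/= => qq'.
  have h1 := metric_triangle p q' q; have h2 := metric_sym q q' : mdist q q' = mdist q' q.
  rewrite -/r; lra.
Qed.
End PartitionExists.

(** * Comparison of the norm with the supremum norm *)

Section HamNorm.
Context {R : realType} {M : metricType R} {n : nat} {A : smooth_atlas R M n.*2.+1}.
Hypotheses (M_nonempty : [set: M] !=set0) (M_compact : compact [set: M]).
Variable alpha : one_form A.
Hypothesis alpha_contact : contact_form alpha.
Implicit Types f : M -> R.

(** Since a partition of unity exists, [xget] returns the functional of an actual one, and the
    estimates above hold for every partition. *)
Let form_integralP : exists (N : nat) (ix : 'I_N -> atlas_index A) (rho : 'I_N -> M -> R),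
  partition_of_unity ix rho /\ form_integral alpha = integral_with alpha ix rho.
Proof.
rewrite /form_integral.
have [N [ix [rho P]]] := exists_partition_of_unity A M_compact M_nonempty.
set S := (X in xget _ X).
have : exists I, S I by exists (integral_with alpha ix rho), N, ix, rho.
by move=> /(xgetPex (fun=> 0)).
Qed.

Definition mean (f : M -> R) := (form_integral alpha (fun=> 1))^-1 * form_integral alpha f.

Lemma mean_le f c : continuous f -> (forall p, f p <= c) -> mean f <= c.
Proof.
move=> cf fc; rewrite /mean; have [N [ix [rho [P ->]]]] := form_integralP.
have I1 := integral_with_gt0 M_compact alpha_contact P M_nonempty.
rewrite mulrC ler_pdivrMr// -(integral_with_cst M_compact alpha P).
apply: (integral_with_le M_compact alpha P) => // p; exact: cst_continuous.
Qed.

Lemma mean_ge f c : continuous f -> (forall p, c <= f p) -> c <= mean f.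
Proof.
move=> cf fc; rewrite /mean; have [N [ix [rho [P ->]]]] := form_integralP.
have I1 := integral_with_gt0 M_compact alpha_contact P M_nonempty.
rewrite mulrC ler_pdivlMr// -(integral_with_cst M_compact alpha P).
apply: (integral_with_le M_compact alpha P) => // p; exact: cst_continuous.
Qed.

Lemma range_ubound f : continuous f -> has_sup (range f).
Proof.
move=> cf; have cf' := continuous_subspaceT (A:=setT) cf.
split; first by have [p _] := M_nonempty; exists (f p), p.
have [c _ Hc] := compact_EVT_max M_nonempty M_compact cf'.
by exists (f c) => _ [p _ <-]; apply: Hc; rewrite inE.
Qed.

Lemma range_lbound f : continuous f -> has_inf (range f).
Proof.
move=> cf; have cf' := continuous_subspaceT (A:=setT) cf.
split; first by have [p _] := M_nonempty; exists (f p), p.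
have [c _ Hc] := compact_EVT_min M_nonempty M_compact cf'.
by exists (f c) => _ [p _ <-]; apply: Hc; rewrite inE.
Qed.

(** The mean lies between the infimum and the supremum, so each value of [f] differs from it by at
    most the oscillation. *)
Lemma le_ham_norm f p : continuous f -> `|f p| <= ham_norm alpha f.
Proof.
move=> cf; rewrite /ham_norm -/(mean f).
have su q : f q <= sup (range f) by apply: sup_ubound; [have [] := range_ubound cf|exists q].
have iu q : inf (range f) <= f q by apply: inf_lbound; [have [] := range_lbound cf|exists q].
have m1 := mean_le cf su; have m2 := mean_ge cf iu.
have a1 := ler_norm (mean f); have a2 := ler_norm (- mean f); rewrite normrN in a2.
by have p1 := su p; have p2 := iu p; rewrite ler_norml; apply/andP; split; lra.
Qed.

(** The oscillation contributes at most 2c and the mean at most c. *)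
Lemma ham_norm_le f c : continuous f -> (forall p, `|f p| <= c) -> ham_norm alpha f <= 3 * c.
Proof.
move=> cf fc; rewrite /ham_norm -/(mean f).
have ubf p : f p <= c by have := fc p; rewrite ler_norml => /andP[].
have lbf p : - c <= f p by have := fc p; rewrite ler_norml => /andP[].
have s1 : sup (range f) <= c.
  by apply: ge_sup; [have [] := range_ubound cf|move=> _ [p _ <-]].
have s2 : - c <= inf (range f).
  by apply: lb_le_inf; [have [] := range_lbound cf|move=> _ [p _ <-]].
have : `|mean f| <= c by rewrite ler_norml mean_le// mean_ge.
lra.
Qed.

Lemma ham_norm_ge0 f : continuous f -> 0 <= ham_norm alpha f.
Proof.
move=> cf; have [p _] := M_nonempty; exact: le_trans (le_ham_norm p cf).
Qed.
End HamNorm.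

(** * Uniform convergence and Riemann sums *)

Section UniformConvergence.
Context {R : realType}.

Lemma uniform_cvgP (T : choiceType) (V : pseudoMetricType R) (B : set T)
    (F_ : nat -> T -> V) (f : T -> V) :
  {uniform B, F_ @ \oo --> f} <->
  forall e : R, 0 < e -> exists N, forall n, (N <= n)%N -> forall y, B y -> ball (f y) e (F_ n y).
Proof.
split=> [Ff e e0|H P /uniform_nbhs[E [entE EP]]].
  have : nbhs (f : {uniform` B -> V}) [set h | forall y, B y -> ball (f y) e (h y)].
    apply/uniform_nbhs; exists [set xy | ball xy.1 e xy.2]; split=> //.
    by apply: entourage_ball (PosNum e0).
  by move=> /Ff [N _ HN]; exists N => n Nn; exact: HN.
move: entE; rewrite -entourage_ballE => -[e /= e0 eE].
have [N HN] := H e e0; exists N => // n /= Nn.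
by apply: EP => y By; apply: eE => /=; exact: HN.
Qed.

End UniformConvergence.

Section CompactFunctions.
Context {R : realType} {M : topologicalType}.
Hypotheses (M_nonempty : [set: M] !=set0) (M_compact : compact [set: M]).
Implicit Types f : M -> R.

Definition supn f : R := sup (range (fun p => `|f p|)).

Lemma supn_ub f p : continuous f -> `|f p| <= supn f.
Proof.
move=> cf.
have cf' : {within [set: M], continuous (fun p => `|f p|)}.
  apply: continuous_subspaceT => q.
  by apply: (@continuous_comp _ _ _ f (fun x : R => `|x|)); [exact: cf|exact: norm_continuous].
apply: sup_ubound; last by exists p.
have [c _ Hc] := compact_EVT_max M_nonempty M_compact cf'.
by exists `|f c| => _ [q _ <-]; apply: Hc; rewrite inE.
Qed.

Lemma supn_le f c : (forall p, `|f p| <= c) -> supn f <= c.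
Proof.
move=> fc; apply: ge_sup; last by move=> _ [p _ <-].
by have [p _] := M_nonempty; exists `|f p|, p.
Qed.

Lemma supn_ge0 f : continuous f -> 0 <= supn f.
Proof. by move=> cf; have [p _] := M_nonempty; exact: le_trans (supn_ub p cf). Qed.

Lemma joint_section (D : R -> M -> R) t : continuous (joint D) -> continuous (D t).
Proof.
move=> cD p; apply: (@continuous_comp _ _ _ (fun p : M => (t, p)) (joint D)); last exact: cD.
by apply: for_continuous_pair; [exact: cst_continuous|exact: cvg_id].
Qed.

Lemma joint_uniform (D : R -> M -> R) s e : continuous (joint D) -> 0 < e ->
  \forall t \near s, forall p, `|D s p - D t p| <= e.
Proof.
move=> cD e0.
have : \forall t \near s, forall p, [set: M] p -> `|D s p - D t p| <= e.
  apply: near_all_compact => // p _.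
  have cF : {for (p, s), continuous (fun z : M * R => D s z.1 - D z.2 z.1)}.
    apply: for_continuousB.
      apply: (@continuous_comp _ _ _ (fun z : M * R => z.1) (D s)); first exact: cvg_fst.
      exact: joint_section.
    apply: (@continuous_comp _ _ _ (fun z : M * R => (z.2, z.1)) (joint D)); last exact: cD.
    by apply: for_continuous_pair; [exact: cvg_snd|exact: cvg_fst].
  have /cvgrPdist_le/(_ _ e0) := cF.
  by rewrite subrr; apply: filterS => z /=; rewrite sub0r normrN.
by apply: filterS => t Ht p; exact: Ht.
Qed.

Lemma supn_continuous (D : R -> M -> R) : continuous (joint D) ->
  continuous (fun t => supn (D t)).
Proof.
move=> cD s; apply/cvgrPdist_le => e e0.
have := joint_uniform s cD e0; apply: filterS => t Ht.
have cs := joint_section (t:=s) cD; have ct := joint_section (t:=t) cD.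
have h1 : supn (D s) <= supn (D t) + e.
  apply: supn_le => p; have h := Ht p; have h' := supn_ub p ct.
  have := ler_normD (D s p - D t p) (D t p); rewrite subrK; lra.
have h2 : supn (D t) <= supn (D s) + e.
  apply: supn_le => p; have h := Ht p; have h' := supn_ub p cs.
  have := ler_normB (D s p) (D s p - D t p); rewrite subKr; lra.
by rewrite ler_norml; apply/andP; split; lra.
Qed.

End CompactFunctions.

Section Riemann.
Context {R : realType}.
Local Notation mu := (@lebesgue_measure R).

Lemma heine (h : R -> R) e : continuous h -> 0 < e -> exists2 d, 0 < d &
  forall x y, x \in `[0, 1] -> `|x - y| <= d -> `|h x - h y| <= e.
Proof.
move=> ch e0.
have : \forall d \near (0 : R), forall x, `[0, 1]%classic x -> forall y, `|x - y| <= d -> `|h x - h y| <= e.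
  apply: near_all_compact; first exact: segment_compact.
  move=> x _; have e2 : 0 < e / 2 by rewrite divr_gt0.
  have /cvgrPdist_le/(_ _ e2)/nbhs_normP[d/= d0 dH] := ch x.
  exists (ball_ (fun x : R => `|x|) x (d / 2), ball_ (fun x : R => `|x|) 0 (d / 2)) => /=.
    by split; apply/nbhs_normP; exists (d / 2) => //=; rewrite divr_gt0.
  move=> [x' d']; rewrite /ball_/= sub0r normrN => -[xx' dd'] y x'y.
  have yd : `|x - y| < d.
    apply: le_lt_trans (ler_distD x' _ _) _; have := ler_norm d'; lra.
  have h1 : `|h x - h x'| <= e / 2 by apply: dH; rewrite /ball_/=; lra.
  have h2 : `|h x - h y| <= e / 2 by apply: dH.
  apply: le_trans (ler_distD (h x) _ _) _; rewrite distrC in h1; lra.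
move=> /nbhs_normP[d/= d0 dH]; exists (d / 2); first by rewrite divr_gt0.
move=> x y x01 xy; apply: (dH (d / 2)) => //.
by rewrite /ball_/= sub0r normrN gtr0_norm; lra.
Qed.

(** This turns a bound on an integral into the data required by [time_change]: the values at the
    left nodes of a fine grid, slightly raised. *)
Lemma upper_riemann_sum (h : R -> R) eps : continuous h -> (forall x, 0 <= h x) ->
  \int[mu]_(x in `[0, 1]) h x < eps ->
  exists m (c : nat -> R), [/\ (0 < m)%N,
    forall k x, (k < m)%N -> k%:R / m%:R <= x <= k.+1%:R / m%:R -> 0 <= h x <= c k &
    (\sum_(k < m) c k) / m%:R < eps].
Proof.
move=> ch h0 Ie.
(* On each cell [h] is within [eta] of its node value, so the upper and lower sums differ by 2 eta.
   The lower sum is at most the integral, which is eps - 4 eta, hence the upper sum stays below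
   eps. *)
pose eta := (eps - \int[mu]_(x in `[0, 1]) h x) / 4.
have eta0 : 0 < eta by rewrite divr_gt0// subr_gt0.
have [d d0 Hd] := heine ch eta0.
have [m0 Hm0] : exists m0 : nat, d^-1 < m0%:R.
  by exists (Num.bound d^-1); apply: archi_boundP; rewrite invr_ge0 ltW.
pose m := m0.+1; have mR : 0 < m%:R :> R by rewrite ltr0n.
have md : m%:R^-1 <= d.
  rewrite invf_ple// ?posrE//; apply: le_trans (ltW Hm0) _; by rewrite ler_nat.
have near_node k x : (k < m)%N -> k%:R / m%:R <= x <= k.+1%:R / m%:R ->
    `|h (k%:R / m%:R) - h x| <= eta.
  move=> km /andP[x1 x2]; apply: Hd.
    rewrite in_itv/=; apply/andP; split; first by rewrite divr_ge0.
    by rewrite ler_pdivrMr// mul1r ler_nat ltnW.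
  move: x2; rewrite -natr1 mulrDl mul1r => x2.
  by rewrite ler_norml; apply/andP; split; lra.
exists m, (fun k => h (k%:R / m%:R) + eta); split=> //.
  move=> k x km kx; rewrite h0/=; have := near_node k x km kx.
  by rewrite ler_norml => /andP[]; lra.
have ih a b : mu.-integrable `[a, b] (EFin \o h).
  by apply: continuous_compact_integrable; [exact: segment_compact|exact: continuous_subspaceT].
pose F a := \int[mu]_(x in `[0, a]) h x.
have Fstep (k : nat) : (k < m)%N ->
    (h (k%:R / m%:R) - eta) / m%:R <= F (k.+1%:R / m%:R) - F (k%:R / m%:R).
  move=> km; set a := k%:R / m%:R; set b := k.+1%:R / m%:R.
  have a0 : 0 <= a by rewrite divr_ge0// ltW.
  have ab : b = a + m%:R^-1 by rewrite /b /a -natr1 mulrDl mul1r.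
  have mV : 0 < m%:R^-1 :> R by rewrite invr_gt0.
  have ab' : a <= b by rewrite ab lerDl ltW.
  rewrite /F Rintegral_itvB//; last first.
  rewrite (_ : _ / _ = \int[mu]_(x in `]a, b]) (h a - eta)).
    apply: le_Rintegral => //.
    - apply: (@integrableS _ _ _ mu `[a, b]) => //.
        by apply: subset_itvr; rewrite bnd_simp.
      apply: continuous_compact_integrable; first exact: segment_compact.
      by apply: continuous_subspaceT => t; exact: cst_continuous.
    - apply: (integrableS _ _ _ (ih a b)) => //.
      by apply: subset_itvr; rewrite bnd_simp.
    - move=> x; rewrite /= in_itv/= => /andP[ax xb].
      have := near_node k x km; rewrite -/a -/b => /(_ _).
      rewrite (ltW ax) xb => /(_ isT); rewrite ler_norml => /andP[]; lra.
  rewrite Rintegral_cst//; congr (_ * _).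
  transitivity (fine (if (a%:E < b%:E)%E then b%:E - a%:E else 0)%E).
    by rewrite lte_fin ifT; [rewrite /= ab addrAC subrr add0r|rewrite ab ltrDl].
  by congr fine; apply/esym; exact: lebesgue_measure_itv.
have F1 : \sum_(k < m) (h (k%:R / m%:R) - eta) / m%:R <= F 1.
  apply: (@le_trans _ _ (\sum_(k < m) (F (k.+1%:R / m%:R) - F (k%:R / m%:R)))).
    by apply: ler_sum => k _; exact: Fstep.
  rewrite -(big_mkord xpredT (fun k => F (k.+1%:R / m%:R) - F (k%:R / m%:R))).
  rewrite (telescope_sumr (fun k => F (k%:R / m%:R)))// mulfV ?gt_eqF// gerBl.
  by apply: Rintegral_ge0.
pose S := \sum_(k < m) h (k%:R / m%:R).
have E1 : \sum_(k < m) (h (k%:R / m%:R) + eta) = S + eta * m%:R.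
  by rewrite big_split/= sumr_const card_ord mulr_natr.
have E2 : \sum_(k < m) (h (k%:R / m%:R) - eta) / m%:R = (S - eta * m%:R) / m%:R.
  transitivity ((\sum_(k < m) (h (k%:R / m%:R) - eta)) / m%:R); first by rewrite mulr_suml.
  by rewrite big_split/= sumrN sumr_const card_ord mulr_natr.
have E3 : (S + eta * m%:R) / m%:R = (S - eta * m%:R) / m%:R + 2 * eta.
  by field; rewrite gt_eqF.
rewrite E1 E3; rewrite E2 in F1.
have : F 1 = eps - 4 * eta by rewrite /eta mulrC divfK// subKr.
lra.
Qed.

End Riemann.

(** * Cauchy estimate in L^1 *)

Section LowerIntegral.
Context {R : realType}.
Local Notation mu := (@lebesgue_measure R).
Implicit Types (f g : R -> \bar R) (D E N : set (measurableTypeR R)).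
Local Open Scope ereal_scope.

(* The integral of a nonnegative function is a supremum over simple functions,
   so it is monotone without any measurability assumption. *)
Lemma le_lower_integral f g : (forall x, 0 <= f x) -> (forall x, f x <= g x) ->
  \int[mu]_x f x <= \int[mu]_x g x.
Proof.
move=> f0 fg; have g0 x : 0 <= g x by exact: le_trans (f0 x) (fg x).
rewrite !ge0_integralTE//; apply: le_ereal_sup => _ [h /= hf <-]; exists h => //= x.
exact: le_trans (hf x) (fg x).
Qed.

(** Neither function is assumed to be measurable, so the comparison goes through
    [le_lower_integral]. Nothing is known of [g] on [N], and its negative part has to be shown to
    contribute zero. *)
Lemma le_integral_ae E N f g : measurable N -> mu N = 0 ->
  (forall x, (E `\` N) x -> 0 <= f x <= g x) ->
  \int[mu]_(x in E `\` N) f x <= \int[mu]_(x in E) g x.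
Proof.
move=> mN N0 fg; rewrite [leRHS]integralE.
(* Off [N] the negative part vanishes, and on [N] it is dominated by the constant +oo, whose
   integral over a null set is 0. *)
have -> : \int[mu]_(x in E) g^\- x = 0.
  apply/eqP; rewrite eq_le integral_ge0 ?andbT; last by move=> x _; exact: funeneg_ge0.
  have <- : \int[mu]_(x in N) (+oo : \bar R) = 0 by apply: null_set_integral => //; exact: measurable_cst.
  rewrite (integral_mkcond E) (integral_mkcond N); apply: le_lower_integral => x.
    by rewrite patchE; case: ifP => _ //; exact: funeneg_ge0.
  rewrite !patchE; case: ifPn => [/set_mem Ex|_]; last by case: ifP => _; rewrite ?leey.
  case: ifPn => [_|/negP nN]; first exact: leey.
  have /andP[f0 fgx] : 0 <= f x <= g x by apply: fg; split => //; apply: contra_not nN => /mem_set.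
  by rewrite funenegE ge_max lexx andbT leeNl oppe0 (le_trans f0).
rewrite sube0 (integral_mkcond (E `\` N)) (integral_mkcond E).
apply: le_lower_integral => x.
  by rewrite patchE; case: ifPn => [/set_mem/fg/andP[]|].
rewrite !patchE; case: ifPn => [/set_mem Dx|_]; last first.
  by case: ifP => _ //; exact: funepos_ge0.
have /andP[_ fgx] := fg x Dx; rewrite ifT; last by rewrite inE; case: Dx.
by apply: le_trans fgx _; rewrite funeposE le_max lexx.
Qed.
End LowerIntegral.

Section Dense.
Context {R : realType} {M : metricType R}.
Hypotheses (M_nonempty : [set: M] !=set0) (M_compact : compact [set: M]).

(** Finite nets of mesh 1/(k+1) for all k are listed in one sequence by coding the pair (net,
    position). Suprema over [M] of continuous functions thereby become countable ones, which are
    measurable in time. *)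
Lemma exists_dense_seq : exists q : nat -> M, forall p (e : R), 0 < e -> exists n, ball p e (q n).
Proof.
have [p0 _] := M_nonempty.
pose MP : ptopologicalType := HB.pack (M : Type) (Topological.on M) (isPointed.Build M p0).
have H (k : nat) : exists s : seq M, forall p, exists2 q, q \in s & ball q (k.+1%:R^-1) p.
  have : @cover_compact MP [set: M] by rewrite -(compact_cover MP).
  move=> /(_ M setT (fun p => (ball p (k.+1%:R^-1 : R))°)).
  case=> [p _|p _|D _ Dcov]; first exact: open_interior.
    by exists p => //; apply: nbhsx_ballx; rewrite invr_gt0.
  exists (finmap.enum_fset D) => p; have [q /= Dq pq] := Dcov p I.
  by exists q => //; exact: interior_subset pq.
have [s Hs] := choice H.
exists (fun a => if unpickle a is Some (k, l) then nth p0 (s k) l else p0) => p e e0.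
pose k := Num.bound e^-1.
have ke : k.+1%:R^-1 <= e.
  rewrite invf_ple ?posrE//; apply: le_trans (ltW (archi_boundP _)) _.
    by rewrite invr_ge0 ltW.
  by rewrite ler_nat.
have [q qs qp] := Hs k p.
exists (pickle (k, index q (s k))); rewrite pickleK nth_index//.
by apply: le_ball ke _ _; exact: ball_sym.
Qed.
End Dense.

Section Cauchy.
Context {R : realType} {M : metricType R} {n : nat} {A : smooth_atlas R M n.*2.+1}.
Hypotheses (M_nonempty : [set: M] !=set0) (M_compact : compact [set: M]).
Variable alpha : one_form A.
Hypothesis alpha_contact : contact_form alpha.
Local Notation mu := (@lebesgue_measure R).

Lemma simple_measurable (S : R -> M -> R) q : simple_C0 S ->
  measurable_fun setT (fun t : measurableTypeR R => S t q).
Proof.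
move=> [N [B [g [mB _ SE]]]].
rewrite (_ : (fun _ => _) = (fun t => \sum_(k < N) \1_(B k) t * g k q)).
  apply: measurable_sum => k; apply: measurable_funM => //.
  by apply: measurable_indic; exact: mB.
by apply/funext => t; exact: SE.
Qed.

Variables (H : R -> M -> R) (H_ : nat -> R -> M -> R).
Hypothesis H_L1 : in_L1C0 alpha H.
Hypothesis H_cont : forall i, continuous (joint (fun t => H_ i (clamp t))).
Hypothesis H_cvg : norm_1oo alpha (fun t x => H t x - H_ i t x) @[i --> \oo] --> 0%E.

Let null_set : exists N : set (measurableTypeR R), [/\ measurable N, mu N = 0%E &
  exists S : nat -> R -> M -> R, (forall k, simple_C0 (S k)) /\
  forall t, t \in `[0, 1] -> ~ N t -> continuous (H t) /\
    forall q, S k t q @[k --> \oo] --> H t q].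
Proof.
have [[N1 [mN1 N10 HN1]] [S [sS [N2 [mN2 N20 HN2]]]] _] := H_L1.
exists (N1 `|` N2); split.
- exact: measurableU.
- exact: etrans (measureU0 mN1 mN2 N20) N10.
exists S; split=> // t t01 nN; split.
  apply: contrapT => nc; apply: nN; left; apply: HN1 => /= /(_ t01).
  exact: nc.
have /uniform_cvgP HS : {uniform, (fun k => S k t) @ \oo --> H t}.
  apply: contrapT => nc; apply: nN; right; apply: HN2 => /= /(_ t01).
  exact: nc.
move=> q; apply/cvgrPdist_lt => e e0; have [K HK] := HS e e0.
by exists K => // k /= Kk; exact: (HK k Kk q I).
Qed.

(** The triangle inequality runs through [H]. Splitting the integral of a sum wants measurable
    summands, which the integrand of [norm_1oo] is not known to be. The suprema [U i] over the dense
    sequence are measurable, because [H] is almost everywhere a pointwise limit of simple functions;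
    they lie below [ham_norm] and still dominate the differences. *)
Lemma L1_cauchy (eps : R) : 0 < eps -> exists N, forall i j, (N <= i)%N -> (N <= j)%N ->
  \int[mu]_(t in `[0, 1]) supn (fun p => H_ i (clamp t) p - H_ j (clamp t) p) < eps.
Proof.
move=> eps0.
have [N0 [mN0 N00 [S [sS HS]]]] := null_set.
have [q qdense] := exists_dense_seq M_nonempty M_compact.
pose I01 : set (measurableTypeR R) := `[0, 1]%classic.
pose D : set (measurableTypeR R) := I01 `\` N0.
have mI : measurable I01 by exact: measurable_itv.
have mD : measurable D by exact: measurableD.
have Hsec i t : continuous (fun p => H_ i (clamp t) p).
  exact: (@joint_section _ _ (fun t => H_ i (clamp t)) t).
have DI t : D t -> t \in `[0, 1] by case.
pose u i t a : R := `|H t (q a) - H_ i (clamp t) (q a)|.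
pose U i (t : measurableTypeR R) : \bar R := esups (fun a => (u i t a)%:E) 0.
have mH a : measurable_fun D (fun t : measurableTypeR R => H t (q a)).
  apply: (@measurable_fun_cvg _ _ _ D (fun k t => S k t (q a))).
    by move=> k; apply: measurable_funS (simple_measurable (q a) (sS k)).
  by move=> t [t01 nN]; have [_] := HS t t01 nN; exact.
have mHi i a : measurable_fun D (fun t : measurableTypeR R => H_ i (clamp t) (q a)).
  apply: (@measurable_funS _ _ _ _ setT) => //.
  apply: continuous_measurable_fun => t.
  apply: (@continuous_comp _ _ _ (fun t : R => (t, q a)) (joint (fun t => H_ i (clamp t)))).
    by apply: for_continuous_pair; [exact: cvg_id|exact: cst_continuous].
  exact: H_cont.
have mU i : measurable_fun D (U i).
  apply: measurable_fun_esups => a; apply/measurable_EFinP.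
  apply: measurableT_comp => //; exact: measurable_funB.
have U0 i t : (0 <= U i t)%E.
  apply: (@le_trans _ _ (u i t 0%N)%:E); first by rewrite lee_fin normr_ge0.
  by apply: ereal_sup_ubound; exists 0%N.
have Uham i t : D t -> (U i t <= (ham_norm alpha (fun x => H t x - H_ i t x))%:E)%E.
  move=> Dt; have [cH _] := HS t (DI t Dt) (proj2 Dt).
  apply: ge_ereal_sup => _ [a _ <-]; rewrite lee_fin /u (clamp_id (DI t Dt)).
  apply: (le_ham_norm M_nonempty M_compact alpha_contact) => p.
  apply: (@for_continuousB _ _ (H t) (H_ i t)); first exact: cH.
  by have := Hsec i t p; rewrite clamp_id// DI.
have hU i j t : D t ->
    ((supn (fun p => H_ i (clamp t) p - H_ j (clamp t) p))%:E <= U i t + U j t)%E.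
  move=> Dt.
  have [Ui HUi] : exists c, U i t = c%:E.
    have := Uham i t Dt; have := U0 i t; case: (U i t) => [c _ _|//|//]; by exists c.
  have [Uj HUj] : exists c, U j t = c%:E.
    have := Uham j t Dt; have := U0 j t; case: (U j t) => [c _ _|//|//]; by exists c.
  rewrite HUi HUj -EFinD lee_fin; apply: (supn_le M_nonempty) => p.
  have cij : {for p, continuous (fun p => H_ i (clamp t) p - H_ j (clamp t) p)}.
    by apply: for_continuousB; exact: Hsec.
  (* The bound at the points of the dense sequence is carried to [p] by continuity of the
     difference, at the cost of an arbitrarily small [e]. *)
  apply/ler_addgt0Pr => e e0.
  have /cvgrPdist_le/(_ _ e0)/nbhs_ballP[d /= d0 Hd] := cij.
  have [a qa] := qdense p d d0.
  have {Hd}h1 := Hd _ qa.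
  have h2 : u i t a <= Ui.
    by rewrite -lee_fin -HUi; apply: ereal_sup_ubound; exists a.
  have h3 : u j t a <= Uj.
    by rewrite -lee_fin -HUj; apply: ereal_sup_ubound; exists a.
  have h4 : `|H_ i (clamp t) (q a) - H_ j (clamp t) (q a)| <= u i t a + u j t a.
    apply: le_trans (ler_distD (H t (q a)) _ _) _.
    by rewrite /u [in X in X + _ <= _]distrC.
  apply: le_trans (_ : e + `|H_ i (clamp t) (q a) - H_ j (clamp t) (q a)| <= _); last lra.
  apply: le_trans _ (lerD h1 (lexx _)).
  by apply: le_trans (ler_normD _ _); rewrite subrK.
have e2 : (0 < (eps / 4)%:E)%E by rewrite lte_fin divr_gt0.
have [N _ HN] : \forall i \near \oo, (norm_1oo alpha (fun t x => (H t x - H_ i t x)%R) < (eps / 4)%:E)%E.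
  have := H_cvg; move=> /(_ [set x | (x < (eps / 4)%:E)%E]); apply.
  by apply: open_nbhs_nbhs; split => //; exact: open_ereal_lt_ereal.
exists N => i j Ni Nj.
pose h t := supn (fun p => H_ i (clamp t) p - H_ j (clamp t) p).
have ch : continuous h.
  apply: (@supn_continuous _ _ M_nonempty M_compact (fun t p => H_ i (clamp t) p - H_ j (clamp t) p)).
  by move=> z; apply: for_continuousB; exact: H_cont.
have h0 t : 0 <= h t.
  by apply: (supn_ge0 M_nonempty M_compact) => p; apply: for_continuousB; exact: Hsec.
have mh : measurable_fun setT (h : measurableTypeR R -> R) by exact: continuous_measurable_fun.
have Uint k : (N <= k)%N -> (\int[mu]_(t in D) U k t < (eps / 4)%:E)%E.
  move=> Nk; apply: le_lt_trans (HN k Nk).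
  apply: (le_integral_ae mN0 N00) => t Dt; rewrite U0/=.
  exact: Uham.
have : (\int[mu]_(t in I01) (h t)%:E <= (eps / 4 + eps / 4)%:E)%E.
  rewrite (ge0_negligible_integral mN0 mI)//; last 2 first.
  - by apply/measurable_EFinP; exact: measurable_funS mh.
  - by move=> t _; rewrite lee_fin h0.
  apply: (@le_trans _ _ (\int[mu]_(t in D) (U i t + U j t))%E).
    apply: ge0_le_integral => //.
    - by move=> t _; rewrite lee_fin h0.
    - by apply/measurable_EFinP; exact: measurable_funS mh.
    - by apply: emeasurable_funD.
    - by move=> t Dt; exact: hU.
  rewrite ge0_integralD// EFinD; apply: leeD; apply: ltW; exact: Uint.
move=> Hle; rewrite /Rintegral.
apply: (@le_lt_trans _ _ (eps / 4 + eps / 4)); last lra.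
rewrite -lee_fin fineK//.
rewrite ge0_fin_numE; first exact: le_lt_trans Hle (ltry _).
by apply: integral_ge0 => t _; rewrite lee_fin h0.
Qed.

End Cauchy.

(** * Continuous systems are topological systems *)

Section ContinuousToTopological.
Context {R : realType} {M : metricType R} {n : nat} {A : smooth_atlas R M n.*2.+1}.
Hypotheses (M_nonempty : [set: M] !=set0) (M_compact : compact [set: M]).
Variable alpha : one_form A.
Hypothesis alpha_contact : contact_form alpha.
Local Notation mu := (@lebesgue_measure R).

Lemma joint_bounded (D : R -> M -> R) : continuous (joint D) ->
  exists2 C, 0 <= C & forall t p, t \in `[0, 1] -> `|D t p| <= C.
Proof.
move=> cD; have cs := supn_continuous M_nonempty M_compact cD.
have [c _ Hc] := @EVT_max R _ 0 1 ler01 (continuous_subspaceT cs).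
have cDt t : continuous (D t) by exact: joint_section.
exists (supn (D c)); first exact: supn_ge0.
move=> t p t01; apply: le_trans (Hc t t01).
exact: (supn_ub M_nonempty M_compact).
Qed.

Lemma clamp_joint (H : R -> M -> R) :
  {within `[0, 1] `*` [set: M], continuous (fun z : R * M => H z.1 z.2)} ->
  continuous (joint (fun t => H (clamp t))).
Proof.
move=> cH z; apply: (@continuous_within_comp _ _ _ _ (fun z : R * M => H z.1 z.2)
  (fun z : R * M => (clamp z.1, z.2)) z cH); last first.
  by move=> y; split=> //=; exact: clamp_itv.
apply: for_continuous_pair; last exact: cvg_snd.
apply: (@continuous_comp _ _ _ (fun z : R * M => z.1) clamp); first exact: cvg_fst.
exact: clamp_continuous.
Qed.

Lemma norm_oo_ub (D : R -> M -> R) t : continuous (joint (fun t => D (clamp t))) ->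
  t \in `[0, 1] -> ham_norm alpha (D t) <= norm_oo alpha D.
Proof.
move=> cD t01; have [C C0 HC] := joint_bounded cD.
apply: sup_ubound; last by exists t.
exists (3 * C) => _ [s s01 <-]; apply: (ham_norm_le M_nonempty M_compact alpha_contact).
  by rewrite -(clamp_id s01); exact: (joint_section (t:=s) cD).
by move=> p; have := HC s p s01; rewrite clamp_id.
Qed.

Lemma norm_oo_le (D : R -> M -> R) c : (forall t, t \in `[0, 1] -> continuous (D t)) ->
  (forall t p, t \in `[0, 1] -> `|D t p| <= c) -> 0 <= norm_oo alpha D <= 3 * c.
Proof.
move=> cD Dc; have i0 : (0 : R) \in `[0, 1] by rewrite in_itv/= lexx ler01.
have bd t : t \in `[0, 1] -> ham_norm alpha (D t) <= 3 * c.
  move=> t01; apply: (ham_norm_le M_nonempty M_compact alpha_contact); first exact: cD.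
  by move=> p; exact: Dc.
apply/andP; split.
  apply: le_trans (ham_norm_ge0 M_nonempty M_compact alpha_contact (cD 0 i0)) _.
  by apply: sup_ubound; [exists (3 * c) => _ [t t01 <-]; exact: bd|exists 0].
apply: ge_sup; first by exists (ham_norm alpha (D 0)), 0.
by move=> _ [t t01 <-]; exact: bd.
Qed.

Lemma norm_1oo_le (D : R -> M -> R) c : (forall t, t \in `[0, 1] -> continuous (D t)) ->
  (forall t, t \in `[0, 1] -> ham_norm alpha (D t) <= c) ->
  (0 <= norm_1oo alpha D <= c%:E)%E.
Proof.
move=> cD Dc.
have h0 t : `[0, 1]%classic t -> (0 <= (ham_norm alpha (D t))%:E)%E.
  by move=> t01; rewrite lee_fin (ham_norm_ge0 M_nonempty M_compact alpha_contact)//; exact: cD.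
rewrite /norm_1oo integral_ge0//=.
have mI : measurable (`[0, 1] : set (measurableTypeR R)) by exact: measurable_itv.
have Ic : (\int[mu]_(t in `[0%R, 1%R]) c%:E = c%:E)%E.
  rewrite integral_cst//; transitivity (c%:E * 1)%E; last by rewrite mule1.
  congr (_ * _)%E; apply: etrans (lebesgue_measure_itv `[0, 1]) _.
  by rewrite /= lte_fin ltr01 oppr0 adde0.
rewrite -[leRHS]Ic -[X in (\int[_]_(_ in X) _ <= _)%E]setD0.
apply: (le_integral_ae measurable0 (measure0 _)) => t [t01 _].
by rewrite h0// lee_fin Dc.
Qed.

Lemma continuous_in_L1C0 (H : R -> M -> R) :
  {within `[0, 1] `*` [set: M], continuous (fun z : R * M => H z.1 z.2)} ->
  in_L1C0 alpha H.
Proof.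
move=> cH; have cHc := clamp_joint cH.
have cHt t : t \in `[0, 1] -> continuous (H t).
  by move=> t01; rewrite -(clamp_id t01); exact: (joint_section (t:=t) cHc).
split.
- by apply: aeW => t; exact: cHt.
- pose B (k j : nat) : set (measurableTypeR R) := `[j%:R / k.+1%:R, j.+1%:R / k.+1%:R[%classic.
  (* Step functions with cells of length 1/(k+1) and the value at the left end of each cell. The
     cells are half-open, so there are k+2 of them: the last one is needed for t = 1. *)
  exists (fun k t x => \sum_(j < k.+2) \1_(B k j) t * H (clamp (j%:R / k.+1%:R)) x); split.
    move=> k; exists k.+2, (fun j => B k j), (fun j => H (clamp (j%:R / k.+1%:R))).
    split=> // j; first exact: measurable_itv.
    exact: (joint_section (t:=j%:R / k.+1%:R) cHc).
  apply: aeW => t t01; apply/uniform_cvgP => e e0.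
  have e2 : 0 < e / 2 by rewrite divr_gt0.
  have /nbhs_normP[d/= d0 Hd] := joint_uniform M_compact t cHc e2.
  exists (Num.bound d^-1) => k Nk p _.
  have kR : 0 < k.+1%:R :> R by [].
  have kd : k.+1%:R^-1 < d.
    rewrite invf_plt ?posrE//; apply: lt_le_trans (archi_boundP _) _.
      by rewrite invr_ge0 ltW.
    by rewrite ler_nat; exact: leq_trans Nk _.
  have /andP[t0 t1] : 0 <= t <= 1 by move: t01; rewrite in_itv.
  have /truncn_itv : 0 <= t * k.+1%:R by rewrite mulr_ge0.
  set j0 := Num.truncn _ => /andP[j1 j2].
  have j0k : (j0 < k.+2)%N.
    rewrite ltnS -(ler_nat R); apply: le_trans j1 _; by rewrite ler_piMl.
  have Bt j : (B k j t) <-> j = j0.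
    rewrite /B/= in_itv/= ler_pdivrMr// ltr_pdivlMr//; split; last first.
      by move=> ->; rewrite j1 j2.
    move=> /andP[a1 a2]; apply/eqP; rewrite eqn_leq; apply/andP; split.
      by rewrite -ltnS -(ltr_nat R) (le_lt_trans a1 j2).
    by rewrite -ltnS -(ltr_nat R) (le_lt_trans j1 a2).
  rewrite (bigD1 (Ordinal j0k))//= big1 ?addr0; last first.
    move=> j jj0; rewrite indicE; case: (boolP (t \in B k j)); last by rewrite mul0r.
    move=> /set_mem /Bt jE; case/eqP: jj0; exact: val_inj.
  rewrite indicE mem_set ?mul1r; last exact/Bt.
  have := Hd (j0%:R / k.+1%:R) => /(_ _ p); rewrite (clamp_id t01) => h.
  rewrite -ball_normE/=; apply: (@le_lt_trans _ _ (e / 2)); last by lra.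
  apply: h; rewrite /ball_/=; apply: le_lt_trans kd.
  have b1 : j0%:R / k.+1%:R <= t by rewrite ler_pdivrMr.
  have b2 : t < j0.+1%:R / k.+1%:R by rewrite ltr_pdivlMr.
  move: b2; rewrite -[j0.+1%:R]natr1 mulrDl mul1r => b2.
  have kV : 0 < k.+1%:R^-1 :> R by rewrite invr_gt0.
  have E (a w : R) : 0 < w -> a <= t -> t < a + w -> `|t - a| <= w.
    by move=> *; rewrite ler_norml; apply/andP; split; lra.
  exact: E.
- have [C C0 HC] := joint_bounded cHc.
  have hb t : t \in `[0, 1] -> ham_norm alpha (H t) <= 3 * C.
    move=> t01; apply: (ham_norm_le M_nonempty M_compact alpha_contact); first exact: cHt.
    by move=> p; have := HC t p t01; rewrite clamp_id.
  by have /andP[_ h] := norm_1oo_le cHt hb; exact: le_lt_trans h (ltry _).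
Qed.

Lemma continuous_topological_system (Phi : R -> M -> M) (H : R -> M -> R) :
  continuous_system alpha Phi H -> topological_system alpha Phi H.
Proof.
move=> [cPhi cH [Phi_ [H_ [sys cvgP cvgH]]]]; split=> //; first exact: continuous_in_L1C0.
exists Phi_, H_; split=> //.
have cHc := clamp_joint cH.
have cDi i : continuous (joint (fun t x => H (clamp t) x - H_ i (clamp t) x)).
  move=> z; apply: (@for_continuousB _ _ (joint (fun t => H (clamp t)))); first exact: cHc.
  exact: (system_hamiltonian_continuous M_compact (@metric_hausdorff R M) (sys i)).
have bound i : (0%E <= norm_1oo alpha (fun t x => (H t x - H_ i t x)%R) <=
    (norm_oo alpha (fun t x => H t x - H_ i t x)%R)%:E)%E.
  apply: norm_1oo_le => t t01.
    have := joint_section (t:=t) (cDi i); by rewrite clamp_id.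
  by apply: (@norm_oo_ub (fun t x => H t x - H_ i t x)).
apply: (@squeeze_cvge _ _ _ _ (fun=> 0%E) _ (fun i => (norm_oo alpha (fun t x => H t x - H_ i t x))%:E)).
- by apply: nearW => i; exact: bound.
- exact: cvg_cst.
- by apply: cvg_EFin; [exact: nearW|exact: cvgH].
Qed.

End ContinuousToTopological.

(** * Connecting two nearby systems *)

Section UniformContinuity.
Context {R : realType} {M : metricType R}.
Hypothesis M_compact : compact [set: M].

Lemma joint_unif_continuous (G : R -> M -> M) (e : R) : continuous (joint G) -> 0 < e ->
  exists2 d, 0 < d & forall u p q, u \in `[0, 1] -> ball p d q -> ball (G u p) e (G u q).
Proof.
move=> cG e0.
have cK : compact (`[0, 1]%classic `*` [set: M] : set (R * M)).
  by apply: compact_setX => //; exact: segment_compact.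
have : \forall d \near (0 : R), forall z : R * M, (`[0, 1]%classic `*` [set: M]) z ->
    forall q, ball z.2 d q -> ball (G z.1 z.2) e (G z.1 q).
  apply: near_all_compact => // -[u p] _.
  have e2 : 0 < e / 2 by rewrite divr_gt0.
  have : \forall z \near (u, p), ball (G u p) (e / 2) (joint G z).
    by apply: (cG (u, p)); exact: nbhsx_ballx.
  move=> [[/= N1 N2] [N1u /nbhs_ballP[r /= r0 rN2]] HN].
  have r2 : 0 < r / 2 by rewrite divr_gt0.
  exists ([set z : R * M | N1 z.1 /\ ball p (r / 2) z.2], ball_ (fun x : R => `|x|) 0 (r / 2)) => /=.
    split; last by apply/nbhs_normP; exists (r / 2).
    exists (N1, ball p (r / 2)) => /=; last by move=> [a b].
    by split=> //; exact: nbhsx_ballx.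
  move=> [[u' p'] d]/= [[N1u' pp'] dr] q p'q.
  have h1 : ball (G u p) (e / 2) (G u' p').
    apply: (HN (u', p')); split=> //=; apply: rN2.
    by apply: le_ball pp'; lra.
  have h2 : ball (G u p) (e / 2) (G u' q).
    apply: (HN (u', q)); split=> //=; apply: rN2.
    rewrite (splitr r); apply: ball_triangle pp' _.
    apply: le_ball p'q; move: dr; rewrite /ball_/= sub0r normrN => /ltW; exact: le_trans (ler_norm _).
  rewrite (splitr e); exact: ball_triangle (ball_sym h1) h2.
move=> /nbhs_normP[d /= d0 Hd]; exists (d / 2); first by rewrite divr_gt0.
move=> u p q u01 pq; apply: (Hd (d / 2) _ (u, p)) => //=.
by rewrite /ball_/= sub0r normrN gtr0_norm ?divr_gt0//; lra.
Qed.

End UniformContinuity.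

Section Stage.
Context {R : realType} {M : metricType R} {n : nat} {A : smooth_atlas R M n.*2.+1}.
Hypotheses (M_nonempty : [set: M] !=set0) (M_compact : compact [set: M]).
Variable alpha : one_form A.
Local Notation mu := (@lebesgue_measure R).
Let M_hausdorff : hausdorff_space M := @metric_hausdorff R M.

(* [P] runs through phi_u^-1 o phi'_u, whose Hamiltonian is (H'_u - H_u) o phi_u,
   with a time change u = tau(t) that slows down where H' - H is large. *)
Lemma connecting_flow : exists2 C : R, 0 < C &
  forall (Phi Phi' : R -> M -> M) (H H' : R -> M -> R) (s s' eps : R),
  smooth_system alpha Phi H -> smooth_system alpha Phi' H' -> s < s' ->
  \int[mu]_(t in `[0, 1]) supn (fun p => H' (clamp t) p - H (clamp t) p) < eps ->
  exists (P Q : R -> M -> M) (L : R -> M -> R), flow alpha P Q L /\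
  [/\ forall t q, `|L t q| <= C * eps / (s' - s),
      forall t q, t <= s \/ s' <= t -> L t q = 0,
      forall t p, t <= s -> P t p = p,
      forall t p, s' <= t -> Phi 1 (P t p) = Phi' 1 p &
      forall t, exists2 u, u \in `[0, 1] & forall p, Phi u (P t p) = Phi' u p].
Proof.
have [C C0 HC] := @time_change R; exists C => // Phi Phi' H H' s s' eps sys sys' ss' Ieps.
have cH := system_hamiltonian_continuous M_compact M_hausdorff sys.
have cH' := system_hamiltonian_continuous M_compact M_hausdorff sys'.
pose D t p := H' (clamp t) p - H (clamp t) p.
have cD : continuous (joint D).
  by move=> z; apply: for_continuousB; [exact: cH'|exact: cH].
pose h t := supn (D t).
have ch : continuous h by exact: supn_continuous.
have h0 t : 0 <= h t by apply: supn_ge0 => //; exact: joint_section.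
have [m [c [m0 hc ceps]]] := upper_riemann_sum ch h0 Ieps.
have [tau [stau itau tau0 tau1 dtau]] := HC h m c eps s s' m0 ss' hc ceps.
have tau01 t : tau t \in `[0, 1] by rewrite in_itv/= itau.
have [G fF] := flow_reparam M_compact M_hausdorff sys stau tau01.
have [G' fF'] := flow_reparam M_compact M_hausdorff sys' stau tau01.
have fP := flow_comp (flow_inv fF) fF'.
set L := (X in flow _ _ _ X) in fP.
have FG t q : Phi (tau t) (G t q) = q by case: fF => _ _ _ /(_ t q).
have LE t q : L t q = (tau^`())%classic t * D (tau t) (Phi (tau t) q).
  by rewrite /L /D clamp_id// mulrBr addrC.
(* Outside the time interval, and also at its ends, [tau] is at its global minimum 0 or maximum
   1. *)
have dtau0 t : t <= s \/ s' <= t -> (tau^`())%classic t = 0.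
  have dert (y : R) : derivable tau y 1 by exact: smooth1_derivable.
  move=> [ts|ts]; [apply: derive1_global_min|apply: derive1_global_max] => // y.
    by rewrite (tau0 t ts); have /andP[] := itau y.
  by rewrite (tau1 t ts); have /andP[] := itau y.
have P0 : Phi 0 = id by case: sys => -[[]].
have P0' : Phi' 0 = id by case: sys' => -[[]].
exists (fun t p => G t (Phi' (tau t) p)), (fun t p => G' t (Phi (tau t) p)), L.
split=> //; split.
- move=> t q; rewrite LE normrM; apply: le_trans (dtau t).
  rewrite ler_wpM2l//; apply: (supn_ub M_nonempty M_compact).
  exact: joint_section.
- by move=> t q ts; rewrite LE dtau0// mul0r.
- move=> t p ts; have := FG t (Phi' (tau t) p).
  by rewrite tau0// P0 P0'.
- move=> t p ts; have := FG t (Phi' (tau t) p).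
  by rewrite tau1.
- by move=> t; exists (tau t) => // p; exact: FG.
Qed.

(** Stopping any system at time 0 by the constant time change exhibits the identity as a flow with
    zero Hamiltonian. *)
Lemma constant_flow Phi H : smooth_system alpha Phi H ->
  exists (G : R -> M -> M) (K : R -> M -> R),
  flow alpha (fun _ => id) G K /\ forall t q, K t q = 0.
Proof.
move=> sys; have c01 (t : R) : (0 : R) \in `[0, 1] by rewrite in_itv/= lexx ler01.
have [G fF] := flow_reparam M_compact M_hausdorff sys (smooth1_cst 0) c01.
have P0 : Phi 0 = id by case: sys => -[[]].
exists G, (fun t q => ((fun _ : R => 0 : R)^`())%classic t * H 0 q); split.
  by rewrite -P0.
by move=> t q; rewrite derive1_cst mul0r.
Qed.

End Stage.

(** * Infinite concatenation *)

Section UniformLimit.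
Context {R : realType} {T : topologicalType} {V : pseudoMetricType R}.

Lemma within_uniform_limit (B : set T) (f_ : nat -> T -> V) (f : T -> V) :
  (forall i, continuous (f_ i)) ->
  (forall e : R, 0 < e -> exists N, forall y, B y -> ball (f y) e (f_ N y)) ->
  {within B, continuous f}.
Proof.
move=> cf uf; apply/subspace_continuousP => x Bx; apply/cvg_ballP => e e0.
have e4 : 0 < e / 4 by rewrite divr_gt0.
have [N HN] := uf _ e4.
have : \forall y \near x, ball (f_ N x) (e / 4) (f_ N y).
  by apply: (cf N x); exact: nbhsx_ballx.
move=> nf; rewrite near_withinE; apply: filterS nf => y xy By.
apply: (@le_ball _ _ _ (e / 4 + e / 4 + e / 4)); first lra.
apply: ball_triangle (ball_sym (HN y By)).
exact: ball_triangle (HN x Bx) xy.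
Qed.
End UniformLimit.

Section Nodes.
Context {R : realType}.

Definition node (k : nat) : R := 1 - k.+1%:R^-1.

Lemma node0 : node 0 = 0.
Proof. by rewrite /node invr1 subrr. Qed.

Lemma node_lt k : node k < node k.+1.
Proof. by rewrite /node ltrD2l ltrN2 ltf_pV2 ?posrE// ltr_nat. Qed.

Lemma node_le k l : (k <= l)%N -> node k <= node l.
Proof. by move=> kl; rewrite /node lerD2l lerN2 lef_pV2 ?posrE// ler_nat. Qed.

Lemma node_lt1 k : node k < 1.
Proof. by rewrite /node gtrBl invr_gt0. Qed.

Lemma node_cofinal (t : R) : t < 1 -> exists N, t <= node N.
Proof.
move=> t1; exists (Num.bound (1 - t)^-1); rewrite /node.
have t0 : 0 < 1 - t by rewrite subr_gt0.
have : (Num.bound (1 - t)^-1).+1%:R^-1 <= 1 - t.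
  rewrite invf_ple ?posrE//; apply: le_trans (ltW (archi_boundP _)) _.
    by rewrite invr_ge0 ltW.
  by rewrite ler_nat.
by rewrite lerBrDr => h; rewrite lerBrDr addrC.
Qed.
End Nodes.

Section Concatenation.
Context {R : realType} {M : metricType R} {n : nat} {A : smooth_atlas R M n.*2.+1}.
Hypotheses (M_nonempty : [set: M] !=set0) (M_compact : compact [set: M]).
Variable alpha : one_form A.
Hypothesis alpha_contact : contact_form alpha.
Let M_hausdorff : hausdorff_space M := @metric_hausdorff R M.
Local Notation mu := (@lebesgue_measure R).

(** [S] is the approximating sequence with the stationary isotopy put in front, and [P k] is the
    stage that leads from [S k] to [S k.+1]. Its Hamiltonian is bounded only for k > 0: the
    contribution of stage 0 is common to all later concatenations and cancels in their
    differences. *)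
Variables (Phi : R -> M -> M) (S : nat -> R -> M -> M).
Variables (P Q : nat -> R -> M -> M) (L : nat -> R -> M -> R).
Variables (F0 G0 : R -> M -> M) (H0 : R -> M -> R).
Hypothesis cPhi : continuous_isotopy Phi.
Hypothesis S0 : S 0 = fun=> id.
Hypothesis S_cvg : forall e : R, 0 < e -> exists N, forall k, (N <= k)%N ->
  forall u p, u \in `[0, 1] -> ball (Phi u p) e (S k u p).
Hypothesis flow0 : flow alpha F0 G0 H0.
Hypothesis F0_id : forall t p, F0 t p = p.
Hypothesis flowP : forall k, flow alpha (P k) (Q k) (L k).
Hypothesis L_le : forall k t q, (0 < k)%N -> `|L k t q| <= node k.+1 - node k.
Hypothesis L0 : forall k t q, t <= node k \/ node k.+1 <= t -> L k t q = 0.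
Hypothesis P_before : forall k t p, t <= node k -> P k t p = p.
Hypothesis P_after : forall k t p, node k.+1 <= t -> S k 1 (P k t p) = S k.+1 1 p.
Hypothesis P_between : forall k t, exists2 u, u \in `[0, 1] &
  forall p, S k u (P k t p) = S k.+1 u p.

(** Each stage is the identity before its time interval and stationary after it, so concatenation is
    just composition of flows, and smoothness at the junctions is automatic. The new factor is put
    on the right, so that at the end of stage k the map is [S k.+1 1]. *)
Fixpoint Theta N : R -> M -> M :=
  if N is N'.+1 then fun t p => Theta N' t (P N' t p) else F0.
Fixpoint ThetaV N : R -> M -> M :=
  if N is N'.+1 then fun t p => Q N' t (ThetaV N' t p) else G0.
Fixpoint Ham N : R -> M -> R :=
  if N is N'.+1 then fun t p => Ham N' t p + L N' t (ThetaV N' t p) else H0.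

Lemma flow_Theta N : flow alpha (Theta N) (ThetaV N) (Ham N).
Proof. by elim: N => [|N IH] /=; [exact: flow0|exact: flow_comp]. Qed.

Lemma Theta_stable N j t p : t <= node N -> Theta (N + j) t p = Theta N t p.
Proof.
move=> tN; elim: j => [|j IH]; first by rewrite addn0.
by rewrite addnS /= P_before ?IH//; apply: le_trans tN (node_le _); rewrite leq_addr.
Qed.

Lemma Ham_stable N j t p : t <= node N -> Ham (N + j) t p = Ham N t p.
Proof.
move=> tN; elim: j => [|j IH]; first by rewrite addn0.
rewrite addnS /= L0 ?addr0 ?IH//; left; apply: le_trans tN (node_le _); exact: leq_addr.
Qed.

Lemma Theta_after N t p : node N <= t -> Theta N t p = S N 1 p.
Proof.
elim: N p => [|N IH] p tN /=; first by rewrite F0_id S0.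
by rewrite IH ?P_after//; apply: le_trans tN; exact: node_le.
Qed.

Lemma Ham_after N t p : 1 <= t -> Ham N t p = H0 t p.
Proof.
move=> t1; elim: N => [//|N IH] /=; rewrite IH L0 ?addr0//; right.
by apply: le_trans t1; exact/ltW/node_lt1.
Qed.

(** Each new summand is some [L k] composed with a map of [M], which does not affect its uniform
    bound; the bounds telescope. *)
Lemma Ham_diff N j t p : (0 < N)%N ->
  `|Ham (N + j) t p - Ham N t p| <= node (N + j) - node N.
Proof.
move=> N0; elim: j => [|j IH]; first by rewrite addn0 !subrr normr0.
rewrite addnS /=; set K := Ham (N + j) t p in IH *; set l := L _ _ _.
have hl : `|l| <= node (N + j).+1 - node (N + j).
  by apply: L_le; rewrite addn_gt0 N0.
rewrite -addrA [l - _]addrC addrA; apply: le_trans (ler_normD _ _) _; lra.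
Qed.

Let psi t := Phi (clamp t).

Let psi_inverse : exists G : R -> M -> M, [/\ continuous (joint psi), continuous (joint G),
  forall t, cancel (psi t) (G t) & forall t, cancel (G t) (psi t)].
Proof.
have [cP dP _] := cPhi.
have cpsi : continuous (joint psi).
  move=> z; apply: (@continuous_within_comp _ _ _ _ (fun z : R * M => Phi z.1 z.2)
    (fun z : R * M => (clamp z.1, z.2)) z cP); last first.
    by move=> y; split=> //=; exact: clamp_itv.
  apply: for_continuous_pair; last exact: cvg_snd.
  apply: (@continuous_comp _ _ _ (fun z : R * M => z.1) clamp); first exact: cvg_fst.
  exact: clamp_continuous.
have H t : exists g, cancel (psi t) g /\ cancel g (psi t).
  by have [g [_ _ gK Kg]] := dP _ (clamp_itv t); exists g.
have [G HG] := choice H.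
have FK t : cancel (psi t) (G t) by have [] := HG t.
have GK t : cancel (G t) (psi t) by have [] := HG t.
exists G; split=> //.
exact: (@continuous_inverse_family R M M_compact M_hausdorff _ _ cpsi FK GK).
Qed.

Let one01 : (1 : R) \in `[0, 1].
Proof. by rewrite in_itv/= ler01 lexx. Qed.

(* Both S_k and S_{k+1} are uniformly close to Phi, and the inverses of the
   Phi_u are equicontinuous. *)
Lemma P_cvg (e : R) : 0 < e -> exists N, forall k, (N <= k)%N ->
  forall t p, ball p e (P k t p).
Proof.
move=> e0; have [G [cpsi cG FK GK]] := psi_inverse.
have [d d0 Hd] := joint_unif_continuous M_compact cG e0.
have d2 : 0 < d / 2 by rewrite divr_gt0.
have [N HN] := S_cvg d2; exists N => k Nk t p.
have [u u01 Hu] := P_between k t.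
have h1 := HN k Nk u (P k t p) u01.
have h2 := HN k.+1 (leqW Nk) u p u01.
rewrite Hu in h1.
have h : ball (psi u p) d (psi u (P k t p)).
  by rewrite (splitr d) /psi clamp_id//; exact: ball_triangle h2 (ball_sym h1).
by have := Hd u _ _ u01 h; rewrite !FK.
Qed.

(** Stages that have not begun drop out, and from time [node N] on the first N stages amount to
    [S N 1], which is close to [Phi 1]. So only the last stage begun has to be estimated, and it is
    close to the identity by [P_cvg]; errors of different stages do not add up. *)
Lemma Theta_near_end (e : R) : 0 < e -> exists N0, forall N t p, (N0 <= N)%N ->
  node N0 <= t -> ball (Phi 1 p) e (Theta N t p).
Proof.
move=> e0; have [G [cpsi cG FK GK]] := psi_inverse.
have e2 : 0 < e / 2 by rewrite divr_gt0.
have [d d0 Hd] := joint_unif_continuous M_compact cpsi e2.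
have [N1 HN1] := S_cvg e2; have [N2 HN2] := P_cvg d0.
exists (maxn N1 N2) => N t p N0N tN0.
have [j ->] : exists j, N = (maxn N1 N2 + j)%N.
  by exists (N - maxn N1 N2)%N; rewrite subnKC.
have S1 k q : (maxn N1 N2 <= k)%N -> ball (Phi 1 q) (e / 2) (S k 1 q).
  by move=> hk; apply: HN1 => //; apply: leq_trans hk; exact: leq_maxl.
have half x y : ball x (e / 2) y -> ball (x : M) e y by apply: le_ball; lra.
elim: j => [|j IH].
  by rewrite addn0 Theta_after//; apply: half; exact: S1.
have [tN|Nt] := ltP t (node (maxn N1 N2 + j)%N).
  rewrite -addn1 addnA -[(_ + _ + 1)%N]addnA addn1 in IH *.
  by rewrite addnS /= P_before ?ltW.
rewrite addnS /= Theta_after// (splitr e).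
apply: ball_triangle (S1 _ _ (leq_addr _ _)).
have psi1 q : psi 1 q = Phi 1 q by rewrite /psi clamp_id.
rewrite -!psi1; apply: Hd => //; apply: HN2.
by apply: leq_trans (leq_addr _ _); exact: leq_maxr.
Qed.

Let index (t : R) := xget 0%N [set N | t <= node N].

Let indexP t : t < 1 -> t <= node (index t).
Proof. by move=> t1; apply: (@xgetPex _ 0%N [set N | t <= node N]); exact: node_cofinal. Qed.

(** At t = 1 infinitely many stages are over, whence the limit value [Phi 1]. All Hamiltonians
    [Ham N] agree with [H0] at that time by [Ham_after], whence the value of [Ham_lim]. *)
Definition Theta_lim t : M -> M := if t < 1 then Theta (index t) t else Phi 1.
Definition Ham_lim t : M -> R := if t < 1 then Ham (index t) t else H0 t.

Lemma Theta_limE t p N : t < 1 -> t <= node N -> Theta_lim t p = Theta N t p.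
Proof.
move=> t1 tN; rewrite /Theta_lim t1.
case: (leqP N (index t)) => [h|/ltnW h].
  by rewrite -(subnKC h) Theta_stable.
by rewrite -[in RHS](subnKC h) Theta_stable//; exact: indexP.
Qed.

Lemma Ham_limE t p N : t < 1 -> t <= node N -> Ham_lim t p = Ham N t p.
Proof.
move=> t1 tN; rewrite /Ham_lim t1.
case: (leqP N (index t)) => [h|/ltnW h].
  by rewrite -(subnKC h) Ham_stable.
by rewrite -[in RHS](subnKC h) Ham_stable//; exact: indexP.
Qed.

(** Up to time [node N0] the sequence is eventually constant; later both sides are close to
    [Phi 1]. *)
Lemma Theta_cvg (e : R) : 0 < e -> exists N0, forall N, (N0 <= N)%N ->
  forall t p, t \in `[0, 1] -> ball (Theta_lim t p) e (Theta N t p).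
Proof.
move=> e0; have e2 : 0 < e / 2 by rewrite divr_gt0.
have [N0 HN0] := Theta_near_end e2; exists N0 => N N0N t p.
rewrite in_itv/= => /andP[_ t1].
have [tN0|N0t] := leP t (node N0).
  have t1' : t < 1 by apply: le_lt_trans tN0 (node_lt1 _).
  rewrite (@Theta_limE t p N) //; first exact: ballxx.
  by apply: le_trans tN0 (node_le _).
rewrite (splitr e); apply: ball_triangle (HN0 N t p N0N (ltW N0t)).
apply: ball_sym; rewrite {t1}/Theta_lim; case: ifPn => [t1|_]; last exact: ballxx.
pose N' := maxn N0 (index t).
have -> : Theta (index t) t p = Theta N' t p.
  have h : (index t <= N')%N by exact: leq_maxr.
  by rewrite -(subnKC h) Theta_stable//; exact: indexP.
by apply: HN0; [exact: leq_maxl|exact: ltW].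
Qed.

Lemma Ham_cvg N t p : (0 < N)%N -> t \in `[0, 1] ->
  `|Ham_lim t p - Ham N t p| <= 1 - node N.
Proof.
move=> N0; rewrite in_itv/= => /andP[_ t1].
have [t1'|t1'] := ltP t 1; last first.
  by rewrite /Ham_lim ltNge t1'/= Ham_after// subrr normr0 subr_ge0 ltW// node_lt1.
pose N' := maxn N (index t).
have h : (index t <= N')%N by exact: leq_maxr.
have h' : (N <= N')%N by exact: leq_maxl.
rewrite (@Ham_limE t p N' t1'); last by apply: le_trans (indexP t1') (node_le h).
rewrite -(subnKC h'); apply: le_trans (Ham_diff _ _ _ N0) _.
by rewrite lerD2r ltW// node_lt1.
Qed.

Lemma concatenated_system : continuous_system alpha Theta_lim Ham_lim.
Proof.
have joint_flow N : continuous (joint (Theta N)) by exact: flow_joint (flow_Theta N).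
have [cPhi' dPhi _] := cPhi.
have joint_ham N : continuous (joint (Ham N)) by exact: flow_continuous (flow_Theta N).
have Th0 N p : Theta N 0 p = p.
  have := @Theta_stable 0%N N 0 p; rewrite add0n node0 lexx => -> //.
have tail (e : R) : 0 < e -> exists N, 1 - node N < e.
  move=> e0; have h : 1 - e / 2 < 1 by rewrite gtrBl divr_gt0.
  have [N HN] := node_cofinal h; exists N; rewrite ltrBlDr -ltrBlDl.
  by apply: lt_le_trans HN; lra.
split.
- split.
  + apply: (@within_uniform_limit _ _ _ _ (fun N => joint (Theta N))) => // e e0.
    have [N HN] := Theta_cvg e0; exists N => -[t p]/= [t01 _]; exact: HN.
  + move=> t t01; rewrite /Theta_lim; case: ifPn => t1; last first.
      exact: dPhi.
    have [sF sG FK GK _ _] := flow_Theta (index t).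
    exists (ThetaV (index t) t); split=> //.
      exact: family_slice_continuous (proj1 sF).
    exact: family_slice_continuous (proj1 sG).
  + apply/funext => p; rewrite (@Theta_limE 0 p 0)// ?node0//; exact: Th0.
- apply: (@within_uniform_limit _ _ _ _ (fun N => joint (Ham N))) => // e e0.
  have [N HN] := tail e e0; exists N.+1 => -[t p]/= [t01 _].
  rewrite -ball_normE/=; apply: le_lt_trans (@Ham_cvg N.+1 t p isT t01) _.
  by apply: le_lt_trans HN; rewrite lerD2l lerN2 node_le.
(* The finite concatenations are themselves the approximating smooth systems. *)
exists Theta, Ham; split.
- move=> N; apply: flow_smooth_system (flow_Theta N) _.
  by apply/funext => p; exact: Th0.
- apply/uniform_cvgP => e e0; have [N0 HN0] := Theta_cvg e0.
  by exists N0 => N N0N -[t p]/= [t01 _]; exact: HN0.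
- apply/cvgrPdist_lt => e e0.
  (* [norm_oo_le] loses a factor 3 against the uniform bound, so a quarter of [e] leaves a strict
     inequality. *)
  have e3 : 0 < e / 4 by rewrite divr_gt0.
  have [N0 HN0] := tail _ e3; exists N0.+1 => // N /= N0N.
  have N1 : (0 < N)%N by exact: leq_trans N0N.
  have cK t : t \in `[0, 1] -> continuous (fun p => Ham_lim t p - Ham N t p).
    move=> t01 p; apply: (@for_continuousB _ _ (Ham_lim t) (Ham N t)); last exact: joint_section.
    rewrite /Ham_lim; case: ifP => _; first exact: joint_section.
    by apply: joint_section; exact: (joint_ham 0%N).
  have /andP[b0 b1] := @norm_oo_le _ _ _ _ M_nonempty M_compact alpha alpha_contact
    (fun t x => Ham_lim t x - Ham N t x) _ cK (fun t p t01 => @Ham_cvg N t p N1 t01).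
  rewrite sub0r normrN ger0_norm//; apply: le_lt_trans b1 _.
  have := node_le (R:=R) (ltnW N0N); lra.
Qed.

Lemma Theta_lim1 : Theta_lim 1 = Phi 1.
Proof. by rewrite /Theta_lim ltxx. Qed.

End Concatenation.

(** * Choice of the subsequence and conclusion *)

Section Coincidence.
Context {R : realType} {M : metricType R} {n : nat} {A : smooth_atlas R M n.*2.+1}.
Hypotheses (M_nonempty : [set: M] !=set0) (M_compact : compact [set: M]).
Variable alpha : one_form A.
Hypothesis alpha_contact : contact_form alpha.
Local Notation mu := (@lebesgue_measure R).

Lemma topological_continuous_time_one (Phi : R -> M -> M) (H : R -> M -> R) :
  topological_system alpha Phi H ->
  exists (Theta : R -> M -> M) (K : R -> M -> R),
    continuous_system alpha Theta K /\ Theta 1 = Phi 1.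
Proof.
move=> [cPhi HL [Phi_ [H_ [sys /uniform_cvgP cvgP cvgH]]]].
have M_hausdorff : hausdorff_space M := @metric_hausdorff R M.
have cH_ i : continuous (joint (fun t => H_ i (clamp t))).
  exact: (system_hamiltonian_continuous M_compact M_hausdorff (sys i)).
have cauchy := L1_cauchy M_nonempty M_compact alpha_contact HL cH_ cvgH.
have [C C0 HC] := connecting_flow M_nonempty M_compact alpha.
(* With this choice the bound of [connecting_flow], C eps divided by the length of the stage, is
   exactly that length. *)
pose eps k : R := (node k.+1 - node k) ^+ 2 / C.
have nd k : 0 < node k.+1 - node k :> R by rewrite subr_gt0 node_lt.
have eps0 k : 0 < eps k by rewrite divr_gt0// exprn_gt0.
have [Nn HNn] := choice (fun k => cauchy (eps k) (eps0 k)).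
(* The summand k makes the indices tend to infinity. The sum includes [Nn k.+1], so that both
   [sigma k] and [sigma k.+1] are large enough for stage k+1, which connects these two systems. *)
pose sigma k := (k + \sum_(l < k.+2) Nn l)%N.
have sigma_ge k l : (l < k.+2)%N -> (Nn l <= sigma k)%N.
  move=> lk; apply: leq_trans (leq_addl _ _).
  by rewrite (bigD1 (Ordinal lk))//= leq_addr.
have [G0 [K0 [flow0 K00]]] := constant_flow M_compact (sys 0%N).
pose S k := if k is k'.+1 then Phi_ (sigma k') else fun _ => id.
pose SH k := if k is k'.+1 then H_ (sigma k') else K0.
have sysS k : smooth_system alpha (S k) (SH k).
  by case: k => [|k]; [exact: flow_smooth_system flow0 _|exact: sys].
have stage k : exists PQL : (R -> M -> M) * (R -> M -> M) * (R -> M -> R),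
    flow alpha PQL.1.1 PQL.1.2 PQL.2 /\
    [/\ forall t q, (0 < k)%N -> `|PQL.2 t q| <= node k.+1 - node k,
      forall t q, t <= node k \/ node k.+1 <= t -> PQL.2 t q = 0,
      forall t p, t <= node k -> PQL.1.1 t p = p,
      forall t p, node k.+1 <= t -> S k 1 (PQL.1.1 t p) = S k.+1 1 p &
      forall t, exists2 u, u \in `[0, 1] & forall p, S k u (PQL.1.1 t p) = S k.+1 u p].
  pose I := \int[mu]_(t in `[0, 1]) supn (fun p => SH k.+1 (clamp t) p - SH k (clamp t) p).
  have [e Ie ek] : exists2 e, I < e & (0 < k)%N -> e = eps k.
    have [k0|k0] := posnP k; first by exists (I + 1); rewrite ?ltrDl// k0.
    exists (eps k) => //; rewrite /I; clear I; case: k k0 => // k _.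
    by apply: (HNn k.+1); apply: sigma_ge.
  have [P [Q [L [fP [Lle L0 P0 P1 PS]]]]] := HC _ _ _ _ _ _ _ (sysS k) (sysS k.+1) (node_lt k) Ie.
  exists (P, Q, L); split=> //; split=> // t q k0.
  apply: le_trans (Lle t q) _; rewrite (ek k0) /eps.
  by rewrite le_eqVlt; apply/orP; left; apply/eqP; field; rewrite !gt_eqF.
have [PQL HPQL] := choice stage.
have S_cvg (e : R) : 0 < e -> exists N, forall k, (N <= k)%N ->
    forall u p, u \in `[0, 1] -> ball (Phi u p) e (S k u p).
  move=> e0; have [N HN] := cvgP e e0; exists N.+1 => -[//|k] Nk u p u01 /=.
  by apply: (HN (sigma k) _ (u, p)) => //; apply: leq_trans (leq_addr _ _).
have sys' := @concatenated_system R M n A M_nonempty M_compact alpha alpha_contact Phi S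
  (fun k => (PQL k).1.1) (fun k => (PQL k).1.2) (fun k => (PQL k).2) (fun _ => id) G0 K0
  cPhi erefl S_cvg flow0 (fun t p => erefl)
  (fun k => proj1 (HPQL k)).
exists (Theta_lim Phi (fun k => (PQL k).1.1) (fun _ => id)).
exists (Ham_lim (fun k => (PQL k).1.2) (fun k => (PQL k).2) G0 K0).
split; last exact: Theta_lim1.
apply: sys'.
- by move=> k t q; have [_ [h _ _ _ _]] := HPQL k; exact: h.
- by move=> k t q; have [_ [_ h _ _ _]] := HPQL k; exact: h.
- by move=> k t q; have [_ [_ _ h _ _]] := HPQL k; exact: h.
- by move=> k t q; have [_ [_ _ _ h _]] := HPQL k; exact: h.
- by move=> k t; have [_ [_ _ _ _ h]] := HPQL k; exact: h.
Qed.

End Coincidence.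

Theorem theorem5p8 (R : realType) (n : nat) (M : metricType R)
    (M_nonempty : [set: M] !=set0)
    (M_compact : compact [set: M])
    (M_connected : connected [set: M])
    (A : smooth_atlas R M n.*2.+1) (alpha : one_form A)
    (alpha_contact : contact_form alpha) :
  Homeo_1oo alpha = Homeo_oo alpha.
Proof.
apply/seteqP; split=> phi [Phi [H [sys ->]]].
  have [Psi [K [sysK PsiE]]] :=
    topological_continuous_time_one M_nonempty M_compact alpha_contact sys.
  by exists Psi, K.
exists Phi, H; split=> //.
exact: continuous_topological_system.
Qed.
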